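(* Let $a>0$, $R\ge 0$ and let $\alpha\in\mathbb{C}$ with $\Re\alpha>-1$. (i) For every $F\in H(a,R)$, the functions $F(t,\alpha)=\mathcal{D}_\alpha\{F(t)\}$ and $F^*(t,\alpha)=\mathcal{I}_\alpha\{F(t)\}$ belong to $H(a,R)$. (ii) The following equalities hold: $$\mathcal{D}_\alpha H(a,R)=H(a,R),\qquad \mathcal{I}_\alpha H(a,R)=H(a,R),$$ $$\hat{\mathcal{D}}_\alpha S(a,R)=S(a,R),\qquad \hat{\mathcal{I}}_\alpha S(a,R)=S(a,R),$$ $$\mathcal{D}_\alpha H=H,\qquad \mathcal{I}_\alpha H=H,\qquad \hat{\mathcal{D}}_\alpha S=S,\qquad \hat{\mathcal{I}}_\alpha S=S,$$ and each of these operators, acting between the indicated spaces, is bijective.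
   Context: For $a>0$ let $\mathfrak{D}(a)=\{t\in\mathbb{C}:\operatorname{dist}(t,(0,+\infty))<a\}$, with boundary $\gamma(a)=\{t\in\mathbb{C}:\operatorname{dist}(t,(0,+\infty))=a\}$. For $a>0$ and $R\ge 0$, $H(a,R)$ is the linear space of all functions $F$ that are analytic in $\mathfrak{D}(a)$ and have exponential growth of type $R$ at infinity in $\mathfrak{D}(a)$. This is understood as follows: $F$ is of at most exponential growth at infinity in $\mathfrak{D}(A)$ for every $0<A<a$, and for every $r>R$ and every $0<A<a$, $$\|F\|_{r,A}=\int_{\gamma(A)}e^{-r|t|}|F(t)|\,|dt|<\infty .$$ Put $H=\bigcup_{a>0,R\ge 0}H(a,R)$. The Laplace transform operator is $$\mathcal{L}\{F(t)\}(\zeta)=\zeta\int_0^{+\infty}e^{-\zeta t}F(t)\,dt,$$ which converges absolutely for $\Re\zeta>R$ when $F\in H(a,R)$. Put $S(a,R)=\mathcal{L}H(a,R)$ and $S=\mathcal{L}H=\bigcup_{a>0,R\ge0}S(a,R)$; $\mathcal{L}:H\to S$ is a bijection. For $\alpha\in\mathbb{C}$, $\Re\alpha>-1$, the operator $\mathcal{L}_\alpha$ on $H$ is $$\mathcal{L}_\alpha\{F(t)\}(\zeta)=\zeta^{\alpha}\mathcal{L}\{t^\alpha F(t)\}(\zeta)=\zeta^{1+\alpha}\int_0^{+\infty}e^{-\zeta t}t^\alpha F(t)\,dt$$ (principal powers). The operators of fractional differentiation and integration of order $\alpha$ are $$\mathcal{D}_\alpha=\mathcal{L}^{-1}\mathcal{L}_\alpha,\quad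 \mathcal{I}_\alpha=\mathcal{L}_\alpha^{-1}\mathcal{L}\quad\text{(on }H),\qquad \hat{\mathcal{D}}_\alpha=\mathcal{L}_\alpha\mathcal{L}^{-1},\quad \hat{\mathcal{I}}_\alpha=\mathcal{L}\mathcal{L}_\alpha^{-1}\quad\text{(on }S).$$ That is, $\mathcal{D}_\alpha F$ is the function $G$ with $\mathcal{L}G=\mathcal{L}_\alpha F$, and $\mathcal{I}_\alpha F$ is the function $G$ with $\mathcal{L}_\alpha G=\mathcal{L}F$. If $F(t)=\sum_{k\ge0}f_kt^k$ near $0$, then near $0$ $$\mathcal{D}_\alpha\{F\}(t)=\sum_{k\ge0}\frac{\Gamma(\alpha+k+1)}{k!}f_kt^k,\qquad \mathcal{I}_\alpha\{F\}(t)=\sum_{k\ge0}\frac{k!}{\Gamma(\alpha+k+1)}f_kt^k .$$ *)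

(* Defs.v *)
From HB Require Import structures.
From mathcomp Require Import all_boot all_order all_algebra.
From mathcomp Require Import generic_quotient complex.
From mathcomp Require Import all_classical all_reals all_analysis.

Set Implicit Arguments.
Unset Strict Implicit.
Unset Printing Implicit Defensive.

Import Order.TTheory GRing.Theory Num.Theory.
Import numFieldNormedType.Exports.
Import ComplexField.Normc.

Local Open Scope classical_set_scope.
Local Open Scope ring_scope.
Local Open Scope complex_scope.
Local Open Scope quotient_scope.

Section ComplexFunctions.
Variable R : realType.
Implicit Types (z w : R[i]) (D : set R) (f : R -> R[i]).

Definition cexp z : R[i] :=
  (expR (complex.Re z) * cos (complex.Im z)) +i*
  (expR (complex.Re z) * sin (complex.Im z)).

(* Values in (-pi, pi]; irrelevant at 0. *)
Definition principal_arg z : R :=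
  if 0 <= complex.Im z then acos (complex.Re z / normc z)
  else - acos (complex.Re z / normc z).

Definition clog z : R[i] := ln (normc z) +i* principal_arg z.

Definition cpow z w : R[i] := cexp (w * clog z).

(* Lebesgue integral of a complex-valued function of a real variable; like
   [Rintegral], it is meaningful when the real and imaginary parts are
   integrable. *)
Definition Cintegral D f : R[i] :=
  Rintegral lebesgue_measure D (fun x => complex.Re (f x)) +i*
  Rintegral lebesgue_measure D (fun x => complex.Im (f x)).

Definition analytic_on (U : set R[i]) (F : R[i] -> R[i]) : Prop :=
  forall t0, U t0 -> exists (c : nat -> R[i]) (e : R), 0 < e /\
    forall t, normc (t - t0) < e ->
      series (fun k => c k * (t - t0) ^+ k : R[i]^o) @ \oo --> (F t : R[i]^o).

End ComplexFunctions.

Section Spaces.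
Variable R : realType.
Implicit Types (a r A x : R) (t zeta alpha : R[i]) (F G : R[i] -> R[i]).

Definition dist_ray t : R := inf [set normc (t - x%:C) | x in `]0, +oo[].

Definition strip a : set R[i] := [set t | dist_ray t < a].

Definition exp_growth_on (U : set R[i]) F : Prop :=
  exists M c N : R, forall t, U t -> N <= normc t ->
    normc (F t) <= M * expR (c * normc t).

Definition weighted r F t : \bar R := (expR (- r * normc t) * normc (F t))%:E.

(* The integral of exp (-r |t|) |F t| |dt| over the boundary of [strip A]: this
   curve consists of the half-lines x + iA and x - iA, x > 0, and of the
   half-circle of radius A about 0 in the left half-plane. *)
Definition boundary_norm r A F : \bar R :=
  (\int[lebesgue_measure]_(x in `]0%R, +oo[) weighted r F (x +i* A)
   + \int[lebesgue_measure]_(x in `]0%R, +oo[) weighted r F (x -i* A)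
   + A%:E * \int[lebesgue_measure]_(s in `[(pi / 2)%R, (3 * pi / 2)%R])
              weighted r F ((A * cos s)%R +i* (A * sin s)%R))%E.

Definition in_H a rho F : Prop :=
  [/\ analytic_on (strip a) F,
      forall A, 0 < A < a -> exp_growth_on (strip A) F &
      forall r A, rho < r -> 0 < A < a -> (boundary_norm r A F < +oo)%E].

(* Functions on different strips (resp. right half-planes) are compared after
   restriction to a common one, so the union over all a and rho is taken in a
   space of germs along the half-line (resp. at +oo). By the identity theorem a
   germ determines its analytic representative on the whole strip. *)
Definition eq_ray F G : bool :=
  `[< exists2 a, 0 < a & forall t, strip a t -> F t = G t >].

Definition eq_halfplane F G : bool :=
  `[< exists rho : R, forall zeta, rho < complex.Re zeta -> F zeta = G zeta >].

Lemma eq_ray_equiv : equiv_class_of eq_ray.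
Proof.
split=> [F|F G|F G K].
- by apply/asboolP; exists 1.
- by apply/asboolP/asboolP => -[a a0 FG]; exists a => // t /FG.
- move=> /asboolP[a a0 FG] /asboolP[b b0 GK]; apply/asboolP.
  exists (Num.min a b) => [|t]; first by rewrite lt_min a0.
  by rewrite /strip/= lt_min => /andP[ta tb]; rewrite FG// GK.
Qed.

Canonical eq_ray_equiv_rel := EquivRelPack eq_ray_equiv.

Lemma eq_halfplane_equiv : equiv_class_of eq_halfplane.
Proof.
split=> [F|F G|F G K].
- by apply/asboolP; exists 0.
- by apply/asboolP/asboolP => -[a FG]; exists a => t /FG.
- move=> /asboolP[a FG] /asboolP[b GK]; apply/asboolP.
  by exists (Num.max a b) => t; rewrite gt_max => /andP[ta tb]; rewrite FG// GK.
Qed.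

Canonical eq_halfplane_equiv_rel := EquivRelPack eq_halfplane_equiv.

Definition ray_germ := {eq_quot eq_ray}.
Definition halfplane_germ := {eq_quot eq_halfplane}.

Definition H_space a rho : set ray_germ := [set \pi_ray_germ F | F in in_H a rho].

Definition H_union : set ray_germ :=
  [set g | exists a rho, [/\ 0 < a, 0 <= rho & H_space a rho g]].

Definition laplace F zeta : R[i] :=
  zeta * Cintegral `]0, +oo[ (fun x => cexp (- (zeta * x%:C)) * F x%:C).

Definition laplace_pow alpha F zeta : R[i] :=
  cpow zeta alpha * laplace (fun t => cpow t alpha * F t) zeta.

(* The transforms only involve the values on (0, +oo), which are the same for
   all the representatives of a germ: see [Lap_pi] and [Lap_pow_pi]. *)
Definition Lap (g : ray_germ) : halfplane_germ :=
  \pi_halfplane_germ (laplace (repr g)).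

Definition Lap_pow alpha (g : ray_germ) : halfplane_germ :=
  \pi_halfplane_germ (laplace_pow alpha (repr g)).

Lemma strip_ray a x : 0 < a -> 0 < x -> strip a x%:C.
Proof.
move=> a0 x0; apply: le_lt_trans a0; apply: ge_inf; last first.
  by exists x; rewrite ?subrr ?normc0 //= in_itv/= x0.
by exists 0 => _ [y _ <-]; rewrite /normc; case: (_ - _) => u v; exact: sqrtr_ge0.
Qed.

Lemma repr_ray F x : 0 < x -> repr (\pi_ray_germ F) x%:C = F x%:C.
Proof.
move=> x0; have /asboolP[a a0] : eq_ray (repr (\pi_ray_germ F)) F.
  by apply/(@eqquotP _ _ ray_germ); rewrite reprK.
by apply; exact: strip_ray.
Qed.

Lemma eq_laplace F G : (forall x, 0 < x -> F x%:C = G x%:C) ->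
  laplace F = laplace G.
Proof.
move=> FG; apply/funext => z; congr (_ * (_ +i* _)); apply: eq_Rintegral => x;
  by rewrite inE/= in_itv/= andbT => x0; rewrite /= FG.
Qed.

Lemma Lap_pi F : Lap (\pi_ray_germ F) = \pi_halfplane_germ (laplace F).
Proof. by congr (\pi_halfplane_germ _); apply: eq_laplace => x; exact: repr_ray. Qed.

Lemma Lap_pow_pi alpha F : Lap_pow alpha (\pi_ray_germ F) =
  \pi_halfplane_germ (laplace_pow alpha F).
Proof.
congr (\pi_halfplane_germ _); apply/funext => z; congr (_ * _).
by congr (_ z); apply: eq_laplace => x x0; rewrite repr_ray.
Qed.

Definition S_space a rho : set halfplane_germ := Lap @` H_space a rho.

Definition S_union : set halfplane_germ := Lap @` H_union.

Definition Lap_inv : halfplane_germ -> ray_germ :=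
  'pinv_(fun=> \pi_ray_germ 0) H_union Lap.

Definition Lap_pow_inv alpha : halfplane_germ -> ray_germ :=
  'pinv_(fun=> \pi_ray_germ 0) H_union (Lap_pow alpha).

Definition frac_diff alpha : ray_germ -> ray_germ := Lap_inv \o Lap_pow alpha.

Definition frac_int alpha : ray_germ -> ray_germ := Lap_pow_inv alpha \o Lap.

Definition frac_diff_hat alpha : halfplane_germ -> halfplane_germ :=
  Lap_pow alpha \o Lap_inv.

Definition frac_int_hat alpha : halfplane_germ -> halfplane_germ :=
  Lap \o Lap_pow_inv alpha.

End Spaces.

Arguments H_union {R}.
Arguments S_union {R}.

(* Main.v *)
(* Write L_p F (z) = z^(1+p) int_0^oo e^(-z t) t^p F(t) dt. Everything follows from
   two facts: for all exponents p, q of real part > -1 and all F in H(a, rho) there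
   is a G in H(a, rho) with L_q G = L_p F, and L_p is injective on H.

   Integration by parts gives L_p (t F' + (p+1) F) = L_(p+1) F, which lowers the
   exponent by one, and a convolution gives
     L_(p+q) (int_0^1 s^p (1-s)^(q-1) F(s t) ds) = Gamma(q) L_p F,
   which raises it by q if Gamma(q) <> 0; both operators preserve H(a, rho) because
   the strip is star-shaped about 0. Raising by 2 + delta and lowering twice moves
   the exponent by delta. As Gamma does not vanish near 2, finitely many small steps
   lead from p to q. Preservation of H(a, rho) rests on a pointwise description of
   this space: F = O(e^(r |t|)) on every smaller strip for every r > rho.

   For injectivity, Watson's lemma recovers from L_p F the Taylor coefficients of F
   at 0 multiplied by values of Gamma; that Gamma has no zeros follows from the
   first fact applied to F = 1.

   Complex analysis is done without contour integrals: Taylor expansions with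
   uniform remainders are obtained by applying the maximum principle to iterated
   difference quotients. *)

Require Import Defs.
From HB Require Import structures.
From mathcomp Require Import all_boot all_order all_algebra.
From mathcomp Require Import generic_quotient complex.
From mathcomp Require Import all_classical all_reals all_analysis.
From mathcomp Require Import measurable_realfun ring lra.
Import Order.TTheory GRing.Theory Num.Theory.
Import numFieldNormedType.Exports.
Import ComplexField.Normc.
Local Open Scope classical_set_scope.
Local Open Scope ring_scope.
Local Open Scope complex_scope.

Set Implicit Arguments.
Unset Strict Implicit.
Unset Printing Implicit Defensive.

Local Notation Re := complex.Re.
Local Notation Im := complex.Im.

(** * Holomorphic functions by polynomial approximation *)

(** Nonvanishing of Gamma is wanted at both ends: raising an exponent by q divides by Gamma(q),
    while recovering Taylor coefficients divides by Gamma(alpha + k + 1) for every k. Circularity is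
    avoided because only values near Gamma(2) enter the change of exponent, and these are handled by
    a direct estimate. Steps near 2 have a second advantage: Re q >= 1 there, so (1-s)^(q-1) is
    bounded and the convolution has one singular factor only.

    Membership in H is an L1 condition on boundary curves. Without Cauchy's formula such integrals
    do not control F inside, but they do control a primitive along the two half-lines. The primitive
    used is t int_0^1 F(s t) ds, an average along segments like those that raise exponents, so one
    theory of averages serves both purposes.

    The identity int_0^oo e^(-z t) t^p dt = Gamma(p+1) z^(-p-1) for complex z would usually come
    from rotating a contour. Here z^(p+1) times the integral is differentiated along the segment
    from 1 to z, and the functional equation of Gamma makes the derivative vanish. *)

Section Norm.
Variable R : realType.
Implicit Types (z w : R[i]) (x y : R).

Lemma normc_ge0 z : 0 <= normc z.
Proof. by case: z => x y; exact: sqrtr_ge0. Qed.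

Lemma normc_sqr z : normc z ^+ 2 = Re z ^+ 2 + Im z ^+ 2.
Proof. by case: z => x y /=; rewrite sqr_sqrtr// addr_ge0// sqr_ge0. Qed.

Lemma normcD z w : normc (z + w) <= normc z + normc w.
Proof. exact: le_normcD. Qed.

Lemma normcNE z : normc (- z) = normc z.
Proof. exact: normcN. Qed.

Lemma normcB z w : normc (z - w) <= normc z + normc w.
Proof. by rewrite -(normcNE w); exact: normcD. Qed.

Lemma normcBC z w : normc (z - w) = normc (w - z).
Proof. by rewrite -normcNE opprB. Qed.

Lemma normcX z n : normc (z ^+ n) = normc z ^+ n.
Proof. by elim: n => [|n IH]; rewrite ?expr0 ?normc1// !exprS normcM IH. Qed.

Lemma normc_real x : normc x%:C = `|x|.
Proof. by rewrite /= expr0n addr0 sqrtr_sqr. Qed.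

Lemma normc_eq0 z : (normc z == 0) = (z == 0).
Proof.
by apply/eqP/eqP => [/eq0_normc//|->]; rewrite normc0.
Qed.

Lemma normc_gt0 z : (0 < normc z) = (z != 0).
Proof. by rewrite lt_def normc_ge0 andbT normc_eq0. Qed.

Lemma normRe z : `|Re z| <= normc z.
Proof.
rewrite -(@ler_pXn2r _ 2) ?nnegrE ?normc_ge0// normc_sqr -normrX ger0_norm ?sqr_ge0//.
by rewrite lerDl sqr_ge0.
Qed.

Lemma normIm z : `|Im z| <= normc z.
Proof.
rewrite -(@ler_pXn2r _ 2) ?nnegrE ?normc_ge0// normc_sqr -normrX ger0_norm ?sqr_ge0//.
by rewrite lerDr sqr_ge0.
Qed.

Lemma normc_le z : normc z <= `|Re z| + `|Im z|.
Proof.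
rewrite -(@ler_pXn2r _ 2) ?nnegrE ?normc_ge0 ?addr_ge0// normc_sqr sqrrD.
rewrite !real_normK ?num_real// addrAC lerDl.
by rewrite mulrn_wge0 // mulr_ge0.
Qed.

Lemma normc_sum (I : Type) (r : seq I) (P : pred I) (F : I -> R[i]) :
  normc (\sum_(i <- r | P i) F i) <= \sum_(i <- r | P i) normc (F i).
Proof.
elim/big_ind2 : _ => [|x1 x2 y1 y2 h1 h2|//]; first by rewrite normc0.
by apply: le_trans (normcD _ _) _; exact: lerD.
Qed.

Lemma ReD z w : Re (z + w) = Re z + Re w.
Proof. by case: z; case: w. Qed.
Lemma ImD z w : Im (z + w) = Im z + Im w.
Proof. by case: z; case: w. Qed.
Lemma ReN z : Re (- z) = - Re z.
Proof. by case: z. Qed.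
Lemma ImN z : Im (- z) = - Im z.
Proof. by case: z. Qed.
Lemma cReM z w : Re (z * w) = Re z * Re w - Im z * Im w.
Proof. by case: z; case: w. Qed.
Lemma cImM z w : Im (z * w) = Re z * Im w + Im z * Re w.
Proof. by case: z; case: w. Qed.

Lemma complexP z w : Re z = Re w -> Im z = Im w -> z = w.
Proof. by case: z; case: w => a b c d /= -> ->. Qed.

End Norm.

(** * Polynomial jets *)

Section Jets.
Variable R : realType.
Implicit Types (z w t : R[i]) (g h : R[i] -> R[i]) (n : nat) (p : {poly R[i]}).

(** [p] is not truncated below degree [n]: its higher terms are O(|z|^n) and harmless, so products
    and compositions need no bookkeeping of degrees. *)
Definition jet n g := exists p (M e : R), [/\ 0 <= M, 0 < e &
  forall z, normc z < e -> normc (g z - p.[z]) <= M * normc z ^+ n].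

(* Unlike complex differentiability, approximability by polynomials to every order
   passes directly to difference quotients, see [jet_dquot]. *)
Definition holo_at g t := forall n, jet n (fun z => g (t + z)).

Definition holo (U : set R[i]) g := forall t, U t -> holo_at g t.

Lemma poly_bound p : exists2 B : R, 0 <= B & forall z, normc z <= 1 -> normc p.[z] <= B.
Proof.
exists (\sum_(i < size p) normc p`_i).
  by apply: sumr_ge0 => i _; exact: normc_ge0.
move=> z z1; rewrite horner_coef (le_trans (normc_sum _ _ _))//.
apply: ler_sum => i _; rewrite normcM normcX ler_piMr ?normc_ge0//.
by rewrite exprn_ile1 ?normc_ge0.
Qed.

Lemma jet_ext n g h (e : R) : 0 < e -> (forall z, normc z < e -> g z = h z) ->
  jet n g -> jet n h.
Proof.
move=> e0 gh [p [M [d [M0 d0 gp]]]]; exists p, M, (Num.min e d); split=> //.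
  by rewrite lt_min e0.
by move=> z; rewrite lt_min => /andP[ze zd]; rewrite -gh// gp.
Qed.

Lemma jet_le m n g : (m <= n)%N -> jet n g -> jet m g.
Proof.
move=> mn [p [M [d [M0 d0 gp]]]]; exists p, M, (Num.min 1 d); split=> //.
  by rewrite lt_min ltr01.
move=> z; rewrite lt_min => /andP[ze zd]; apply: le_trans (gp _ zd) _.
by apply: ler_wpM2l => //; apply: ler_wiXn2l => //; [exact: normc_ge0|exact: ltW].
Qed.

Lemma jet_poly n p : jet n (horner p).
Proof.
exists p, 0, 1; split=> // z _; by rewrite subrr normc0 mul0r.
Qed.

Lemma jet_cst n w : jet n (cst w).
Proof. by apply: (jet_ext ltr01 _ (jet_poly n w%:P)) => z _; rewrite hornerC. Qed.

Lemma jet_id n : jet n id.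
Proof. by apply: (jet_ext ltr01 _ (jet_poly n 'X)) => z _; rewrite hornerX. Qed.

Lemma jetD n g h : jet n g -> jet n h -> jet n (fun z => g z + h z).
Proof.
move=> [p [M [d [M0 d0 gp]]]] [q [L [e [L0 e0 hq]]]].
exists (p + q), (M + L), (Num.min d e); split; first exact: addr_ge0.
  by rewrite lt_min d0.
move=> z; rewrite lt_min => /andP[zd ze]; rewrite hornerD opprD addrACA mulrDl.
by apply: le_trans (normcD _ _) _; apply: lerD; [exact: gp|exact: hq].
Qed.

Lemma jetM n g h : jet n g -> jet n h -> jet n (fun z => g z * h z).
Proof.
move=> [p [M [d [M0 d0 gp]]]] [q [L [e [L0 e0 hq]]]].
have [A A0 pA] := poly_bound p; have [B B0 qB] := poly_bound q.
exists (p * q), (M * (B + L) + A * L), (Num.min 1 (Num.min d e)); split.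
- by rewrite addr_ge0// mulr_ge0// addr_ge0.
- by rewrite !lt_min ltr01 d0.
move=> z; rewrite !lt_min => /andP[/ltW z1 /andP[zd ze]]; rewrite hornerM.
have -> : g z * h z - p.[z] * q.[z] =
  (g z - p.[z]) * (q.[z] + (h z - q.[z])) + p.[z] * (h z - q.[z]) by ring.
rewrite (le_trans (normcD _ _))// [leRHS]mulrDl; apply: lerD; last first.
  rewrite normcM -mulrA; apply: ler_pM; rewrite ?normc_ge0//; first exact: pA.
  exact: hq.
rewrite normcM mulrAC; apply: ler_pM; rewrite ?normc_ge0//; first exact: gp.
apply: le_trans (normcD _ _) _; apply: lerD; first exact: qB.
apply: le_trans (hq _ ze) _; rewrite ler_piMr//.
by rewrite exprn_ile1 ?normc_ge0.
Qed.

Lemma jetZ n w g : jet n g -> jet n (fun z => w * g z).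
Proof. by move=> /(jetM (jet_cst n w)). Qed.

Lemma jetN n g : jet n g -> jet n (fun z => - g z).
Proof. by move=> /(jetZ (-1)); apply: (jet_ext ltr01) => z _; rewrite mulN1r. Qed.

Lemma jetB n g h : jet n g -> jet n h -> jet n (fun z => g z - h z).
Proof. by move=> ? ?; apply: jetD => //; exact: jetN. Qed.

(** Truncated geometric series of 1/(w + z): the exact error is (-z/w)^n / (w + z), and |w + z| >=
    |w|/2 on the chosen disc. *)
Lemma jetV n w : w != 0 -> jet n (fun z => (w + z)^-1).
Proof.
move=> w0; have Nw0 : 0 < normc w by rewrite normc_gt0.
exists (\sum_(i < n) (- w^-1) ^+ i *: 'X^i * (w^-1)%:P),
  (normc (w^-1) ^+ n * (2 / normc w)), (normc w / 2); split.
- by rewrite mulr_ge0 ?exprn_ge0 ?normc_ge0// mulr_ge0 ?invr_ge0 ?normc_ge0.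
- exact: divr_gt0.
move=> z zw; have wz2 : normc w / 2 <= normc (w + z).
  have : normc w <= normc (w + z) + normc z.
    by rewrite -(normcNE z); apply: le_trans (normcD _ _); rewrite addrK.
  by move: zw; lra.
have wz0 : w + z != 0 by rewrite -normc_gt0 (lt_le_trans _ wz2)// divr_gt0.
have -> : (\sum_(i < n) (- w^-1) ^+ i *: 'X^i * (w^-1)%:P).[z] =
    (w + z)^-1 * (1 - (- w^-1 * z) ^+ n).
  rewrite horner_sum.
  have -> : \sum_(i < n) ((- w^-1) ^+ i *: 'X^i * (w^-1)%:P).[z] =
     w^-1 * \sum_(i < n) (- w^-1 * z) ^+ i.
    rewrite mulr_sumr; apply: eq_bigr => i _.
    by rewrite hornerM hornerZ hornerXn hornerC exprMn mulrC.
  have E : (w + z)^-1 * (w * (1 - - w^-1 * z)) = 1.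
    have -> : w * (1 - - w^-1 * z) = w + z by field.
    by rewrite mulVf.
  rewrite -(@opprB _ _ 1) subrX1 -[LHS]mul1r -{1}E; field.
  by rewrite w0 wz0.
have -> : (w + z)^-1 - (w + z)^-1 * (1 - (- w^-1 * z) ^+ n) =
  (- w^-1 * z) ^+ n * (w + z)^-1 by field.
rewrite normcM normcX normcM normcNE exprMn mulrAC; apply: ler_wpM2r.
  by rewrite exprn_ge0 ?normc_ge0.
apply: ler_wpM2l; first by rewrite exprn_ge0 ?normc_ge0.
by rewrite normcV -[leRHS]invf_div lef_pV2 ?posrE ?divr_gt0// normc_gt0.
Qed.

Lemma jet0E n p (M e : R) g : (0 < n)%N -> 0 < e ->
  (forall z, normc z < e -> normc (g z - p.[z]) <= M * normc z ^+ n) -> g 0 = p`_0.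
Proof.
move=> n0 e0 /(_ 0); rewrite normc0 expr0n eqn0Ngt n0 mulr0 => /(_ e0) h.
apply/eqP; rewrite -subr_eq0 -normc_eq0 eq_le normc_ge0 andbT.
by rewrite -horner_coef0.
Qed.

Lemma jet_lip g : jet 1 g -> exists M e : R, [/\ 0 <= M, 0 < e &
  forall z, normc z < e -> normc (g z - g 0) <= M * normc z].
Proof.
move=> [p [M [e [M0 e0 gp]]]].
have [B B0 pB] := poly_bound (drop_poly 1 p).
exists (M + B), (Num.min e 1); split; [exact: addr_ge0|by rewrite lt_min e0 ltr01|].
move=> z; rewrite lt_min => /andP[ze /ltW z1].
have -> : g z - g 0 = (g z - p.[z]) + (drop_poly 1 p).[z] * z.
  rewrite (jet0E _ e0 gp)// -{2}(poly_take_drop 1 p) hornerD expr1 hornerMX.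
  have -> : take_poly 1 p = (p`_0)%:P.
    apply/polyP => i; rewrite coef_take_poly coefC.
    by case: i => [|i].
  by rewrite hornerC; ring.
rewrite mulrDl (le_trans (normcD _ _))//; apply: lerD.
  by have := gp z ze; rewrite expr1.
by rewrite normcM ler_wpM2r ?normc_ge0// pB.
Qed.

End Jets.

(** * The maximum principle on compact sets *)

Section MaxPrinciple.
Variable R : realType.
Implicit Types (z w t : R[i]) (g Q : R[i] -> R[i]) (K B : set R[i]).

(** This serves as continuity of functions of a complex variable: first-order jets provide it, and
    it yields continuity on R * R as well as measurability along lines. *)
Definition lip_at g t := exists M e : R, [/\ 0 <= M, 0 < e &
  forall z, normc z < e -> normc (g (t + z) - g t) <= M * normc z].

Lemma holo_lip g t : holo_at g t -> lip_at g t.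
Proof.
move=> /(_ 1) /jet_lip[M [e [M0 e0 h]]]; exists M, e; split=> // z ze.
by have := h z ze; rewrite addr0.
Qed.

Lemma lip_continuous g t : lip_at g t ->
  {for (Re t, Im t), continuous (fun q : R * R => Re (g (q.1 +i* q.2)))} /\
  {for (Re t, Im t), continuous (fun q : R * R => Im (g (q.1 +i* q.2)))}.
Proof.
move=> [M [e [M0 e0 h]]].
have H (d : R) : 0 < d -> \forall q \near (Re t, Im t),
    normc (g (q.1 +i* q.2) - g t) < d.
  move=> d0; pose r := Num.min e (d / (M + 1)) / 2.
  have M1 : 0 < M + 1 by lra.
  have r0 : 0 < r by rewrite divr_gt0// lt_min e0 divr_gt0.
  have : \forall q \near (Re t, Im t), ball (Re t, Im t) r q.
    exact: nbhsx_ballx.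
  apply: filterS => -[x y] [/= xr yr]; rewrite /ball/= in xr yr.
  pose z : R[i] := (x - Re t) +i* (y - Im t).
  have -> : x +i* y = t + z.
    by apply: complexP; rewrite ?ReD ?ImD /= ?subrK addrC subrK.
  have zr : normc z < Num.min e (d / (M + 1)).
    apply: le_lt_trans (normc_le _) _ => /=.
    by rewrite (distrC x) (distrC y) [ltRHS](splitr) ltrD.
  move: zr; rewrite lt_min => /andP[ze zd].
  apply: le_lt_trans (h _ ze) _; move: zd; rewrite ltr_pdivlMr// => zd.
  by have := normc_ge0 z; nra.
split; apply/cvgrPdist_lt => d d0.
  apply: filterS (H d d0) => q; apply: le_lt_trans.
  have -> : (Re t +i* Im t) = t by case: (t).
  by rewrite distrC -ReN -ReD normRe.
apply: filterS (H d d0) => q; apply: le_lt_trans.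
have -> : (Re t +i* Im t) = t by case: (t).
by rewrite distrC -ImN -ImD normIm.
Qed.

(** Complex sets are read in R * R, where the extreme value theorem and the compactness of products
    of segments apply. *)
Definition cset K : set (R * R) := [set q | K (q.1 +i* q.2)].

Lemma ccompact_max K (f : R * R -> R) : compact (cset K) -> K !=set0 ->
  (forall t, K t -> {for (Re t, Im t), continuous f}) ->
  exists2 t, K t & forall s, K s ->
    f (Re s, Im s) <= f (Re t, Im t).
Proof.
move=> cK [t0 Kt0] cf.
have [||c Kc h] := @compact_EVT_max _ R f (cset K) _ cK.
- by exists (Re t0, Im t0); rewrite /cset/=; case: (t0) Kt0.
- by apply: continuous_in_subspaceT => -[x y]; rewrite inE => /cf.
exists (c.1 +i* c.2) => [|s Ks]; first by rewrite inE in Kc.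
by rewrite /= -surjective_pairing; apply: h; rewrite inE /cset/=; case: (s) Ks.
Qed.

Lemma normc2_continuous g t : lip_at g t ->
  {for (Re t, Im t), continuous (fun q : R * R => normc (g (q.1 +i* q.2)) ^+ 2)}.
Proof.
move=> /lip_continuous[cR cI].
have -> : (fun q : R * R => normc (g (q.1 +i* q.2)) ^+ 2) = (fun q : R * R =>
   Re (g (q.1 +i* q.2)) * Re (g (q.1 +i* q.2)) +
   Im (g (q.1 +i* q.2)) * Im (g (q.1 +i* q.2))).
  by apply/funext => q; rewrite normc_sqr !expr2.
by apply: cvgD; apply: cvgM.
Qed.

Lemma ccompact_bounded K g : compact (cset K) -> (forall t, K t -> lip_at g t) ->
  exists2 M : R, 0 <= M & forall t, K t -> normc (g t) <= M.
Proof.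
move=> cK gl; have [->|/set0P K0] := eqVneq K set0; first by exists 0.
have [t Kt h] := ccompact_max cK K0 (fun t Kt => normc2_continuous (gl t Kt)).
exists (normc (g t)) => [|s Ks]; first exact: normc_ge0.
rewrite -(@ler_pXn2r _ 2) ?nnegrE ?normc_ge0//.
by have := h s Ks; case: (s); case: (t).
Qed.

(* The real part of the second argument is squared: its mean over the four
   points w, iw, -w, -iw exceeds its value at the centre, while |g|^2 satisfies
   the mean value inequality up to O(|w|^3). *)
Lemma jet3_increase g (eps x0 e : R) : jet 3 g -> 0 < eps -> 0 < e ->
  exists2 z, normc z < e &
    normc (g 0) ^+ 2 + eps * x0 ^+ 2 < normc (g z) ^+ 2 + eps * (x0 + Re z) ^+ 2.
Proof.
move=> [p [M [e1 [M0 e10 gp]]]] eps0 e0.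
have g0 := jet0E (ltn0Sn _) e10 gp.
pose c0 := p`_0; pose c1 := p`_1; pose c2 := p`_2.
have [B B0 pB] := poly_bound (drop_poly 3 p).
have [D D0 qD] := poly_bound (take_poly 3 p).
have qE z : (take_poly 3 p).[z] = c0 + c1 * z + c2 * z ^+ 2.
  rewrite (@horner_coef_wide _ 3); last exact: size_take_poly.
  by rewrite !big_ord_recl big_ord0 !coef_take_poly/= addr0 expr0 mulr1 expr1 addrA.
pose L := M + B.
have gq z : normc z < e1 -> normc z <= 1 ->
    normc (take_poly 3 p).[z] ^+ 2 - 2 * D * L * normc z ^+ 3 <= normc (g z) ^+ 2.
  move=> ze1 z1; set q := (take_poly 3 p).[z].
  have qD' : normc q <= D by exact: qD.
  have h1 : normc (g z - q) <= L * normc z ^+ 3.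
    have -> : g z - q = (g z - p.[z]) + (drop_poly 3 p).[z] * z ^+ 3.
      have -> : p.[z] = q + (drop_poly 3 p).[z] * z ^+ 3.
        by rewrite -[in LHS](poly_take_drop 3 p) hornerD hornerM hornerXn.
      by ring.
    rewrite (le_trans (normcD _ _))// [leRHS]mulrDl; apply: lerD; first exact: gp.
    by rewrite normcM normcX ler_wpM2r ?exprn_ge0 ?normc_ge0// pB.
  have h2 : normc q <= normc (g z) + normc (g z - q).
    by rewrite -[in leLHS](subKr (g z) q); exact: normcB.
  have := normc_ge0 q; have := normc_ge0 (g z).
  have : 0 <= L * normc z ^+ 3 by rewrite mulr_ge0 ?exprn_ge0 ?normc_ge0 ?addr_ge0.
  move: h1 h2 qD'; rewrite -!mulrA; set X := L * _; set a := normc (g z); set b := normc q.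
  move=> h1 h2 qD' X0 a0 b0.
  have [bX|bX] := leP b X.
    have : b * b <= D * X by nra.
    by rewrite !expr2; nra.
  have : (b - X) * (b - X) <= a * a by apply: ler_pM; lra.
  by rewrite !expr2; nra.
pose N := 2 * D * L.
have N0 : 0 <= N by rewrite !mulr_ge0// addr_ge0.
pose d := Num.min (Num.min e e1) (Num.min 1 (eps / (2 * N + 1))) / 2.
have d0 : 0 < d.
  rewrite divr_gt0// !lt_min e0 e10 ltr01/= divr_gt0//.
  by apply: ltr_wpDl => //; rewrite mulr_ge0.
have : d < Num.min (Num.min e e1) (Num.min 1 (eps / (2 * N + 1))).
  by rewrite [ltRHS]splitr -/d ltrDl.
rewrite !lt_min => /andP[/andP[de de1] /andP[d1]].
rewrite ltr_pdivlMr; last by apply: ltr_wpDl => //; rewrite mulr_ge0.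
move=> dN.
have nR : normc (d%:C : R[i]) = d by rewrite normc_real gtr0_norm.
have nI : normc (0 +i* d) = d by rewrite /= expr0n add0r sqrtr_sqr gtr0_norm.
suff : ~ (forall z, normc z < e ->
    normc (g z) ^+ 2 + eps * (x0 + Re z) ^+ 2 <= normc (g 0) ^+ 2 + eps * x0 ^+ 2).
  by move=> /existsNP[z /not_implyP[ze /negP]]; rewrite -ltNge => h; exists z.
move=> H.
have H1 z : normc z = d -> normc (c0 + c1 * z + c2 * z ^+ 2) ^+ 2 - N * d ^+ 3
     + eps * (x0 + Re z) ^+ 2 <= normc c0 ^+ 2 + eps * x0 ^+ 2.
  move=> zd; have ze : normc z < e by rewrite zd.
  have := H z ze; rewrite g0 -/c0; apply: le_trans; rewrite lerD2r.
  rewrite -qE -zd; apply: gq; rewrite zd//; exact: ltW.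
have := H1 d%:C nR; have := H1 (- d%:C); rewrite normcNE => /(_ nR).
have := H1 (0 +i* d) nI; have := H1 (- (0 +i* d)); rewrite normcNE => /(_ nI).
(* Summed over the four points, the cross terms of |c0 + c1 z + c2 z^2|^2 cancel and 2 eps d^2 <= 4
   N d^3 remains. [F] contradicts this; it holds because [d] was chosen with d (2 N + 1) < eps. *)
have F : eps * d ^+ 2 > 2 * N * d ^+ 3.
  have d20 : 0 < d ^+ 2 by rewrite exprn_gt0.
  rewrite exprS mulrA ltr_pM2r//.
  by move: d0 dN; clear; clearbody N d; lra.
clearbody c0 c1 c2; move: F; clear -d0; rewrite !normc_sqr.
case: c0 => a0 b0; case: c1 => a1 b1; case: c2 => a2 b2 /=.
rewrite !expr2 /=.
move=> F h1 h2 h3 h4.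
nra.
Qed.

(** [B] only has to contain the points of [K] that are not interior. If |Q t| > M, then |Q|^2 + eps
    Re^2 attains its maximum on [K]; for small eps this cannot happen on [B], and [jet3_increase]
    excludes the interior. *)
Lemma max_principle K B Q (M : R) : compact (cset K) ->
  (forall t, K t -> jet 3 (fun z => Q (t + z))) ->
  (forall t, K t -> ~ B t -> exists2 e : R, 0 < e & forall z, normc z < e -> K (t + z)) ->
  (forall t, K t -> B t -> normc (Q t) <= M) ->
  forall t, K t -> normc (Q t) <= M.
Proof.
move=> cK jQ KI QB t Kt; rewrite leNgt; apply/negP => MQ.
have lipid s : lip_at id s.
  by exists 1, 1; split=> // z _; rewrite addrAC subrr add0r mul1r.
have [L L0 KL] := ccompact_bounded cK (fun s _ => lipid s).
have lipQ s : K s -> lip_at Q s.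
  move=> /jQ h; have [D [e [D0 e0 h']]] := jet_lip (jet_le (isT : (1 <= 3)%N) h).
  by exists D, e; split=> // z ze; have := h' z ze; rewrite addr0.
have [M0|M0] := ltP M 0.
  (* M < 0 forces the boundary to be empty, impossible at a rightmost point of K *)
  have [s Ks sE] : exists2 s, K s & forall w, K w -> Re w <= Re s.
    have [||s Ks h] := @ccompact_max K fst cK; first by exists t.
      by move=> s _; exact: cvg_fst.
    by exists s.
  have [|e e0 h] := KI s Ks; first by move=> /(QB s Ks); have := normc_ge0 (Q s); lra.
  have := h (e / 2)%:C; rewrite normc_real ger0_norm ?divr_ge0 ?ltW// ltr_pdivrMr//.
  by rewrite ltr_pMr ?ltr1n// => /(_ isT) /sE; rewrite ReD /=; lra.
(* [L] bounds |s| on [K], so that eps Re(s)^2 stays below half of the gap |Q t|^2 - M^2. *)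
pose eps := (normc (Q t) ^+ 2 - M ^+ 2) / (2 * (L ^+ 2 + 1)).
have L1 : 0 < 2 * (L ^+ 2 + 1) by rewrite mulr_gt0// ltr_wpDl// sqr_ge0.
have eps0 : 0 < eps.
  by rewrite divr_gt0// subr_gt0 ltr_pXn2r// ?nnegrE ?normc_ge0.
pose f (q : R * R) := normc (Q (q.1 +i* q.2)) ^+ 2 + eps * (q.1 * q.1).
have [||s Ks smax] := @ccompact_max K f cK; first by exists t.
  move=> s Ks; apply: cvgD; first exact: (normc2_continuous (lipQ s Ks)).
  by apply: cvgM; [exact: cvg_cst|apply: cvgM; exact: cvg_fst].
have fE w : f (Re w, Im w) = normc (Q w) ^+ 2 + eps * Re w ^+ 2.
  by rewrite /f expr2; case: w.
have [Bs|Bs] := pselect (B s).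
  have := smax t Kt; rewrite !fE.
  have : normc (Q s) ^+ 2 <= M ^+ 2 by rewrite ler_pXn2r ?nnegrE ?normc_ge0 ?QB.
  have : eps * Re s ^+ 2 <= eps * L ^+ 2.
    rewrite ler_pM2l// -(real_normK (num_real (Re s))).
    by rewrite ler_pXn2r ?nnegrE// (le_trans (normRe _))// KL.
  have : 0 <= eps * L ^+ 2 by rewrite mulr_ge0 ?sqr_ge0// ltW.
  have : 0 <= eps * Re t ^+ 2 by rewrite mulr_ge0 ?sqr_ge0// ltW.
  have : eps * (2 * (L ^+ 2 + 1)) = normc (Q t) ^+ 2 - M ^+ 2 by rewrite /eps divfK// gt_eqF.
  by move: eps0; clear; clearbody eps; lra.
have [e e0 h] := KI s Ks Bs.
have [z ze] := jet3_increase (Re s) (jQ s Ks) eps0 e0.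
have := smax _ (h z ze); rewrite !fE ReD addr0; lra.
Qed.

Definition rect (a b c d : R) : set R[i] :=
  [set t | a <= Re t <= b /\ c <= Im t <= d].

Lemma compact_rect a b c d : compact (cset (rect a b c d)).
Proof.
have -> : cset (rect a b c d) = `[a, b] `*` `[c, d].
  by apply/seteqP; split=> -[x y]; rewrite /cset /rect/= !in_itv.
by apply: compact_setX; exact: segment_compact.
Qed.

Lemma max_rect a b c d Q (M : R) : holo (rect a b c d) Q ->
  (forall t, rect a b c d t ->
    [\/ Re t = a, Re t = b, Im t = c | Im t = d] ->
    normc (Q t) <= M) ->
  forall t, rect a b c d t -> normc (Q t) <= M.
Proof.
move=> hQ; apply: max_principle; first exact: compact_rect.
- by move=> t /hQ; exact.
move=> t [/andP[ta tb] /andP[tc td]] nB.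
have {}ta : a < Re t.
  by rewrite lt_neqAle ta andbT; apply/eqP => h; apply: nB; apply: Or41.
have {}tb : Re t < b.
  by rewrite lt_neqAle tb andbT; apply/eqP => h; apply: nB; apply: Or42.
have {}tc : c < Im t.
  by rewrite lt_neqAle tc andbT; apply/eqP => h; apply: nB; apply: Or43.
have {}td : Im t < d.
  by rewrite lt_neqAle td andbT; apply/eqP => h; apply: nB; apply: Or44.
exists (Num.min (Num.min (Re t - a) (b - Re t))
                (Num.min (Im t - c) (d - Im t))).
  by rewrite !lt_min !subr_gt0 ta tb tc.
move=> z; rewrite !lt_min => /andP[/andP[h1 h2] /andP[h3 h4]].
have := normRe z; have := normIm z; rewrite !ler_norml => /andP[h5 h6] /andP[h7 h8].
by split; rewrite ?ReD ?ImD; lra.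
Qed.

End MaxPrinciple.

(** * Difference quotients, Taylor remainders and Cauchy's estimate *)

Section Taylor.
Variable R : realType.
Implicit Types (z w t : R[i]) (g F : R[i] -> R[i]) (U : set R[i]).

(** The derivative at 0. The quadratic remainder makes the coefficient unique ([der_uniq]), and it
    exists as soon as [g] has a jet of order 2, so the default 0 is then never taken. *)
Definition der g : R[i] := xget 0 [set c | exists M e : R, 0 < e /\
  forall z, normc z < e -> normc (g z - g 0 - c * z) <= M * normc z ^+ 2].

Lemma der_uniq g c c' (M M' e e' : R) : 0 < e -> 0 < e' ->
  (forall z, normc z < e -> normc (g z - g 0 - c * z) <= M * normc z ^+ 2) ->
  (forall z, normc z < e' -> normc (g z - g 0 - c' * z) <= M' * normc z ^+ 2) -> c = c'.
Proof.
move=> e0 e'0 h h'; apply/eqP; rewrite -subr_eq0 -normc_eq0; apply/negPn/negP => cc.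
have cc0 : 0 < normc (c - c') by rewrite lt_def cc normc_ge0.
pose L := `|M| + `|M'| + 1; have L0 : 0 < L by rewrite ltr_wpDl// addr_ge0.
pose d := Num.min (Num.min e e') (normc (c - c') / L) / 2.
have d0 : 0 < d by rewrite divr_gt0// !lt_min e0 e'0 divr_gt0.
have : d < Num.min (Num.min e e') (normc (c - c') / L) by rewrite [ltRHS]splitr -/d ltrDl.
rewrite !lt_min => /andP[/andP[de de']]; rewrite ltr_pdivlMr// => dL.
have nd : normc (d%:C : R[i]) = d by rewrite normc_real gtr0_norm.
have := h d%:C; have := h' d%:C; rewrite !nd => /(_ de') h1 /(_ de) h2.
have : normc ((c - c') * d%:C) <= M * d ^+ 2 + M' * d ^+ 2.
  have -> : (c - c') * d%:C = (g d%:C - g 0 - c' * d%:C) - (g d%:C - g 0 - c * d%:C) by ring.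
  by rewrite (le_trans (normcB _ _))// addrC lerD.
have : (M + M') * d <= L * d.
  rewrite ler_pM2r// /L; have := ler_norm M; have := ler_norm M'; lra.
rewrite normcM nd; move: dL d0 cc0; clear; clearbody L d.
set u := normc _ => dL d0 u0 h1 h2.
by nra.
Qed.

Lemma derE n g p (M e : R) : (1 < n)%N -> 0 <= M -> 0 < e ->
  (forall z, normc z < e -> normc (g z - p.[z]) <= M * normc z ^+ n) -> der g = p`_1.
Proof.
move=> n1 M0 e0 gp.
have [B B0 pB] := poly_bound (drop_poly 2 p).
have H z : normc z < Num.min e 1 ->
    normc (g z - g 0 - p`_1 * z) <= (M + B) * normc z ^+ 2.
  rewrite lt_min => /andP[ze /ltW z1].
  have -> : g z - g 0 - p`_1 * z = (g z - p.[z]) + (drop_poly 2 p).[z] * z ^+ 2.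
    rewrite (jet0E _ e0 gp); last exact: ltnW.
    have -> : p.[z] = p`_0 + p`_1 * z + (drop_poly 2 p).[z] * z ^+ 2.
      rewrite -[in LHS](poly_take_drop 2 p) hornerD hornerM hornerXn; congr (_ + _).
      rewrite (@horner_coef_wide _ 2); last exact: size_take_poly.
      by rewrite !big_ord_recl big_ord0 !coef_take_poly/= addr0 expr0 mulr1 expr1.
    by ring.
  rewrite (le_trans (normcD _ _))// [leRHS]mulrDl; apply: lerD.
    apply: le_trans (gp _ ze) _; apply: ler_wpM2l => //.
    by apply: ler_wiXn2l => //; exact: normc_ge0.
  by rewrite normcM normcX ler_wpM2r ?exprn_ge0 ?normc_ge0// pB.
have e10 : 0 < Num.min e 1 by rewrite lt_min e0 ltr01.
rewrite /der; case: xgetP => [c _ [M' [e' [e'0 h]]]|]; last first.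
  by move=> /(_ p`_1) []; exists (M + B), (Num.min e 1).
exact: der_uniq e'0 e10 h H.
Qed.

Lemma der_ext g h (e : R) : 0 < e -> (forall z, normc z < e -> g z = h z) ->
  jet 2 g -> der g = der h.
Proof.
move=> e0 gh [p [M [d [M0 d0 gp]]]].
rewrite (derE (isT : (1 < 2)%N) M0 d0 gp).
rewrite (@derE 2 h p M (Num.min e d)) => //; first by rewrite lt_min e0.
by move=> z; rewrite lt_min => /andP[ze zd]; rewrite -gh// gp.
Qed.

Lemma derP g : jet 2 g -> exists M e : R, [/\ 0 <= M, 0 < e &
  forall z, normc z < e -> normc (g z - g 0 - der g * z) <= M * normc z ^+ 2].
Proof.
move=> [p [M [e [M0 e0 gp]]]].
have [B B0 pB] := poly_bound (drop_poly 2 p).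
rewrite (derE (isT : (1 < 2)%N) M0 e0 gp).
exists (M + B), (Num.min e 1); split; [exact: addr_ge0|by rewrite lt_min e0 ltr01|].
move=> z; rewrite lt_min => /andP[ze /ltW z1].
have -> : g z - g 0 - p`_1 * z = (g z - p.[z]) + (drop_poly 2 p).[z] * z ^+ 2.
  rewrite (jet0E _ e0 gp)//.
  have -> : p.[z] = p`_0 + p`_1 * z + (drop_poly 2 p).[z] * z ^+ 2.
    rewrite -[in LHS](poly_take_drop 2 p) hornerD hornerM hornerXn; congr (_ + _).
    rewrite (@horner_coef_wide _ 2); last exact: size_take_poly.
    by rewrite !big_ord_recl big_ord0 !coef_take_poly/= addr0 expr0 mulr1 expr1.
  by ring.
rewrite (le_trans (normcD _ _))// [leRHS]mulrDl; apply: lerD; first exact: gp.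
by rewrite normcM normcX ler_wpM2r ?exprn_ge0 ?normc_ge0// pB.
Qed.

Definition dquot g z : R[i] := if z == 0 then der g else (g z - g 0) / z.

Lemma dquotE g z : g z = g 0 + z * dquot g z.
Proof.
rewrite /dquot; have [->|z0] := eqVneq z 0; first by rewrite mul0r addr0.
by field.
Qed.

(** Dividing by z removes the constant coefficient of the approximating polynomial and costs one
    order. At z = 0 the value is [der g], which is determined because n + 1 >= 2. *)
Lemma jet_dquot n g : (0 < n)%N -> jet n.+1 g -> jet n (dquot g).
Proof.
move=> n0 [p [M [e [M0 e0 gp]]]]; exists (drop_poly 1 p), M, e; split=> // z ze.
have pE : p.[z] = p`_0 + z * (drop_poly 1 p).[z].
  rewrite -[in LHS](poly_take_drop 1 p) hornerD hornerM hornerXn expr1 mulrC; congr (_ + _).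
  rewrite (@horner_coef_wide _ 1); last exact: size_take_poly.
  by rewrite !big_ord_recl big_ord0 !coef_take_poly/= addr0 expr0 mulr1.
rewrite /dquot; have [->|z0] := eqVneq z 0.
  rewrite horner_coef0 coef_drop_poly add0n (derE _ M0 e0 gp)//.
  by rewrite subrr normc0 mulr_ge0 ?exprn_ge0.
have g0 := jet0E (ltn0Sn _) e0 gp.
have -> : (g z - g 0) / z - (drop_poly 1 p).[z] = (g z - p.[z]) / z.
  by rewrite pE g0; field.
rewrite normcM normcV ler_pdivrMr ?normc_gt0// -mulrA -exprSr; exact: gp.
Qed.

Lemma holo_dquot U g : U 0 -> holo U g -> holo U (dquot g).
Proof.
move=> U0 hg w Uw n; have [->|w0] := eqVneq w 0.
  apply: (@jet_ext _ _ (dquot g) _ 1) => // [z _|]; first by rewrite add0r.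
  have [->|n0] := posnP n.
    apply: (@jet_le _ 0 1) => //; apply: jet_dquot => //.
    by apply: jet_ext (hg 0 U0 2); [exact: ltr01|move=> z _; rewrite add0r].
  apply: jet_dquot => //.
  by apply: jet_ext (hg 0 U0 n.+1); [exact: ltr01|move=> z _; rewrite add0r].
apply: (@jet_ext _ _ (fun z => (g (w + z) - g 0) * (w + z)^-1) _ (normc w)).
- by rewrite normc_gt0.
- move=> z zw; rewrite /dquot ifF//; apply/negbTE/eqP => wz.
  by move: zw; rewrite (_ : z = - w) ?normcNE ?ltxx//; apply/eqP; rewrite -addr_eq0 addrC wz.
apply: jetM; last exact: jetV.
by apply: jetB; [exact: hg|exact: jet_cst].
Qed.

Definition sq (d : R) : set R[i] := rect (- d) d (- d) d.

Lemma sqP (d : R) z : sq d z <-> `|Re z| <= d /\ `|Im z| <= d.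
Proof. by rewrite /sq /rect/= !ler_norml. Qed.

Lemma sq0 (d : R) : 0 <= d -> sq d 0.
Proof. by move=> d0; apply/sqP; rewrite /= normr0. Qed.

Lemma sq_normc (d : R) z : normc z <= d -> sq d z.
Proof.
by move=> zd; apply/sqP; split; [rewrite (le_trans (normRe _))|rewrite (le_trans (normIm _))].
Qed.

Lemma normc_sq (d : R) z : sq d z -> normc z <= d + d.
Proof. by move=> /sqP[h1 h2]; apply: le_trans (normc_le _) _; exact: lerD. Qed.

(* Schwarz lemma: |z| >= d on the boundary of the square, so the bound holds there,
   and the maximum principle propagates it. *)
Lemma dquot_bound (d M : R) g : 0 < d -> holo (sq d) g ->
  (forall z, sq d z -> normc (g z) <= M) ->
  forall z, sq d z -> normc (dquot g z) <= M * (2 / d).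
Proof.
move=> d0 hg gM; apply: max_rect; first by apply: holo_dquot => //; apply: sq0; exact: ltW.
move=> t st tb; have dt : d <= normc t.
  have := normRe t; have := normIm t.
  by case: tb => ->; rewrite ?normrN (gtr0_norm d0).
have t0 : t != 0 by rewrite -normc_gt0 (lt_le_trans d0).
rewrite /dquot (negbTE t0) normcM normcV ler_pdivrMr ?normc_gt0//.
have h : normc (g t - g 0) <= M + M.
  by rewrite (le_trans (normcB _ _))// lerD ?gM//; apply: sq0; exact: ltW.
apply: le_trans h _; rewrite -mulrA.
have M0 : 0 <= M by apply: le_trans (gM _ st); exact: normc_ge0.
have : 2 <= 2 / d * normc t by rewrite mulrAC ler_pdivlMr// ler_pM2l.
by nra.
Qed.

Lemma holo_shift U F t : holo U F -> holo [set z | U (t + z)] (fun z => F (t + z)).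
Proof.
move=> hF z Uz n; apply: jet_ext (hF _ Uz n); first exact: ltr01.
by move=> w _; rewrite addrA.
Qed.

(** The k-th Taylor coefficient of [F] at [t]: by [iter_dquotE], the values at 0 of the successive
    difference quotients are the coefficients of the expansion. *)
Definition tay F t k : R[i] := iter k dquot (fun z => F (t + z)) 0.

Lemma holo_iter_dquot U g k : U 0 -> holo U g -> holo U (iter k dquot g).
Proof. by move=> U0 hg; elim: k => // k IH; exact: holo_dquot. Qed.

Lemma iter_dquotE g k z :
  g z = \sum_(j < k) iter j dquot g 0 * z ^+ j + z ^+ k * iter k dquot g z.
Proof.
elim: k => [|k IH]; first by rewrite big_ord0 add0r expr0 mul1r.
by rewrite {1}IH big_ord_recr/= {1}(dquotE (iter k dquot g) z) mulrDr mulrC addrA exprSr mulrA.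
Qed.

Lemma iter_dquot_bound (d M : R) g k : 0 < d -> holo (sq d) g ->
  (forall z, sq d z -> normc (g z) <= M) ->
  forall z, sq d z -> normc (iter k dquot g z) <= M * (2 / d) ^+ k.
Proof.
move=> d0 hg gM; elim: k => [|k IH z zd]; first by move=> z /gM; rewrite mulr1.
rewrite exprSr [leRHS]mulrA.
exact: (dquot_bound d0 (holo_iter_dquot k (sq0 (ltW d0)) hg) IH zd).
Qed.

(** The remainder is exactly z^k times the k-th difference quotient, and each quotient costs a
    factor 2/d. The bound depends on [d] and [M] only, which allows integration over the base point
    [t]. *)
Lemma taylor (d M : R) F t k z : 0 < d -> holo [set t + z | z in sq d] F ->
  (forall z, sq d z -> normc (F (t + z)) <= M) -> sq d z ->
  normc (F (t + z) - \sum_(j < k) tay F t j * z ^+ j) <= M * (2 / d * normc z) ^+ k.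
Proof.
move=> d0 hF FM zd; rewrite (iter_dquotE (fun z => F (t + z)) k) addrC addKr.
rewrite normcM normcX mulrC exprMn mulrA ler_wpM2r ?exprn_ge0 ?normc_ge0//.
apply: iter_dquot_bound => // w wd n.
by have h := @holo_shift _ _ t hF; apply: (h w); exists w.
Qed.

Definition cder F t : R[i] := der (fun z => F (t + z)).

Lemma tay1 F t : tay F t 1 = cder F t.
Proof. by rewrite /tay /= /dquot eqxx. Qed.

Lemma cauchy_bound (d M : R) F t : 0 < d -> holo [set t + z | z in sq d] F ->
  (forall z, sq d z -> normc (F (t + z)) <= M) -> normc (cder F t) <= M * (2 / d).
Proof.
move=> d0 hF FM; rewrite -tay1 -[2 / d]expr1; apply: iter_dquot_bound => //.
  by move=> w wd n; have h := @holo_shift _ _ t hF; apply: (h w); exists w.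
by apply: sq0; exact: ltW.
Qed.

End Taylor.

(** * Power series, holomorphy and the complex derivative *)

Section Analytic.
Variable R : realType.
Implicit Types (z w t : R[i]) (g F : R[i] -> R[i]) (U : set R[i]).

(** Openness is expressed with squares because these are the domains of [taylor] and
    [cauchy_bound]. *)
Definition copen U := forall t, U t -> exists2 d : R, 0 < d & forall z, sq d z -> U (t + z).

Lemma cvg_seqP (u : nat -> R[i]) (l : R[i]) :
  ((u : nat -> R[i]^o) @ \oo --> (l : R[i]^o)) <->
  (forall e : R, 0 < e -> exists N, forall n, (N <= n)%N -> normc (u n - l) < e).
Proof.
split=> [/cvgrPdist_lt h e e0|h].
  have e0' : (0 : R[i]) < e%:C by rewrite ltcR.
  have [N _ hN] := h _ e0'; exists N => n Nn.
  by have := hN n Nn; rewrite /= -[`|_|]/((normc _)%:C) ltcR normcBC.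
apply/cvgrPdist_lt => -[e e']; rewrite ltcE/= => /andP[/eqP -> e0].
have [N hN] := h e e0; exists N => // n /= Nn.
by rewrite -[`|_|]/((normc _)%:C) ltcR normcBC; exact: hN.
Qed.

Lemma geometric_tail (c : nat -> R[i]) (M e : R) z n m : 0 <= M -> 0 < e -> (n <= m)%N ->
  (forall k, normc (c k) * e ^+ k <= M) -> normc z <= e / 2 ->
  normc (\sum_(n <= k < m) c k * z ^+ k) <= 2 * M * (normc z / e) ^+ n.
Proof.
move=> M0 e0 nm cM ze; pose r := normc z / e.
have r0 : 0 <= r by rewrite divr_ge0 ?normc_ge0// ltW.
have r2 : r <= 1 / 2 by rewrite ler_pdivrMr// mulrC mulrA mulr1.
have rE : normc z = r * e by rewrite divfK ?gt_eqF.
have H k : normc (c k * z ^+ k) <= M * r ^+ k.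
  by rewrite normcM normcX rE exprMn mulrCA mulrC ler_wpM2r ?exprn_ge0.
rewrite -/r (le_trans (normc_sum _ _ _))// (le_trans (ler_sum _ (fun k _ => H k)))//.
(* The telescoping form makes the induction work: r <= 1/2 gives r^m <= 2 (r^m - r^(m+1)). *)
suff : \sum_(n <= k < m) M * r ^+ k <= 2 * M * (r ^+ n - r ^+ m).
  move=> /le_trans; apply; rewrite ler_wpM2l ?mulr_ge0// lerBlDr lerDl exprn_ge0//.
elim: m nm => [|m IH]; first by rewrite leqn0 => /eqP ->; rewrite big_geq// subrr mulr0.
rewrite leq_eqVlt => /orP[/eqP ->|]; first by rewrite big_geq// subrr mulr0.
rewrite ltnS => nm; rewrite big_nat_recr//= (le_trans (lerD (IH nm) (lexx _)))//.
rewrite exprS; have := mulr_ge0 M0 (exprn_ge0 m r0); set x := r ^+ m; set y := r ^+ n.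
by move=> Mx; nra.
Qed.

(** Partial sums are the approximating polynomials. Convergence at the single point t + e/2 bounds
    |c k| (e/2)^k, so for |z| < e/4 the tails are dominated by a geometric series. *)
Lemma analytic_holo U F : analytic_on U F -> holo U F.
Proof.
move=> aF t Ut n; have [c [e [e0 h]]] := aF t Ut.
have [M M0 cM] : exists2 M : R, 0 <= M & forall k, normc (c k) * (e / 2) ^+ k <= M.
  have e2 : normc ((e / 2)%:C : R[i]) = e / 2 by rewrite normc_real gtr0_norm// divr_gt0.
  have := h (t + (e / 2)%:C); rewrite addrAC subrr add0r e2 ltr_pdivrMr// ltr_pMr// ltr1n.
  move=> /(_ isT) /cvg_seqP /(_ 1 ltr01)[N hN].
  (* From rank [N] on, a term is the difference of two partial sums within 1 of the limit, hence at
     most 2; the sum covers the earlier terms. *)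
  exists (2 + \sum_(k < N) normc (c k) * (e / 2) ^+ k).
    by rewrite addr_ge0// sumr_ge0// => k _; rewrite mulr_ge0 ?normc_ge0// exprn_ge0// divr_ge0// ltW.
  move=> k; have [kN|Nk] := ltnP k N.
    rewrite (bigD1 (Ordinal kN))//= addrCA lerDl addr_ge0// sumr_ge0// => i _.
    by rewrite mulr_ge0 ?normc_ge0// exprn_ge0// divr_ge0// ltW.
  rewrite -[leLHS]addr0 lerD//; last first.
    by rewrite sumr_ge0// => i _; rewrite mulr_ge0 ?normc_ge0// exprn_ge0// divr_ge0// ltW.
  have := hN _ Nk; have := hN _ (leqW Nk).
  rewrite /series /= big_nat_recr//=; set S := \sum_(0 <= i < k) _.
  rewrite -[X in normc (c k) * X ^+ _]e2 -normcX -normcM.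
  set x := c k * _; set l := F _ => h1 h2.
  have -> : x = (S + x - l) - (S - l) by ring.
  by rewrite (le_trans (normcB _ _))//; lra.
exists (\poly_(k < n) c k), (2 * M * (2 / e) ^+ n), (e / 4); split.
- by rewrite !mulr_ge0// exprn_ge0// divr_ge0// ltW.
- by rewrite divr_gt0.
move=> z ze; apply/ler_addgt0Pr => d d0.
have ze' : normc z < e by move: ze; rewrite ltr_pdivlMr//; lra.
have := h (t + z); rewrite addrAC subrr add0r => /(_ ze') /cvg_seqP /(_ d d0) [N hN].
set m := maxn n N; have := hN m (leq_maxr _ _); rewrite /series/= => hm.
rewrite horner_poly; have nm : (n <= m)%N by exact: leq_maxl.
rewrite (big_cat_nat (leq0n n) nm)/= in hm; rewrite big_mkord in hm.
have e20 : 0 < e / 2 by rewrite divr_gt0.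
have := @geometric_tail c M (e / 2) z n m M0 e20 nm cM.
rewrite (_ : e / 2 / 2 = e / 4); last by field.
move=> /(_ (ltW ze)); set S := \sum_(i < n) _ in hm *; set T := \sum_(n <= k < m) _ in hm *.
have -> : F (t + z) - S = T - (S + T - F (t + z)) by ring.
move=> hT; rewrite (le_trans (normcB _ _))// lerD ?(ltW hm)//.
by rewrite (le_trans hT)// invf_div exprMn -[leRHS]mulrA (mulrC (normc z ^+ n)).
Qed.

Lemma holo_local_bound U F t : copen U -> holo U F -> U t -> exists d M : R,
  [/\ 0 < d, 0 <= M, holo [set t + z | z in sq d] F,
   forall z, sq d z -> normc (F (t + z)) <= M & forall z, sq d z -> U (t + z)].
Proof.
move=> oU hF Ut; have [d d0 dU] := oU t Ut.
have hS : holo (sq d) (fun z => F (t + z)).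
  by move=> z zd; apply: (holo_shift hF); exact: dU.
have [M M0 h] := ccompact_bounded (@compact_rect R (- d) d (- d) d)
  (fun z zd => holo_lip (hS z zd)).
by exists d, M; split=> // _ [z zd <-]; apply: hF; exact: dU.
Qed.

Lemma holo_analytic U F : copen U -> holo U F -> analytic_on U F.
Proof.
move=> oU hF t Ut; have [d [M [d0 M0 hd FM _]]] := holo_local_bound oU hF Ut.
(* For |w| < d/4 the ratio 2 |w| / d in [taylor] is below 1/2. *)
exists (tay F t), (d / 4); split; first by rewrite divr_gt0.
move=> z; set w := z - t => wd; have -> : z = t + w by rewrite addrC subrK.
apply/cvg_seqP => e e0.
have wd' : 2 / d * normc w < 1 / 2.
  by rewrite mulrAC ltr_pdivrMr//; move: wd; rewrite ltr_pdivlMr//; lra.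
have r0 : 0 <= 2 / d * normc w by rewrite mulr_ge0 ?normc_ge0// divr_ge0// ltW.
have : (fun n => (M + 1) * (2 / d * normc w) ^+ n) @ \oo --> (M + 1) * 0.
  apply: cvgM; first exact: cvg_cst.
  by apply: cvg_expr; rewrite ger0_norm//; lra.
rewrite mulr0 => /cvgrPdist_lt /(_ e e0)[N _ hN]; exists N => n Nn.
have := hN n Nn; rewrite sub0r normrN ger0_norm; last by rewrite mulr_ge0 ?exprn_ge0//; lra.
apply: le_lt_trans; rewrite normcBC /series /= big_mkord.
have wsq : sq d w by apply: sq_normc; apply: le_trans (ltW wd) _; rewrite ler_pdivrMr//; lra.
apply: le_trans (taylor n d0 hd FM wsq) _.
by rewrite ler_wpM2r ?exprn_ge0//; lra.
Qed.

Lemma cder_uniq F t c (M e : R) : holo_at F t -> 0 < e ->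
  (forall z, normc z < e -> normc (F (t + z) - F t - c * z) <= M * normc z ^+ 2) ->
  cder F t = c.
Proof.
move=> hF e0 h; have [L [d [L0 d0 h']]] := derP (hF 2).
by apply: (der_uniq d0 e0 h') => z ze; rewrite addr0; exact: h.
Qed.

Lemma cderP F t : holo_at F t -> exists M e : R, [/\ 0 <= M, 0 < e &
  forall z, normc z < e -> normc (F (t + z) - F t - cder F t * z) <= M * normc z ^+ 2].
Proof.
move=> hF; have [L [d [L0 d0 h']]] := derP (hF 2); exists L, d; split=> // z /h'.
by rewrite addr0.
Qed.

Lemma holo_atD F G t : holo_at F t -> holo_at G t -> holo_at (fun z => F z + G z) t.
Proof. by move=> hF hG n; exact: jetD. Qed.

Lemma holo_atM F G t : holo_at F t -> holo_at G t -> holo_at (fun z => F z * G z) t.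
Proof. by move=> hF hG n; exact: jetM. Qed.

Lemma holo_at_cst c t : holo_at (cst c) t.
Proof. by move=> n; exact: jet_cst. Qed.

Lemma holo_at_id t : holo_at id t.
Proof. by move=> n; apply: jetD; [exact: jet_cst|exact: jet_id]. Qed.

Lemma holo_at_poly (p : {poly R[i]}) t : holo_at (horner p) t.
Proof.
elim/poly_ind : p => [|p c IH] n.
  by apply: jet_ext (holo_at_cst 0 t n); [exact: ltr01|move=> z _; rewrite horner0].
have := holo_atD (holo_atM IH (holo_at_id t)) (holo_at_cst c t).
by move=> /(_ n); apply: jet_ext ltr01 _ => z _; rewrite hornerMXaddC.
Qed.

Lemma cderD F G t : holo_at F t -> holo_at G t ->
  cder (fun z => F z + G z) t = cder F t + cder G t.
Proof.
move=> hF hG; have [M [e [M0 e0 h]]] := cderP hF; have [N [d [N0 d0 k]]] := cderP hG.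
apply: (@cder_uniq _ _ _ (M + N) (Num.min e d)).
- exact: holo_atD.
- by rewrite lt_min e0.
move=> z; rewrite lt_min => /andP[/h h1 /k h2].
rewrite (_ : _ - _ = (F (t + z) - F t - cder F t * z) + (G (t + z) - G t - cder G t * z)); last by ring.
by rewrite (le_trans (normcD _ _))// mulrDl lerD.
Qed.

Lemma cderM F G t : holo_at F t -> holo_at G t ->
  cder (fun z => F z * G z) t = cder F t * G t + F t * cder G t.
Proof.
move=> hF hG; have [M [e [M0 e0 h]]] := cderP hF; have [N [d [N0 d0 k]]] := cderP hG.
have [L [r [L0 r0 l]]] := holo_lip hG.
apply: (@cder_uniq _ _ _ (M * (L + normc (G t)) + normc (cder F t) * L + normc (F t) * N)
  (Num.min (Num.min 1 r) (Num.min e d))).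
- exact: holo_atM.
- by rewrite !lt_min ltr01 e0 r0.
move=> z; rewrite !lt_min => /andP[/andP[z1 /l h3] /andP[/h h1 /k h2]].
rewrite (_ : _ - _ = (F (t + z) - F t - cder F t * z) * ((G (t + z) - G t) + G t)
   + cder F t * z * (G (t + z) - G t) + F t * (G (t + z) - G t - cder G t * z)); last by ring.
rewrite (le_trans (normcD _ _))// [leRHS]mulrDl; apply: lerD; last first.
  by rewrite normcM -mulrA ler_wpM2l ?normc_ge0.
rewrite (le_trans (normcD _ _))// [leRHS]mulrDl; apply: lerD; last first.
  rewrite !normcM expr2 mulrACA ler_pM ?mulr_ge0 ?normc_ge0//.
rewrite normcM mulrAC ler_pM ?normc_ge0//.
rewrite (le_trans (normcD _ _))// lerD2r (le_trans h3)// ler_piMr//; exact: ltW.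
Qed.

Lemma cder_cst c t : cder (cst c) t = 0.
Proof.
apply: (@cder_uniq _ _ _ 0 1) => [||z _]; [exact: holo_at_cst|exact: ltr01|].
by rewrite /cst subrr mul0r subr0 normc0 mul0r.
Qed.

Lemma cder_id t : cder id t = 1.
Proof.
apply: (@cder_uniq _ _ _ 0 1) => [||z _]; [exact: holo_at_id|exact: ltr01|].
by rewrite mul1r (addrAC t) subrr add0r subrr normc0 mul0r.
Qed.

Lemma cder_ext F G t (e : R) : 0 < e -> holo_at F t ->
  (forall z, normc z < e -> F (t + z) = G (t + z)) -> cder F t = cder G t.
Proof. by move=> e0 hF h; apply: der_ext e0 h (hF 2). Qed.

Lemma cder_poly (p : {poly R[i]}) t : cder (horner p) t = p^`().[t].
Proof.
elim/poly_ind : p => [|p c IH].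
  rewrite deriv0 horner0 -(cder_cst 0 t); apply: (@cder_ext _ _ _ 1) => [//||z _].
    exact: holo_at_poly.
  by rewrite horner0.
have h := holo_atM (holo_at_poly p t) (holo_at_id t).
rewrite -(@cder_ext (fun z => p.[z] * z + c) _ _ 1)//; last 2 first.
- exact: (holo_atD h (holo_at_cst c t)).
- by move=> z _; rewrite hornerMXaddC.
rewrite (cderD h (holo_at_cst c t)) (cderM (holo_at_poly p t) (holo_at_id t)).
rewrite cder_cst cder_id IH addr0 mulr1 derivD derivC derivM derivX mulr1 addr0.
by rewrite hornerD hornerMX.
Qed.

(** Write F(t + z) = p(z) + E(z) with E(z) = z^k q(z) and [q] bounded. The jet of F' is p'; Cauchy's
    estimate on the square of half-width |z| about z, where |E| <= L (3 |z|)^k, gives E' =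
    O(|z|^(k-1)). *)
Lemma holo_cder U F : copen U -> holo U F -> holo U (cder F).
Proof.
move=> oU hF t Ut n; have [d [M [d0 M0 hd FM dU]]] := holo_local_bound oU hF Ut.
pose g z := F (t + z); pose k := n.+2; pose q := iter k (@dquot R) g.
pose E z := z ^+ k * q z; pose p : {poly R[i]} := \poly_(j < k) tay F t j.
have hg : holo (sq d) g.
  by move=> w wd; have h := @holo_shift _ _ _ t hd; apply: (h w); exists w.
have hq : holo (sq d) q by apply: holo_iter_dquot => //; apply: sq0; exact: ltW.
pose L := M * (2 / d) ^+ k.
have qL z : sq d z -> normc (q z) <= L by exact: iter_dquot_bound.
have L0 : 0 <= L by rewrite mulr_ge0// exprn_ge0// divr_ge0// ltW.
have hE : holo (sq d) E.
  move=> z /hq h; apply: holo_atM => // m.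
  by apply: jet_ext (holo_at_poly 'X^k z m) => [//|w _]; rewrite hornerXn.
have gE z : g z = p.[z] + E z by rewrite horner_poly; exact: iter_dquotE.
exists (p^`()), (L * 3 ^+ k * 2), (Num.min (d / 2) 1); split.
- by rewrite mulr_ge0// mulr_ge0// exprn_ge0.
- by rewrite lt_min divr_gt0//= ltr01.
move=> z; rewrite lt_min => /andP[zd /ltW z1].
have zs : sq d z by apply: sq_normc; move: zd; lra.
have -> : cder F (t + z) = cder g z by rewrite /cder /g; congr der; apply/funext => w; rewrite addrA.
have -> : cder g z = p^`().[z] + cder E z.
  rewrite -cder_poly -(cderD (holo_at_poly p z) (hE z zs)).
  by apply: cder_ext ltr01 (hg z zs) _ => w _; exact: gE.
(* At z = 0 the Cauchy square degenerates. There E' = 0 because k = n + 2 >= 2 makes [E]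
   quadratically small. *)
rewrite addrC addKr; have [->|z0] := eqVneq z 0.
  rewrite (@cder_uniq E 0 0 L (Num.min d 1)).
  - by rewrite normc0 mulr_ge0 ?exprn_ge0// mulr_ge0// mulr_ge0// exprn_ge0.
  - by apply: hE; apply: sq0; exact: ltW.
  - by rewrite lt_min d0 ltr01.
  move=> w; rewrite lt_min => /andP[wd w1].
  rewrite add0r mul0r subr0 /E expr0n mul0r subr0 normcM normcX mulrC ler_pM ?normc_ge0 ?exprn_ge0 ?normc_ge0//.
    by apply: qL; apply: sq_normc; exact: ltW.
  by apply: ler_wiXn2l; rewrite ?normc_ge0// ltW.
have Nz0 : 0 < normc z by rewrite normc_gt0.
have zw w : sq (normc z) w -> sq d (z + w) /\ normc (z + w) <= 3 * normc z.
  move=> ws; have /sqP[w1 w2] := ws; split.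
    by apply/sqP; rewrite ReD ImD; have := normRe z; have := normIm z; move: w1 w2 zd;
       rewrite !ler_norml; lra.
  by rewrite (le_trans (normcD _ _))//; have := normc_sq ws; lra.
apply: le_trans (cauchy_bound (M := L * (3 * normc z) ^+ k) Nz0 _ _) _.
- by move=> _ [w /zw[h _] <-]; exact: hE.
- move=> w /zw[h1 h2]; rewrite /E normcM normcX mulrC ler_pM ?normc_ge0 ?exprn_ge0 ?normc_ge0//.
    exact: qL.
  by rewrite lerXn2r// ?nnegrE ?mulr_ge0 ?normc_ge0.
rewrite exprMn /k !exprSr [leRHS](_ : _ = L * (3 ^+ n * 3 * 3) * 2 * normc z ^+ n * 1); last by ring.
have -> : L * (3 ^+ n * 3 * 3 * (normc z ^+ n * normc z * normc z)) * (2 / normc z) =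
  L * (3 ^+ n * 3 * 3) * 2 * normc z ^+ n * normc z by field; exact: lt0r_neq0.
apply: ler_wpM2l => //; apply: mulr_ge0; last by rewrite exprn_ge0 ?normc_ge0.
by rewrite mulr_ge0// mulr_ge0// mulr_ge0// mulr_ge0// exprn_ge0.
Qed.

End Analytic.

(** * Derivatives along a real variable and the complex exponential *)

Section RealVariable.
Variable R : realType.
Implicit Types (z w t c : R[i]) (x s : R).

Lemma quadratic_is_derive (f : R -> R) x d (M e : R) : 0 < e ->
  (forall h, `|h| < e -> `|f (x + h) - f x - d * h| <= M * h ^+ 2) -> is_derive x 1 f d.
Proof.
move=> e0 H.
have cv : h^-1 *: ((f \o shift x) (h *: (1 : R)) - f x) @[h --> 0^'] --> d.
  apply/cvgrPdist_lt => eps eps0; near=> h.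
  have h0 : h != 0 by near: h; exact: nbhs_dnbhs_neq.
  have he : `|h| < e by near: h; exact: dnbhs0_lt.
  have hM : `|h| < eps / (`|M| + 1) by near: h; apply: dnbhs0_lt; rewrite divr_gt0// ltr_wpDl.
  have h0' : 0 < `|h| by rewrite normr_gt0.
  rewrite distrC /= (_ : h%:A + x = x + h); last by rewrite addrC /GRing.scale/= mulr1.
  have -> : h^-1 *: (f (x + h) - f x) - d = (f (x + h) - f x - d * h) / h.
    by rewrite /GRing.scale/=; field.
  rewrite normrM normfV ltr_pdivrMr//; apply: le_lt_trans (H h he) _.
  rewrite -(real_normK (num_real h)) expr2 mulrA ltr_pM2r//.
  move: hM; rewrite ltr_pdivlMr ?ltr_wpDl//.
  by apply: le_lt_trans; have := ler_norm M; nra.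
by apply: DeriveDef; [exact: cvgP cv|exact: cvg_lim cv].
Unshelve. all: by end_near. Qed.

Definition cD (f : R -> R[i]) x c :=
  is_derive x 1 (fun s => Re (f s) : R) (Re c : R) /\
  is_derive x 1 (fun s => Im (f s) : R) (Im c : R).

Lemma cD_eq f x c c' : cD f x c -> c = c' -> cD f x c'.
Proof. by move=> h <-. Qed.

Lemma cD_ext f g x c : f =1 g -> cD f x c -> cD g x c.
Proof. by move=> /funext ->. Qed.

Lemma cD_cst w x : cD (fun=> w) x 0.
Proof. by split; exact: is_derive_cst. Qed.

Lemma cD_real (f : R -> R) x d : is_derive x 1 f d -> cD (fun s => (f s)%:C) x d%:C.
Proof. by move=> h; split => //; exact: is_derive_cst. Qed.

Lemma cDD f g x c d : cD f x c -> cD g x d -> cD (fun s => f s + g s) x (c + d).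
Proof.
move=> [f1 f2] [g1 g2]; split; rewrite ?ReD ?ImD.
  rewrite (_ : (fun _ => _) = (fun s => Re (f s)) + (fun s => Re (g s))).
    exact: is_deriveD.
  by apply/funext => s; rewrite ReD.
rewrite (_ : (fun _ => _) = (fun s => Im (f s)) + (fun s => Im (g s))).
  exact: is_deriveD.
by apply/funext => s; rewrite ImD.
Qed.

Lemma cDM f g x c d : cD f x c -> cD g x d -> cD (fun s => f s * g s) x (c * g x + f x * d).
Proof.
move=> [f1 f2] [g1 g2]; split.
  rewrite (_ : (fun _ => _) = (fun s => Re (f s)) * (fun s => Re (g s)) -
     (fun s => Im (f s)) * (fun s => Im (g s))); last first.
    by apply/funext => s; rewrite cReM.
  apply: is_derive_eq (is_deriveB (is_deriveM f1 g1) (is_deriveM f2 g2)) _.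
  by rewrite ReD !cReM /GRing.scale/=; ring.
rewrite (_ : (fun _ => _) = (fun s => Re (f s)) * (fun s => Im (g s)) +
   (fun s => Im (f s)) * (fun s => Re (g s))); last first.
  by apply/funext => s; rewrite cImM.
apply: is_derive_eq (is_deriveD (is_deriveM f1 g2) (is_deriveM f2 g1)) _.
by rewrite ImD !cImM /GRing.scale/=; ring.
Qed.

Lemma cDZ w f x c : cD f x c -> cD (fun s => w * f s) x (w * c).
Proof.
by move=> /(cDM (cD_cst w x)) h; apply: cD_eq h _; rewrite mul0r add0r.
Qed.

Lemma cDB f g x c d : cD f x c -> cD g x d -> cD (fun s => f s - g s) x (c - d).
Proof.
move=> hf /(cDZ (-1)) hg; have h := cDD hf hg.
by apply: cD_eq (cD_ext _ h) _ => [s|]; rewrite mulN1r.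
Qed.

Lemma cD_quadratic f x c (M e : R) : 0 < e ->
  (forall h, `|h| < e -> normc (f (x + h) - f x - c * h%:C) <= M * h ^+ 2) -> cD f x c.
Proof.
move=> e0 H; split; apply: (quadratic_is_derive e0) => h /H.
  apply: le_trans; apply: le_trans (normRe _); rewrite !ReD !ReN cReM /=.
  by rewrite mulr0 subr0.
apply: le_trans; apply: le_trans (normIm _); rewrite !ImD !ImN cImM /=.
by rewrite mulr0 add0r.
Qed.

Lemma cD_holo F t v x : holo_at F (t + x%:C * v) ->
  cD (fun s => F (t + s%:C * v)) x (cder F (t + x%:C * v) * v).
Proof.
move=> /cderP[M [e [M0 e0 h]]].
apply: (@cD_quadratic _ _ _ (M * normc v ^+ 2) (e / (normc v + 1))).
  by rewrite divr_gt0// ltr_wpDl ?normc_ge0.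
move=> k; rewrite ltr_pdivlMr ?ltr_wpDl ?normc_ge0// => ke.
have kv : normc (k%:C * v) <= `|k| * (normc v + 1).
  by rewrite normcM normc_real ler_wpM2l// lerDl.
rewrite raddfD/= mulrDl addrA -mulrA (mulrC v).
apply: le_trans (h _ (le_lt_trans kv ke)) _.
by rewrite normcM normc_real exprMn (real_normK (num_real k)) mulrCA mulrC mulrA.
Qed.

Lemma cD_cexp f x c : cD f x c -> cD (fun s => cexp (f s)) x (c * cexp (f x)).
Proof.
move=> [f1 f2].
have E : is_derive x 1 (expR \o (fun s => Re (f s))) (Re c * expR (Re (f x))).
  by apply: is_derive_eq; rewrite /GRing.scale/= mulrC.
have C : is_derive x 1 (cos \o (fun s => Im (f s))) (Im c * - sin (Im (f x))).
  by apply: is_derive_eq; rewrite /GRing.scale/= mulrC.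
have S : is_derive x 1 (sin \o (fun s => Im (f s))) (Im c * cos (Im (f x))).
  by apply: is_derive_eq; rewrite /GRing.scale/= mulrC.
split.
  rewrite (_ : (fun _ => _) = (expR \o (fun s => Re (f s))) *
     (cos \o (fun s => Im (f s)))); last by [].
  by apply: is_derive_eq; rewrite cReM /GRing.scale/=; ring.
rewrite (_ : (fun _ => _) = (expR \o (fun s => Re (f s))) *
   (sin \o (fun s => Im (f s)))); last by [].
by apply: is_derive_eq; rewrite cImM /GRing.scale/=; ring.
Qed.

(** The mean value theorem is applied to the real and imaginary parts separately, whence the doubled
    bound. *)
Lemma cD_bound f df (B : R) : (forall s, 0 <= s <= 1 -> cD f s (df s)) ->
  (forall s, 0 <= s <= 1 -> normc (df s) <= B) -> normc (f 1 - f 0) <= B + B.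
Proof.
move=> fD dB.
have H (g dg : R -> R) : (forall s, 0 <= s <= 1 -> is_derive s 1 g (dg s)) ->
    (forall s, 0 <= s <= 1 -> `|dg s| <= B) -> `|g 1 - g 0| <= B.
  move=> gD gB.
  have [|c|c c01 ->] := @MVT_segment _ g dg 0 1 ler01.
  - by move=> s; rewrite in_itv/= => /andP[s0 s1]; apply: gD; rewrite !ltW.
  - apply: derivable_within_continuous => s; rewrite in_itv/= => /gD[]//.
  by rewrite subr0 mulr1 gB//; move: c01; rewrite in_itv.
apply: le_trans (normc_le _) _; rewrite !ReD !ImD !ReN !ImN.
apply: lerD; [apply: (H (fun s => Re (f s)) (fun s => Re (df s)))
             |apply: (H (fun s => Im (f s)) (fun s => Im (df s)))].
- by move=> s /fD[].
- by move=> s /dB; apply: le_trans; exact: normRe.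
- by move=> s /fD[].
- by move=> s /dB; apply: le_trans; exact: normIm.
Qed.

Lemma cD0_cst f : (forall s, 0 <= s <= 1 -> cD f s 0) -> f 1 = f 0.
Proof.
move=> fD; apply/eqP; rewrite -subr_eq0 -normc_eq0 eq_le normc_ge0 andbT.
have := @cD_bound f (fun=> 0) 0 fD; rewrite addr0; apply=> s _.
by rewrite normc0.
Qed.

Lemma cexpD z w : cexp (z + w) = cexp z * cexp w.
Proof.
apply: complexP; rewrite ?cReM ?cImM /cexp/= ReD ImD expRD ?cosD ?sinD; ring.
Qed.

Lemma cexp0 : cexp (0 : R[i]) = 1.
Proof. by rewrite /cexp/= expR0 cos0 sin0 mulr1 mulr0. Qed.

Lemma normc_cexp z : normc (cexp z) = expR (Re z).
Proof.
apply/eqP; rewrite -(@eqrXn2 _ 2) ?normc_ge0 ?expR_ge0// normc_sqr /= !exprMn.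
by rewrite -mulrDr cos2Dsin2 mulr1.
Qed.

Definition cexp_poly n : {poly R[i]} := \poly_(k < n) (k`!%:R)^-1.

Lemma deriv_cexp_poly n : (cexp_poly n.+1)^`() = cexp_poly n.
Proof.
apply/polyP => k; rewrite coef_deriv !coef_poly ltnS; case: ltnP => // kn; last by rewrite mul0rn.
rewrite factS natrM invfM -mulr_natr; field.
by rewrite nat1r !pnatr_eq0 -lt0n fact_gt0.
Qed.

(** Along s w, the derivative of the remainder of order n + 1 is w times the remainder of order n.
    Each use of [cD_bound] doubles the bound, hence 2^n in place of 1/n!. *)
Lemma cexp_taylor n w : normc (cexp w - (cexp_poly n).[w]) <=
  2 ^+ n * normc w ^+ n * expR (normc w).
Proof.
elim: n w => [|n IH] w.
  rewrite /cexp_poly poly_def big_ord0 horner0 subr0 normc_cexp !expr0 !mul1r ler_expR.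
  by rewrite (le_trans (ler_norm _))// normRe.
pose f s := cexp (s%:C * w) - (cexp_poly n.+1).[0 + s%:C * w].
pose df s := w * (cexp (s%:C * w) - (cexp_poly n).[s%:C * w]).
have fD s : 0 <= s <= 1 -> cD f s (df s).
  move=> _; rewrite /f /df.
  have h1 : cD (fun s => s%:C * w) s w.
    apply: cD_eq (cDM (cD_real (is_derive_id s 1)) (cD_cst w s)) _.
    by rewrite mulr0 addr0 mul1r.
  apply: cD_eq (cDB (cD_cexp h1) (cD_holo (holo_at_poly (cexp_poly n.+1) (0 + s%:C * w)))) _.
  by rewrite cder_poly deriv_cexp_poly add0r; ring.
have := @cD_bound f df (normc w * (2 ^+ n * normc w ^+ n * expR (normc w))) fD.
have -> : f 0 = 0.
  by rewrite /f mul0r addr0 cexp0 horner_coef0 coef_poly/= fact0 invr1 subrr.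
have -> : f 1 = cexp w - (cexp_poly n.+1).[w] by rewrite /f mul1r add0r.
rewrite subr0.
move=> h; rewrite exprS exprS.
rewrite (_ : 2 * _ * _ * _ = normc w * (2 ^+ n * normc w ^+ n * expR (normc w)) +
  normc w * (2 ^+ n * normc w ^+ n * expR (normc w))); last by ring.
apply: h => s /andP[s0 s1]; rewrite /df normcM ler_wpM2l ?normc_ge0//.
have sw : normc (s%:C * w) <= normc w.
  by rewrite normcM normc_real ger0_norm// ler_piMl ?normc_ge0.
apply: le_trans (IH _) _; apply: ler_pM => //.
- by rewrite mulr_ge0 ?exprn_ge0 ?normc_ge0.
- by rewrite ler_wpM2l ?exprn_ge0// lerXn2r ?nnegrE ?normc_ge0.
- by rewrite ler_expR.
Qed.

(** Factor cexp p(t + z) = cexp p(t) cexp q(z) with q(0) = 0. Since q(z) = O(|z|), truncating the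
    exponential series at order [n] and composing with [q] gives the jet. *)
Lemma holo_cexp_poly (p : {poly R[i]}) t : holo_at (fun z => cexp p.[z]) t.
Proof.
move=> n.
have [M [e [M0 e0 pM]]] := holo_lip (holo_at_poly p t).
pose q : {poly R[i]} := p \Po ('X + t%:P) - (p.[t])%:P.
have qE z : q.[z] = p.[t + z] - p.[t].
  by rewrite /q hornerD hornerN hornerC horner_comp hornerD hornerX hornerC (addrC z).
apply: (@jet_ext _ _ (fun z => cexp p.[t] * cexp q.[z]) _ 1) => // [z _|].
  by rewrite -cexpD qE addrC subrK.
apply: jetZ; exists (cexp_poly n \Po q), (2 ^+ n * M ^+ n * expR (M * 1)), (Num.min e 1); split.
- by rewrite mulr_ge0 ?expR_ge0// mulr_ge0// exprn_ge0.
- by rewrite lt_min e0 ltr01.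
move=> z; rewrite lt_min => /andP[/pM ze /ltW z1]; rewrite horner_comp.
apply: le_trans (cexp_taylor n _) _; rewrite qE.
have h : normc (p.[t + z] - p.[t]) ^+ n <= M ^+ n * normc z ^+ n.
  by rewrite -exprMn lerXn2r ?nnegrE ?mulr_ge0 ?normc_ge0.
rewrite (mulrAC (2 ^+ n * M ^+ n)) -(mulrA _ (M ^+ n)); apply: ler_pM.
- by rewrite mulr_ge0 ?exprn_ge0 ?normc_ge0.
- exact: expR_ge0.
- by rewrite ler_wpM2l// exprn_ge0.
- by rewrite ler_expR (le_trans ze)// ler_wpM2l.
Qed.

End RealVariable.

(** * Integrals of complex-valued functions *)

Section ComplexIntegral.
Variable R : realType.
Local Notation mu := (@lebesgue_measure R).
Local Notation RT := (measurableTypeR R).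
Implicit Types (z w c : R[i]).

Definition cmeas d (T : measurableType d) (D : set T) (f : T -> R[i]) :=
  measurable_fun D (fun x => Re (f x)) /\
  measurable_fun D (fun x => Im (f x)).

Definition cint (D : set RT) (f : R -> R[i]) := mu.-integrable D (fun x => (Re (f x))%:E) /\
  mu.-integrable D (fun x => (Im (f x))%:E).

Lemma cmeas_cst d (T : measurableType d) (D : set T) w : cmeas D (fun=> w).
Proof. by split; exact: measurable_cst. Qed.

Lemma cmeas_real d (T : measurableType d) (D : set T) (f : T -> R) :
  measurable_fun D f -> cmeas D (fun x => (f x)%:C).
Proof. by split => //; exact: measurable_cst. Qed.

Lemma cmeasD d (T : measurableType d) (D : set T) (f g : T -> R[i]) :
  cmeas D f -> cmeas D g -> cmeas D (fun x => f x + g x).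
Proof.
move=> [f1 f2] [g1 g2]; split.
  by under eq_fun do rewrite ReD; exact: measurable_funD.
by under eq_fun do rewrite ImD; exact: measurable_funD.
Qed.

Lemma cmeasN d (T : measurableType d) (D : set T) (f : T -> R[i]) :
  cmeas D f -> cmeas D (fun x => - f x).
Proof.
move=> [f1 f2]; split.
  by under eq_fun do rewrite ReN; exact: measurable_funN.
by under eq_fun do rewrite ImN; exact: measurable_funN.
Qed.

Lemma cmeasM d (T : measurableType d) (D : set T) (f g : T -> R[i]) :
  cmeas D f -> cmeas D g -> cmeas D (fun x => f x * g x).
Proof.
move=> [f1 f2] [g1 g2]; split.
  by under eq_fun do rewrite cReM; apply: measurable_funB; exact: measurable_funM.
by under eq_fun do rewrite cImM; apply: measurable_funD; exact: measurable_funM.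
Qed.

Lemma cmeas_cexp d (T : measurableType d) (D : set T) (f : T -> R[i]) :
  cmeas D f -> cmeas D (fun x => cexp (f x)).
Proof.
move=> [f1 f2]; split => /=; apply: measurable_funM.
- by apply: measurableT_comp f1; exact: measurable_expR.
- by apply: measurableT_comp f2; apply: continuous_measurable_fun; exact: continuous_cos.
- by apply: measurableT_comp f1; exact: measurable_expR.
- by apply: measurableT_comp f2; apply: continuous_measurable_fun; exact: continuous_sin.
Qed.

Lemma cmeas_eq d (T : measurableType d) (D : set T) (f g : T -> R[i]) :
  {in D, f =1 g} -> cmeas D f -> cmeas D g.
Proof.
by move=> fg [f1 f2]; split;
  [apply: eq_measurable_fun f1|apply: eq_measurable_fun f2] => x /fg ->.
Qed.

Lemma cmeas_comp d d' (T : measurableType d) (T' : measurableType d') (h : T -> T') (f : T' -> R[i])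
  (D' : set T') (D : set T) : measurable D' -> h @` D `<=` D' ->
  cmeas D' f -> measurable_fun D h -> cmeas D (f \o h).
Proof.
move=> mD' hD [f1 f2] mh; split.
  exact: (measurable_comp mD' hD f1 mh).
exact: (measurable_comp mD' hD f2 mh).
Qed.

Lemma cmeas_cvg d (T : measurableType d) (D : set T) (F : nat -> T -> R[i]) (f : T -> R[i]) :
  (forall n, cmeas D (F n)) ->
  (forall x, D x -> forall e : R, 0 < e -> exists N, forall n, (N <= n)%N -> normc (F n x - f x) < e) ->
  cmeas D f.
Proof.
move=> mF cF; split.
  apply: (@measurable_fun_cvg _ _ _ _ (fun n x => Re (F n x))) => [n|x Dx].
    by case: (mF n).
  apply/cvgrPdist_lt => e e0; have [N hN] := cF x Dx e e0; exists N => // n /= /hN.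
  by apply: le_lt_trans; rewrite distrC -ReN -ReD normRe.
apply: (@measurable_fun_cvg _ _ _ _ (fun n x => Im (F n x))) => [n|x Dx].
  by case: (mF n).
apply/cvgrPdist_lt => e e0; have [N hN] := cF x Dx e e0; exists N => // n /= /hN.
by apply: le_lt_trans; rewrite distrC -ImN -ImD normIm.
Qed.

Lemma measurable_normc d (T : measurableType d) (D : set T) (f : T -> R[i]) :
  cmeas D f -> measurable_fun D (fun x => normc (f x)).
Proof.
move=> [f1 f2].
have -> : (fun x => normc (f x)) =
    Num.sqrt \o (fun x => Re (f x) ^+ 2 + Im (f x) ^+ 2).
  by apply/funext => x /=; case: (f x).
apply: measurableT_comp.
  by apply: continuous_measurable_fun; exact: sqrt_continuous.
by apply: measurable_funD; exact: measurable_funX.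
Qed.

Lemma cint_cmeas (D : set RT) (f : R -> R[i]) : cint D f -> cmeas D f.
Proof. by move=> [/measurable_int/measurable_EFinP ? /measurable_int/measurable_EFinP ?]. Qed.

Lemma cint_le (D : set RT) (f : R -> R[i]) (g : R -> R) : measurable D -> cmeas D f ->
  mu.-integrable D (fun x => (g x)%:E) -> (forall x, D x -> normc (f x) <= g x) -> cint D f.
Proof.
move=> mD [f1 f2] ig fg; split.
  apply: le_integrable ig => //; first exact/measurable_EFinP.
  move=> x Dx; rewrite !abse_EFin lee_fin (le_trans (normRe _))// (le_trans (fg x Dx))//.
  exact: ler_norm.
apply: le_integrable ig => //; first exact/measurable_EFinP.
move=> x Dx; rewrite !abse_EFin lee_fin (le_trans (normIm _))// (le_trans (fg x Dx))//.
exact: ler_norm.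
Qed.

Lemma cint_normc (D : set RT) (f : R -> R[i]) : measurable D -> cint D f -> mu.-integrable D (fun x => (normc (f x))%:E).
Proof.
move=> mD fi; have [f1 f2] := fi; have /measurable_normc mf := cint_cmeas fi.
have := integrableD mD (integrable_abse f1) (integrable_abse f2).
apply: le_integrable => //; first exact/measurable_EFinP.
move=> x Dx /=; rewrite lee_fin ger0_norm ?normc_ge0// ger0_norm ?addr_ge0//.
exact: normc_le.
Qed.

(** The factor 2 pays for bounding the real and imaginary parts separately; every later estimate
    tolerates a constant. *)
Lemma Cintegral_bound (D : set RT) (f : R -> R[i]) (g : R -> R) : measurable D -> cmeas D f ->
  mu.-integrable D (fun x => (g x)%:E) -> (forall x, D x -> normc (f x) <= g x) ->
  normc (Cintegral D f) <= 2 * Rintegral mu D g.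
Proof.
move=> mD mf ig fg; have [f1 f2] := cint_le mD mf ig fg.
apply: le_trans (normc_le _) _; rewrite mulr_natl mulr2n; apply: lerD => /=.
  apply: le_trans (le_normr_Rintegral mD f1) _; apply: le_Rintegral => //.
    exact: integrable_norm.
  by move=> x /fg; apply: le_trans; exact: normRe.
apply: le_trans (le_normr_Rintegral mD f2) _; apply: le_Rintegral => //.
  exact: integrable_norm.
by move=> x /fg; apply: le_trans; exact: normIm.
Qed.

Lemma cintD (D : set RT) (f g : R -> R[i]) : measurable D -> cint D f -> cint D g -> cint D (fun x => f x + g x).
Proof.
move=> mD [f1 f2] [g1 g2]; split.
  by apply: eq_integrable (integrableD mD f1 g1) => // x _; rewrite /= ReD.
by apply: eq_integrable (integrableD mD f2 g2) => // x _; rewrite /= ImD.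
Qed.

Lemma cintZ (D : set RT) w (f : R -> R[i]) : measurable D -> cint D f -> cint D (fun x => w * f x).
Proof.
move=> mD [f1 f2]; split.
  apply: eq_integrable (integrableB mD (integrableZl mD (Re w) f1)
    (integrableZl mD (Im w) f2)) => // x _.
  by rewrite /= cReM EFinB !EFinM.
apply: eq_integrable (integrableD mD (integrableZl mD (Re w) f2)
  (integrableZl mD (Im w) f1)) => // x _.
by rewrite /= cImM EFinD !EFinM.
Qed.

Lemma CintegralD (D : set RT) (f g : R -> R[i]) : measurable D -> cint D f -> cint D g ->
  Cintegral D (fun x => f x + g x) = Cintegral D f + Cintegral D g.
Proof.
move=> mD [f1 f2] [g1 g2]; apply: complexP; rewrite ?ReD ?ImD /=.
  by rewrite -RintegralD//; apply: eq_Rintegral => x _; rewrite ReD.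
by rewrite -RintegralD//; apply: eq_Rintegral => x _; rewrite ImD.
Qed.

Lemma CintegralZ (D : set RT) w (f : R -> R[i]) : measurable D -> cint D f ->
  Cintegral D (fun x => w * f x) = w * Cintegral D f.
Proof.
move=> mD [f1 f2]; apply: complexP; rewrite ?cReM ?cImM /=.
  rewrite -RintegralZl// -RintegralZl// -RintegralB//; last 2 first.
  - by apply: eq_integrable (integrableZl mD _ f1).
  - by apply: eq_integrable (integrableZl mD _ f2).
  by apply: eq_Rintegral => x _; rewrite cReM.
rewrite -RintegralZl// -RintegralZl// -RintegralD//; last 2 first.
- by apply: eq_integrable (integrableZl mD _ f2).
- by apply: eq_integrable (integrableZl mD _ f1).
by apply: eq_Rintegral => x _; rewrite cImM.
Qed.

Lemma Cintegral0 (D : set R) : Cintegral D (fun=> 0) = 0 :> R[i].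
Proof. by apply: complexP => /=; rewrite /Rintegral integral0. Qed.

Lemma eq_Cintegral (D : set R) (f g : R -> R[i]) : (forall x, D x -> f x = g x) -> Cintegral D f = Cintegral D g.
Proof.
by move=> fg; apply: complexP => /=; apply: eq_Rintegral => x; rewrite inE => /fg ->.
Qed.

Lemma eq_cint (D : set RT) (f g : R -> R[i]) : measurable D -> (forall x, D x -> f x = g x) -> cint D f -> cint D g.
Proof.
by move=> mD fg [f1 f2]; split;
  [apply: eq_integrable f1|apply: eq_integrable f2] => // x; rewrite inE => /fg ->.
Qed.

Lemma CintegralB (D : set RT) (f g : R -> R[i]) : measurable D -> cint D f -> cint D g ->
  Cintegral D (fun x => f x - g x) = Cintegral D f - Cintegral D g.
Proof.
move=> mD fi gi; rewrite -mulN1r -CintegralZ// -CintegralD//; last exact: cintZ.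
by apply: eq_Cintegral => x _; rewrite mulN1r.
Qed.

Lemma cintB (D : set RT) (f g : R -> R[i]) : measurable D -> cint D f -> cint D g -> cint D (fun x => f x - g x).
Proof.
move=> mD fi gi; apply: eq_cint (cintD mD fi (cintZ (-1) mD gi)) => //.
by move=> x _; rewrite mulN1r.
Qed.

Lemma cint0 (D : set RT) : measurable D -> cint D (fun=> 0).
Proof. by move=> mD; split; exact: integrable0. Qed.

Lemma cint_sum (D : set RT) (n : nat) (F : nat -> R -> R[i]) : measurable D ->
  (forall i, cint D (F i)) -> cint D (fun x => \sum_(i < n) F i x).
Proof.
move=> mD Fi; elim: n => [|n IH].
  by apply: eq_cint (cint0 mD) => // x _; rewrite big_ord0.
by apply: eq_cint (cintD mD IH (Fi n)) => // x _; rewrite big_ord_recr.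
Qed.

Lemma Cintegral_sum (D : set RT) (n : nat) (F : nat -> R -> R[i]) : measurable D ->
  (forall i, cint D (F i)) ->
  Cintegral D (fun x => \sum_(i < n) F i x) = \sum_(i < n) Cintegral D (F i).
Proof.
move=> mD Fi; elim: n => [|n IH].
  rewrite big_ord0 -[RHS](Cintegral0 D); apply: eq_Cintegral => x _; by rewrite big_ord0.
rewrite big_ord_recr/= -IH -CintegralD//; last exact: cint_sum.
by apply: eq_Cintegral => x _; rewrite big_ord_recr.
Qed.

Lemma cD_continuous (f : R -> R[i]) x c : cD f x c ->
  {for x, continuous (fun s => Re (f s))} /\ {for x, continuous (fun s => Im (f s))}.
Proof.
by move=> [f1 f2]; split; apply: differentiable_continuous; apply/derivable1_diffP.
Qed.

Lemma cD_cmeas (D : set RT) (f df : R -> R[i]) : open D -> (forall x, D x -> cD f x (df x)) -> cmeas D f.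
Proof.
move=> oD fD; split; apply: open_continuous_measurable_fun => // x; rewrite inE => /fD.
  by move=> /cD_continuous[].
by move=> /cD_continuous[].
Qed.

Lemma lip_cmeas (D : set R) (F : R[i] -> R[i]) (t v : R[i]) : open D ->
  (forall x, D x -> lip_at F (t + x%:C * v)) -> cmeas D (fun x => F (t + x%:C * v)).
Proof.
move=> oD FD.
have H x : D x -> forall e, 0 < e -> \forall y \near x,
    normc (F (t + y%:C * v) - F (t + x%:C * v)) < e.
  move=> /FD[M [d [M0 d0 h]]] e e0.
  pose r := Num.min d (e / (M + 1)) / (normc v + 1).
  have M1 : 0 < M + 1 by rewrite ltr_wpDl.
  have v1 : 0 < normc v + 1 by rewrite ltr_wpDl// normc_ge0.
  have r0 : 0 < r by rewrite divr_gt0// lt_min d0 divr_gt0.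
  have : \forall y \near x, ball x r y by exact: nbhsx_ballx.
  apply: filterS => y; rewrite /ball/= => yr.
  have -> : t + y%:C * v = t + x%:C * v + (y - x)%:C * v by rewrite raddfB/=; ring.
  have : normc ((y - x)%:C * v) < Num.min d (e / (M + 1)).
    rewrite normcM normc_real distrC; apply: le_lt_trans (_ : `|x - y| * (normc v + 1) < _).
      by rewrite ler_wpM2l// lerDl.
    by rewrite -ltr_pdivlMr.
  rewrite lt_min => /andP[yd]; rewrite ltr_pdivlMr// => ye.
  apply: le_lt_trans (h _ yd) _; have := normc_ge0 ((y - x)%:C * v); move: ye; nra.
split; apply: open_continuous_measurable_fun => // x; rewrite inE => Dx;
  apply/cvgrPdist_lt => e e0; apply: filterS (H x Dx e e0) => y; apply: le_lt_trans.
  by rewrite distrC -ReN -ReD normRe.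
by rewrite distrC -ImN -ImD normIm.
Qed.

End ComplexIntegral.

(** * Affine change of variables *)

Section Substitution.
Variable R : realType.
Local Notation mu := (@lebesgue_measure R).
Local Notation RT := (measurableTypeR R).
Variables (k c : R).
Hypothesis k0 : 0 < k.
Let phi (x : RT) : RT := k * x + c.

Let mphi : measurable_fun [set: RT] phi.
Proof.
by apply: measurable_funD => //; apply: measurable_funM.
Qed.

Let nu : {measure set RT -> \bar R} :=
  @measure_function_pushforward__canonical__measure_function_Measure _ _ RT RT R mu phi mphi.

(** Lebesgue measure is determined by half-open intervals, and the preimage of such an interval
    under [phi] is shorter by the factor [k]. *)
Lemma affine_measure (A : set RT) : measurable A ->
  mu A = mscale (NngNum (ltW k0)) nu A.
Proof.
move=> mA; apply: lebesgue_measure_unique => //= _ [[a b]] _ <-.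
rewrite /mscale/= /nu/= /pushforward.
have -> : phi @^-1` `]a, b]%classic = `]((a - c) / k), ((b - c) / k)]%classic.
  apply/seteqP; split => x /=; rewrite !in_itv/= ltr_pdivrMr// ler_pdivlMr// /phi mulrC;
    by rewrite ltrBlDr lerBrDr.
rewrite !lebesgue_measure_itv/= !lte_fin ltr_pM2r ?invr_gt0// ltrD2r.
case: ifPn => _; last by rewrite mule0.
rewrite -!EFinD -EFinM; congr EFin; field.
exact: lt0r_neq0.
Qed.

Lemma ge0_integral_affine (D : set RT) (f : RT -> \bar R) : measurable D ->
  measurable_fun D f -> (forall x, D x -> (0 <= f x)%E) ->
  (\int[mu]_(x in D) f x = k%:E * \int[mu]_(x in phi @^-1` D) f (phi x))%E.
Proof.
move=> mD mf f0.
rewrite (eq_measure_integral (mscale (NngNum (ltW k0)) nu)); last first.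
  by move=> A mA _; exact: affine_measure.
rewrite ge0_integral_mscale//=; congr (_ * _)%E.
by rewrite (ge0_integral_pushforward mphi)// => x; rewrite inE => /f0.
Qed.

Lemma integrable_affine (D : set RT) (f : RT -> \bar R) : measurable D ->
  mu.-integrable D f -> mu.-integrable (phi @^-1` D) (f \o phi).
Proof.
move=> mD /integrableP[mf foo]; apply/integrableP; split.
  apply: (measurable_comp mD) => //; first by move=> _ [x /= Dx <-].
  exact: measurable_funTS.
move: foo; rewrite ge0_integral_affine//; last by exact: measurableT_comp.
by move=> h; rewrite ltey; apply/eqP => h'; move: h; rewrite /= h' gt0_muley.
Qed.

Lemma integral_affine (D : set RT) (f : RT -> \bar R) : measurable D ->
  mu.-integrable D f ->
  (\int[mu]_(x in D) f x = k%:E * \int[mu]_(x in phi @^-1` D) f (phi x))%E.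
Proof.
move=> mD fi; have mf := measurable_int mu fi.
have mD' : measurable (phi @^-1` D).
  by rewrite -[X in measurable X]setTI; exact: mphi.
have fi' := integrable_affine mD fi.
transitivity (k%:E * (\int[mu]_(x in phi @^-1` D) (f \o phi)^\+ x -
  \int[mu]_(x in phi @^-1` D) (f \o phi)^\- x))%E; last by rewrite -integralE.
have Ep : (\int[mu]_(x in D) f^\+ x = k%:E * \int[mu]_(x in phi @^-1` D) (f \o phi)^\+ x)%E.
  rewrite [in RHS]funepos_comp.
  exact: (ge0_integral_affine mD (measurable_funepos mf) (fun x _ => funepos_ge0 f x)).
have En : (\int[mu]_(x in D) f^\- x = k%:E * \int[mu]_(x in phi @^-1` D) (f \o phi)^\- x)%E.
  rewrite [in RHS]funeneg_comp.
  exact: (ge0_integral_affine mD (measurable_funeneg mf) (fun x _ => funeneg_ge0 f x)).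
rewrite [LHS]integralE Ep En [RHS]muleBr//.
by apply: fin_num_adde_defl; rewrite fin_numN; exact: (integrable_neg_fin_num mD' fi').
Qed.

Lemma Cintegral_affine (D : set RT) (f : R -> R[i]) : measurable D -> cint D f ->
  cint (phi @^-1` D) (fun x => f (k * x + c)) /\
  Cintegral D f = k%:C * Cintegral (phi @^-1` D) (fun x => f (k * x + c)).
Proof.
move=> mD [f1 f2]; have i1 := integrable_affine mD f1; have i2 := integrable_affine mD f2.
have mD' : measurable (phi @^-1` D).
  by rewrite -[X in measurable X]setTI; exact: mphi.
split; first by split.
apply: complexP; rewrite ?cReM ?cImM /= mul0r ?subr0 ?addr0 /Rintegral.
  rewrite integral_affine// fineM//; exact: (integrable_fin_num mD' i1).
rewrite integral_affine// fineM//; exact: (integrable_fin_num mD' i2).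
Qed.

End Substitution.

(** * Fundamental theorem of calculus on an increasing union of segments *)

Section Exhaustion.
Variable R : realType.
Local Notation mu := (@lebesgue_measure R).
Local Notation RT := (measurableTypeR R).
Variables (D : set RT) (a b : nat -> R) (W w : R -> R).
Hypothesis mD : measurable D.
Hypothesis ab : forall n, a n < b n.
Hypothesis nd : nondecreasing_seq (fun n => `[a n, b n]%classic).
Hypothesis DE : D = \bigcup_n `[a n, b n]%classic.
Hypothesis dW : forall x, D x -> is_derive x 1 W (w x).
Hypothesis cw : forall x, D x -> {for x, continuous w}.

Let abD n x : a n <= x <= b n -> D x.
Proof. by move=> h; rewrite DE; exists n => //=; rewrite in_itv. Qed.

Lemma exhaust_measurable : measurable_fun D w.
Proof.
rewrite DE; apply/measurable_fun_bigcup => [n|n]; first exact: measurable_itv.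
apply: subspace_continuous_measurable_fun; first exact: measurable_itv.
by apply: continuous_in_subspaceT => x; rewrite inE/= in_itv/= => /abD /cw.
Qed.

Lemma exhaust_FTC n : (\int[mu]_(x in `[a n, b n]) (w x)%:E = (W (b n) - W (a n))%:E)%E.
Proof.
rewrite (continuous_FTC2 (F := W))//.
- by apply: continuous_in_subspaceT => x; rewrite inE/= in_itv/= => /abD /cw.
- have cW x : a n <= x <= b n -> {for x, continuous W}.
    move=> /abD /dW h; apply: differentiable_continuous.
    by apply/derivable1_diffP; exact: ex_derive.
  split.
  + by move=> x; rewrite in_itv/= => /andP[x1 x2]; have := @abD n x; rewrite !ltW// => /(_ isT)/dW[].
  + by apply: cvg_at_right_filter; apply: cW; rewrite lexx ltW.
  + by apply: cvg_at_left_filter; apply: cW; rewrite lexx ltW.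
- move=> x; rewrite in_itv/= => /andP[x1 x2]; have := @abD n x; rewrite !ltW// => /(_ isT)/dW[_ <-].
  by rewrite derive1E.
Qed.

(** Monotone convergence: a nonnegative [w] with a bounded primitive has integral at most 2 B on
    each segment. *)
Lemma exhaust_integrable (B : R) : (forall x, D x -> 0 <= w x) ->
  (forall x, D x -> `|W x| <= B) -> mu.-integrable D (fun x => (w x)%:E).
Proof.
move=> w0 WB; apply/integrableP; split; first by apply/measurable_EFinP; exact: exhaust_measurable.
rewrite (eq_integral (fun x : RT => (w x)%:E)); last first.
  by move=> x; rewrite inE => /w0 ?; rewrite abse_EFin ger0_norm.
have h := @ge0_nondecreasing_set_cvg_integral _ RT R (fun n => `[a n, b n]%classic)
  (fun x => (w x)%:E) mu nd.
have cv : (\int[mu]_(x in `[a i, b i]) (w x)%:E)%E @[i --> \oo] --> (\int[mu]_(x in D) (w x)%:E)%E.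
  rewrite [in X in _ --> X]DE; apply: h.
  - by move=> n; exact: measurable_itv.
  - move=> n; apply: measurable_funS (_ : measurable_fun D _) => //.
      by move=> x /=; rewrite in_itv => /abD.
    by apply/measurable_EFinP; exact: exhaust_measurable.
  - by move=> n x /=; rewrite in_itv/= lee_fin => /abD/w0.
apply: (@le_lt_trans _ _ (B + B)%:E); last exact: ltry.
rewrite -(cvg_lim _ cv)//; apply: lime_le; first by apply/cvg_ex; eexists; exact: cv.
apply: nearW => n; rewrite exhaust_FTC lee_fin.
have Da : D (a n) by apply: (@abD n); rewrite lexx ltW.
have Db : D (b n) by apply: (@abD n); rewrite lexx ltW.
by rewrite (le_trans (ler_norm _))// (le_trans (ler_normB _ _))// lerD// WB.
Qed.

(** Dominated convergence with |w| itself as dominating function; the integrals over the segments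
    are W (b n) - W (a n). *)
Lemma exhaust_integral (l0 l1 : R) : mu.-integrable D (fun x => (w x)%:E) ->
  W (a n) @[n --> \oo] --> l0 -> W (b n) @[n --> \oo] --> l1 ->
  Rintegral mu D w = l1 - l0.
Proof.
move=> wi Wa Wb.
pose f_ n (x : RT) : \bar R := ((w x)%:E * (\1_`[a n, b n] x)%:E)%E.
have wm := measurable_int mu wi.
have mI n : measurable_fun D (fun x : RT => (\1_`[a n, b n] x)%:E : \bar R).
  by apply/measurable_EFinP; apply: measurable_indic; exact: measurable_itv.
have [||_ _ cv] := @dominated_convergence _ RT R mu D mD f_ (fun x => (w x)%:E) (fun x => `|(w x)%:E|)%E
  (fun n => emeasurable_funM wm (mI n)) wm _ (integrable_abse wi) _.
- apply: aeW => x Dx; have [n _ nx] : (\bigcup_n `[a n, b n]%classic) x by rewrite -DE.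
  apply: cvg_near_cst; exists n => // m /= nm.
  by rewrite /f_ indicE mem_set ?mule1//; move: (nd nm); rewrite subsetEset; apply.
- apply: aeW => x n Dx; rewrite /f_ abseM indicE.
  by rewrite !abse_EFin -EFinM lee_fin; case: (_ \in _); rewrite ?normr1 ?normr0 ?mulr1 ?mulr0.
have cv2 : (W (b n) - W (a n))%:E @[n --> \oo] --> (\int[mu]_(x in D) (w x)%:E)%E.
  move: cv; apply: cvg_trans; apply: near_eq_cvg; apply: nearW => n.
  rewrite /= -exhaust_FTC.
  have -> : `[a n, b n]%classic = D `&` `[a n, b n]%classic.
    by apply/esym/setIidPr => x /=; rewrite in_itv/=; exact: abD.
  rewrite integral_mkcondr; apply: eq_integral => x _.
  by rewrite /f_ patchE indicE; case: (_ \in _); rewrite ?mule1 ?mule0.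
have cv3 : (W (b n) - W (a n))%:E @[n --> \oo] --> (l1 - l0)%:E.
  by apply: cvg_EFin; [exact: nearW|exact: cvgB].
by rewrite /Rintegral (cvg_unique _ cv2 cv3).
Qed.

End Exhaustion.

(** * The half-line and the open unit interval *)

Section Intervals.
Variable R : realType.
Local Notation mu := (@lebesgue_measure R).
Local Notation RT := (measurableTypeR R).
Implicit Types (x s : R).

Local Notation H := (`]0%R, +oo[%classic : set RT).
Local Notation I := (`]0%R, 1%R[%classic : set RT).

Definition ccont (w : R -> R[i]) x :=
  {for x, continuous (fun s => Re (w s))} /\ {for x, continuous (fun s => Im (w s))}.

(** The offsets keep the first segments nondegenerate: [1/2, 2] in the half-line and [1/3, 2/3] in
    the unit interval. *)
Let pa n : R := n.+2%:R^-1.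
Let pb n : R := n.+2%:R.
Let qa n : R := n.+3%:R^-1.
Let qb n : R := 1 - n.+3%:R^-1.

Let mH : measurable H. Proof. exact: measurable_itv. Qed.
Let mI : measurable I. Proof. exact: measurable_itv. Qed.

Let pa_small (d : R) : 0 < d -> \forall n \near \oo, pa n < d.
Proof.
move=> d0; have := @cvg_harmonic R; rewrite -cvg_shiftS => /cvgrPdist_lt /(_ d d0).
apply: filterS => n; rewrite /= sub0r normrN ger0_norm//.
Qed.

Let qa_small (d : R) : 0 < d -> \forall n \near \oo, qa n < d.
Proof.
move=> d0; have [N _ h] := pa_small d0; exists N => // n /= Nn.
by apply: (h n.+1); exact: leqW.
Qed.

Let pab n : pa n < pb n.
Proof. by rewrite /pa /pb (lt_trans (_ : _ < 1))// ?invf_lt1 ?ltr1n. Qed.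

Let qab n : qa n < qb n.
Proof.
rewrite /qa /qb ltrBrDr -mulr2n -[_ *+ 2]mulr_natl ltr_pdivrMr// mul1r ltr_nat//.
Qed.

Let pE : H = \bigcup_n `[pa n, pb n]%classic.
Proof.
apply/seteqP; split => [x /=|x [n _] /=]; rewrite in_itv/= ?andbT.
  move=> x0.
  have [N _ hN] := pa_small x0; pose m := maxn N (Num.truncn x).
  exists m => //=; rewrite in_itv/= ltW/=; last by apply: hN; exact: leq_maxl.
  rewrite /pb (le_trans (ltW (truncnS_gt x)))// ler_nat.
  by rewrite ltnS leqW// leq_maxr.
move=> /andP[h _].
by rewrite in_itv/= andbT (lt_le_trans _ h)// /pa invr_gt0.
Qed.

Let qE : I = \bigcup_n `[qa n, qb n]%classic.
Proof.
apply/seteqP; split => [x /=|x [n _] /=]; rewrite in_itv/= => /andP[].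
  move=> x0 x1.
  have x1' : 0 < 1 - x by rewrite subr_gt0.
  have [N _ hN] := qa_small x0; have [M _ hM] := qa_small x1'.
  exists (maxn N M) => //=; rewrite in_itv/= ltW/=; last by apply: hN; exact: leq_maxl.
  by have /ltW := hM _ (leq_maxr N M); rewrite /qa /qb lerBrDr -lerBrDl.
move=> h1 h2; rewrite in_itv/=.
have q0 : 0 < n.+3%:R^-1 :> R by rewrite invr_gt0.
by rewrite (lt_le_trans q0 h1)/= (le_lt_trans h2)// /qb ltrBlDr ltrDl.
Qed.

Let pnd : nondecreasing_seq (fun n => `[pa n, pb n]%classic).
Proof.
move=> n m nm; rewrite subsetEset => x /=; rewrite !in_itv/= => /andP[h1 h2].
apply/andP; split.
  by apply: le_trans h1; rewrite /pa lef_pV2 ?posrE// ler_nat.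
by apply: (le_trans h2); rewrite /pb ler_nat.
Qed.

Let qnd : nondecreasing_seq (fun n => `[qa n, qb n]%classic).
Proof.
move=> n m nm; rewrite subsetEset => x /=; rewrite !in_itv/= => /andP[h1 h2].
apply/andP; split.
  by apply: le_trans h1; rewrite /qa lef_pV2 ?posrE// ler_nat.
by apply: (le_trans h2); rewrite /qb lerD2l lerN2 lef_pV2 ?posrE// ler_nat.
Qed.

Lemma halfline_integrable (W w : R -> R) (B : R) :
  (forall x, 0 < x -> is_derive x 1 W (w x)) -> (forall x, 0 < x -> {for x, continuous w}) ->
  (forall x, 0 < x -> 0 <= w x) -> (forall x, 0 < x -> `|W x| <= B) ->
  mu.-integrable H (fun x => (w x)%:E).
Proof.
move=> dW cw w0 WB; have E x : H x -> 0 < x by rewrite /= in_itv/= andbT.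
exact: (exhaust_integrable mH pab pnd pE (fun x h => dW x (E x h)) (fun x h => cw x (E x h))
  (fun x h => w0 x (E x h)) (fun x h => WB x (E x h))).
Qed.

Lemma unit_integrable (W w : R -> R) (B : R) :
  (forall x, 0 < x < 1 -> is_derive x 1 W (w x)) -> (forall x, 0 < x < 1 -> {for x, continuous w}) ->
  (forall x, 0 < x < 1 -> 0 <= w x) -> (forall x, 0 < x < 1 -> `|W x| <= B) ->
  mu.-integrable I (fun x => (w x)%:E).
Proof.
move=> dW cw w0 WB; have E x : I x -> 0 < x < 1 by rewrite /= in_itv/=.
exact: (exhaust_integrable mI qab qnd qE (fun x h => dW x (E x h)) (fun x h => cw x (E x h))
  (fun x h => w0 x (E x h)) (fun x h => WB x (E x h))).
Qed.

Lemma halfline_FTC (W w : R -> R[i]) : (forall x, 0 < x -> cD W x (w x)) ->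
  (forall x, 0 < x -> ccont w x) -> cint H w ->
  (forall e : R, 0 < e -> exists2 d : R, 0 < d & forall x, 0 < x < d -> normc (W x) < e) ->
  (forall e : R, 0 < e -> exists B : R, forall x, B < x -> normc (W x) < e) ->
  Cintegral H w = 0.
Proof.
move=> dW cw [w1 w2] W0 Wy.
have H0 (g : R[i] -> R) : (forall z, `|g z| <= normc z) -> g (W (pa n)) @[n --> \oo] --> (0 : R).
  move=> gz; apply/cvgrPdist_lt => e /W0[d d0 h].
  near=> n; rewrite sub0r normrN (le_lt_trans (gz _))// h// invr_gt0 ltr0n/=.
  by near: n; exact: pa_small.
have Hy (g : R[i] -> R) : (forall z, `|g z| <= normc z) -> g (W (pb n)) @[n --> \oo] --> (0 : R).
  move=> gz; apply/cvgrPdist_lt => e /Wy[B h].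
  near=> n; rewrite sub0r normrN (le_lt_trans (gz _))// h// /pb.
  rewrite (lt_le_trans (le_lt_trans (ler_norm B) (truncnS_gt `|B|)))// ler_nat.
  by rewrite ltnS leqW//; near: n; exists (Num.truncn `|B|).
apply: complexP => /=; rewrite -[RHS](subrr 0).
- apply: (exhaust_integral mH pab pnd pE (W := fun x => Re (W x))) w1 (H0 _ (@normRe R)) (Hy _ (@normRe R)) => x /=.
    by rewrite in_itv/= andbT => /dW[].
  by rewrite in_itv/= andbT => /cw[].
- apply: (exhaust_integral mH pab pnd pE (W := fun x => Im (W x))) w2 (H0 _ (@normIm R)) (Hy _ (@normIm R)) => x /=.
    by rewrite in_itv/= andbT => /dW[].
  by rewrite in_itv/= andbT => /cw[].
Unshelve. all: by end_near. Qed.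

Lemma unit_FTC (W w : R -> R[i]) : (forall x, 0 <= x <= 1 -> cD W x (w x)) ->
  (forall x, 0 < x < 1 -> ccont w x) -> cint I w -> Cintegral I w = W 1 - W 0.
Proof.
move=> dW cw [w1 w2].
have qa0 : qa n @[n --> \oo] --> (0 : R).
  apply/cvgrPdist_lt => e /qa_small; apply: filterS => n.
  by rewrite sub0r normrN ger0_norm// invr_ge0.
have qb1 : qb n @[n --> \oo] --> (1 : R).
  by rewrite -[X in _ --> X]subr0; apply: cvgB => //; exact: cvg_cst.
have /dW/cD_continuous[cR0 cI0] : 0 <= (0 : R) <= 1 by rewrite lexx ler01.
have /dW/cD_continuous[cR1 cI1] : 0 <= (1 : R) <= 1 by rewrite lexx ler01.
apply: complexP; rewrite ?ReD ?ImD ?ReN ?ImN /=.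
  apply: (exhaust_integral mI qab qnd qE (W := fun x => Re (W x))) => //.
  - by move=> x /=; rewrite in_itv/= => /andP[x0 x1]; case: (dW x) => //; rewrite !ltW.
  - by move=> x /=; rewrite in_itv/= => /cw[].
  - exact: (cvg_comp _ _ qa0 cR0).
  - exact: (cvg_comp _ _ qb1 cR1).
apply: (exhaust_integral mI qab qnd qE (W := fun x => Im (W x))) => //.
- by move=> x /=; rewrite in_itv/= => /andP[x0 x1]; case: (dW x) => //; rewrite !ltW.
- by move=> x /=; rewrite in_itv/= => /cw[].
- exact: (cvg_comp _ _ qa0 cI0).
- exact: (cvg_comp _ _ qb1 cI1).
Qed.

End Intervals.

(** * Laplace transforms with power weights *)

Section PowersAndLaplace.
Variable R : realType.
Local Notation mu := (@lebesgue_measure R).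
Local Notation RT := (measurableTypeR R).
Local Notation H := (`]0%R, +oo[%classic : set RT).
Local Notation I := (`]0%R, 1%R[%classic : set RT).
Implicit Types (z w c alpha zeta : R[i]) (x s : R) (F G : R[i] -> R[i]).

(** For x > 0 this is the principal power ([cpow_real]), written without the argument so that it can
    be differentiated in [x] directly. *)
Definition rpow x w : R[i] := cexp (w * (ln x)%:C).

Lemma rpowD x w z : rpow x (w + z) = rpow x w * rpow x z.
Proof. by rewrite /rpow mulrDl cexpD. Qed.

Lemma rpow0 x : rpow x 0 = 1.
Proof. by rewrite /rpow mul0r cexp0. Qed.

Lemma rpow1w w : rpow 1 w = 1.
Proof. by rewrite /rpow ln1 mulr0 cexp0. Qed.

Lemma rpow1 x : 0 < x -> rpow x 1 = x%:C.
Proof.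
by move=> x0; rewrite /rpow mul1r /cexp/= cos0 sin0 mulr1 mulr0 lnK.
Qed.

Lemma rpowM x s w : 0 < x -> 0 < s -> rpow (x * s) w = rpow x w * rpow s w.
Proof. by move=> x0 s0; rewrite /rpow lnM ?posrE// raddfD/= mulrDr cexpD. Qed.

Lemma normc_rpow x w : 0 < x -> normc (rpow x w) = x `^ Re w.
Proof.
move=> x0; rewrite normc_cexp cReM /= mulr0 subr0 /powR gt_eqF//.
Qed.

Lemma rpow_neq0 x w : rpow x w != 0.
Proof. by rewrite -normc_gt0 normc_cexp expR_gt0. Qed.

Lemma rpowN x w : rpow x (- w) = (rpow x w)^-1.
Proof.
apply: (mulfI (rpow_neq0 x w)); rewrite -rpowD subrr rpow0 divff//.
exact: rpow_neq0.
Qed.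

Lemma realcV x : (x^-1)%:C = (x%:C)^-1 :> R[i].
Proof. exact: (fmorphV (real_complex R)). Qed.

Lemma cD_rpow x w : 0 < x -> cD (fun s => rpow s w) x (w * rpow x (w - 1)).
Proof.
move=> x0; have h := cD_cexp (cDZ w (cD_real (is_derive1_ln x0))).
apply: cD_eq h _; rewrite rpowD rpowN rpow1// -/(rpow x w) realcV.
by rewrite /rpow; ring.
Qed.

Lemma cpow_real x w : 0 < x -> cpow x%:C w = rpow x w.
Proof.
move=> x0; rewrite /cpow /rpow /clog normc_real gtr0_norm//; congr (cexp (w * _)).
by rewrite /principal_arg /= lexx expr0n addr0 sqrtr_sqr gtr0_norm// divff ?gt_eqF// acos1.
Qed.

Lemma cD_ccont (f : R -> R[i]) x c : cD f x c -> ccont f x.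
Proof. exact: cD_continuous. Qed.

Lemma ccontM (f g : R -> R[i]) x : ccont f x -> ccont g x -> ccont (fun s => f s * g s) x.
Proof.
move=> [f1 f2] [g1 g2]; split.
  have -> : (fun s => Re (f s * g s)) = (fun s =>
     Re (f s) * Re (g s) - Im (f s) * Im (g s)).
    by apply/funext => s; rewrite cReM.
  by apply: cvgB; apply: cvgM.
have -> : (fun s => Im (f s * g s)) = (fun s =>
   Re (f s) * Im (g s) + Im (f s) * Re (g s)).
  by apply/funext => s; rewrite cImM.
by apply: cvgD; apply: cvgM.
Qed.

Lemma ccontD (f g : R -> R[i]) x : ccont f x -> ccont g x -> ccont (fun s => f s + g s) x.
Proof.
move=> [f1 f2] [g1 g2]; split.
  have -> : (fun s => Re (f s + g s)) = (fun s => Re (f s) + Re (g s)).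
    by apply/funext => s; rewrite ReD.
  by apply: cvgD.
have -> : (fun s => Im (f s + g s)) = (fun s => Im (f s) + Im (g s)).
  by apply/funext => s; rewrite ImD.
by apply: cvgD.
Qed.

Lemma cmeas_rpow w : cmeas H (fun x => rpow x w).
Proof.
apply: (@cD_cmeas _ _ _ (fun x => w * rpow x (w - 1))); first exact: interval_open.
by move=> x /=; rewrite in_itv/= andbT; exact: cD_rpow.
Qed.

Lemma powR_expR_bound (b x : R) : 0 <= b -> 0 < x ->
  exists2 C : R, 0 < C & forall v, 0 < v -> v `^ b <= C * expR (x * v).
Proof.
move=> b0 x0; have [->|bn0] := eqVneq b 0.
  exists 1 => // v v0; rewrite powRr0 mul1r -expR0 ler_expR; nra.
have {b0 bn0}b0 : 0 < b by rewrite lt_def bn0.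
(* After the substitution v = (b / x) y, the claim is ln y <= y. *)
exists (expR (b * ln (b / x))); first exact: expR_gt0.
move=> v v0; rewrite /powR gt_eqF// -expRD ler_expR.
pose y := v * x / b; have y0 : 0 < y by rewrite divr_gt0// mulr_gt0.
have bx0 : 0 < b / x by rewrite divr_gt0.
have -> : v = (b / x) * y by rewrite /y; field; rewrite !gt_eqF.
rewrite lnM ?posrE// mulrDr lerD2l.
have -> : x * (b / x * y) = b * y by field; rewrite gt_eqF.
by rewrite ler_pM2l// ltW// ln_sublinear.
Qed.

Lemma int_powR_unit (sg : R) : -1 < sg -> mu.-integrable I (fun s => (s `^ sg)%:E).
Proof.
move=> s1; have p0 : 0 < sg + 1 by lra.
apply: (@unit_integrable _ (fun s => s `^ (sg + 1) / (sg + 1)) _ (1 / (sg + 1))).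
- move=> x /andP[x0 x1].
  have h := is_derive1_powR (sg + 1) x0.
  have -> : (fun s : R => s `^ (sg + 1) / (sg + 1)) = (sg + 1)^-1 *: (fun s : R => s `^ (sg + 1) : R).
    by apply/funext => s; rewrite mulrC.
  apply: is_derive_eq; rewrite /GRing.scale/= addrK mulrA mulVf ?mul1r//.
  exact: lt0r_neq0.
- move=> x /andP[x0 x1]; apply: differentiable_continuous; apply/derivable1_diffP.
  by have [] := is_derive1_powR sg x0.
- by move=> x _; exact: powR_ge0.
- move=> x /andP[x0 x1]; rewrite ger0_norm; last by rewrite divr_ge0 ?powR_ge0 ?ltW.
  have {3}<- : 1 `^ (sg + 1) = 1 :> R by rewrite powR1.
  rewrite ler_pM2r ?invr_gt0//.
  by apply: ge0_ler_powR; rewrite ?nnegrE ?ltW.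
Qed.

Lemma int_powR_exp (sg x : R) : -1 < sg -> 0 < x ->
  mu.-integrable H (fun v => (v `^ sg * expR (- (x * v)))%:E).
Proof.
move=> s1 x0; have p0 : 0 < sg + 1 by lra.
pose p v : R := v `^ (sg + 1).
(* the dominating function: u is the derivative of the bounded function p / (1 + p) *)
pose u v : R := (sg + 1) * v `^ sg / (1 + p v) ^+ 2.
have p1 v : 0 < 1 + p v by rewrite ltr_pwDl// powR_ge0.
have iu : mu.-integrable H (fun v => (u v)%:E).
  have dp (v : R) : 0 < v -> is_derive v 1 p ((sg + 1) * v `^ sg).
    by move=> v0; have := is_derive1_powR (sg + 1) v0; rewrite addrK.
  apply: (@halfline_integrable _ (- (fun v : R => (1 + p v)^-1 : R)) _ 1).
  - move=> v v0; have h := dp v v0.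
    have h1 : is_derive v 1 (fun v => 1 + p v) ((sg + 1) * v `^ sg).
      by have := is_deriveD (is_derive_cst (1 : R) v 1) h; rewrite add0r.
    have hV := @is_deriveV _ (fun v : R => 1 + p v) v _ 1 (lt0r_neq0 (p1 v)) h1.
    have hN := is_deriveN hV.
    apply: is_derive_eq.
    by rewrite /u /GRing.scale/=; field; exact: lt0r_neq0.
  - move=> v v0.
    have c0 : {for v, continuous (fun v : R => v `^ sg : R)}.
      apply: differentiable_continuous; apply/derivable1_diffP.
      by have [] := is_derive1_powR sg v0.
    have c1' : {for v, continuous p}.
      by apply: differentiable_continuous; apply/derivable1_diffP; have [] := dp v v0.
    apply: cvgM; first by apply: cvgM; [exact: cvg_cst|exact: c0].
    apply: cvgV; first by rewrite expf_neq0// lt0r_neq0.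
    have c1 : (1 + p v) @[v --> v] --> 1 + p v.
      by apply: cvgD; [exact: cvg_cst|exact: c1'].
    by under eq_fun do rewrite expr2; rewrite expr2; exact: cvgM.
  - by move=> v v0; rewrite /u divr_ge0// ?sqr_ge0// mulr_ge0 ?powR_ge0 ?ltW.
  - move=> v v0; rewrite normrN ger0_norm ?invr_ge0 ?(ltW (p1 v))//.
    by rewrite invf_le1// lerDl powR_ge0.
(* (1 + p)^2 <= 2 + 2 p^2, and p^2 = v^(2 (sg + 1)) is bounded by C exp (x v). So the integrand is
   at most a constant times [u]. *)
have [C C0 hC] := powR_expR_bound (ltW (mulr_gt0 (ltr0n _ 2) p0)) x0.
have E0 v : 0 < v -> (1 + p v) ^+ 2 <= (2 + 2 * C) * expR (x * v).
  move=> v0; have := hC v v0.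
  have -> : v `^ (2 * (sg + 1)) = p v ^+ 2.
    by rewrite mulrC powRrM -[RHS]powR_mulrn// powR_ge0.
  have : 1 <= expR (x * v) by rewrite -expR0 ler_expR; nra.
  have := sqr_ge0 (p v - 1); rewrite !expr2; nra.
apply: (@le_integrable _ _ _ mu H _ _ (fun v => ((2 + 2 * C) / (sg + 1))%:E * (u v)%:E)%E) => //.
- apply/measurable_EFinP; apply: measurable_funM.
    apply: open_continuous_measurable_fun; first exact: interval_open.
    move=> v; rewrite inE/= in_itv/= andbT => v0.
    apply: differentiable_continuous; apply/derivable1_diffP.
    by have [] := is_derive1_powR sg v0.
  apply: measurableT_comp; first exact: measurable_expR.
  by apply: measurable_funN; apply: measurable_funM.
- move=> v /=; rewrite in_itv/= andbT => v0.
  rewrite !ger0_norm ?lee_fin; last 2 first.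
  + apply: mulr_ge0; first by rewrite divr_ge0 ?(ltW p0)// addr_ge0// mulr_ge0// ltW.
    by rewrite /u divr_ge0 ?sqr_ge0// mulr_ge0 ?powR_ge0 ?ltW.
  + by rewrite mulr_ge0 ?powR_ge0 ?expR_ge0.
  rewrite expRN /u; have h := E0 v v0.
  have -> : (2 + 2 * C) / (sg + 1) * ((sg + 1) * v `^ sg / (1 + p v) ^+ 2) =
    v `^ sg * ((2 + 2 * C) / (1 + p v) ^+ 2).
    by field; rewrite !lt0r_neq0.
  rewrite ler_wpM2l ?powR_ge0// ler_pdivlMr ?exprn_gt0//.
  by rewrite mulrC ler_pdivrMr ?expR_gt0.
- exact: integrableZl.
Qed.

(** The bare integral; [laplace_powE] restores the factor zeta^(1 + alpha), the only place where a
    complex power of zeta occurs. *)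
Definition lap alpha F zeta : R[i] :=
  Cintegral H (fun x => cexp (- (zeta * x%:C)) * (rpow x alpha * F x%:C)).

Lemma laplace_powE alpha F zeta : laplace_pow alpha F zeta = cpow zeta alpha * (zeta * lap alpha F zeta).
Proof.
rewrite /laplace_pow /laplace /lap; congr (_ * (_ * _)); apply: eq_Cintegral => x /=.
by rewrite in_itv/= andbT => x0; rewrite cpow_real.
Qed.

Definition ray_bound F (r : R) := exists2 M : R, 0 <= M &
  forall x, 0 < x -> normc (F x%:C) <= M * expR (r * x).

Lemma normc_lap_integrand alpha F zeta (M r : R) x : 0 < x ->
  normc (F x%:C) <= M * expR (r * x) ->
  normc (cexp (- (zeta * x%:C)) * (rpow x alpha * F x%:C)) <=
  M * (x `^ Re alpha * expR (- ((Re zeta - r) * x))).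
Proof.
move=> x0 FM; rewrite !normcM normc_rpow// normc_cexp ReN cReM /= mulr0 subr0 mulrCA.
rewrite [leRHS]mulrCA; apply: ler_wpM2l; first exact: powR_ge0.
apply: le_trans (ler_wpM2l (expR_ge0 _) FM) _.
rewrite mulrCA -expRD.
by rewrite (_ : - _ + _ = - ((Re zeta - r) * x)) //; ring.
Qed.

Lemma cmeas_lap_integrand alpha F zeta : cmeas H (fun x => F x%:C) ->
  cmeas H (fun x => cexp (- (zeta * x%:C)) * (rpow x alpha * F x%:C)).
Proof.
move=> mF; apply: cmeasM; last by apply: cmeasM => //; exact: cmeas_rpow.
apply: cmeas_cexp; apply: cmeasN; apply: cmeasM; first exact: cmeas_cst.
exact: cmeas_real.
Qed.

Let mH : measurable H. Proof. exact: measurable_itv. Qed.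

Lemma cint_lap alpha F zeta (r : R) : -1 < Re alpha -> r < Re zeta ->
  cmeas H (fun x => F x%:C) -> ray_bound F r ->
  cint H (fun x => cexp (- (zeta * x%:C)) * (rpow x alpha * F x%:C)).
Proof.
move=> a1 rz mF [M M0 FM].
apply: (@cint_le _ _ _ (fun x => M * (x `^ Re alpha * expR (- ((Re zeta - r) * x))))) => //.
- exact: cmeas_lap_integrand.
- have c0 : 0 < Re zeta - r by rewrite subr_gt0.
  exact: (integrableZl mH M (int_powR_exp a1 c0)).
- by move=> x /=; rewrite in_itv/= andbT => x0; apply: normc_lap_integrand => //; exact: FM.
Qed.

Lemma lapD alpha F G zeta (r : R) : -1 < Re alpha -> r < Re zeta ->
  cmeas H (fun x => F x%:C) -> ray_bound F r -> cmeas H (fun x => G x%:C) -> ray_bound G r ->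
  lap alpha (fun t => F t + G t) zeta = lap alpha F zeta + lap alpha G zeta.
Proof.
move=> a1 rz mF bF mG bG; rewrite /lap -CintegralD//; [|exact: (cint_lap a1 rz)|exact: (cint_lap a1 rz)].
by apply: eq_Cintegral => x _; ring.
Qed.

Lemma lapZ alpha F zeta c (r : R) : -1 < Re alpha -> r < Re zeta ->
  cmeas H (fun x => F x%:C) -> ray_bound F r ->
  lap alpha (fun t => c * F t) zeta = c * lap alpha F zeta.
Proof.
move=> a1 rz mF bF; rewrite /lap -CintegralZ//; last exact: (cint_lap a1 rz).
by apply: eq_Cintegral => x _; ring.
Qed.

Lemma ray_boundD F G (r : R) : ray_bound F r -> ray_bound G r -> ray_bound (fun t => F t + G t) r.
Proof.
move=> [M M0 hF] [N N0 hG]; exists (M + N); first exact: addr_ge0.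
by move=> x x0; rewrite mulrDl (le_trans (normcD _ _))// lerD ?hF ?hG.
Qed.

Lemma ray_boundZ c F (r : R) : ray_bound F r -> ray_bound (fun t => c * F t) r.
Proof.
move=> [M M0 hF]; exists (normc c * M); first by rewrite mulr_ge0 ?normc_ge0.
by move=> x x0; rewrite normcM -mulrA ler_wpM2l ?normc_ge0 ?hF.
Qed.

Lemma holo_cmeas F : (forall x, 0 < x -> holo_at F x%:C) -> cmeas H (fun x => F x%:C).
Proof.
move=> hF; apply: cmeas_eq (@lip_cmeas _ H F 0 1 _ _).
- by move=> x _; rewrite add0r mulr1.
- exact: interval_open.
- by move=> x /=; rewrite in_itv/= andbT add0r mulr1 => /hF; exact: holo_lip.
Qed.

(* Integration by parts: the integrand is exp (-zeta x) times the derivative of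
   [x ^ (alpha + 1) F x]. *)
Lemma lap_shift alpha F zeta (r : R) : -1 < Re alpha -> r < Re zeta ->
  (forall x, 0 < x -> holo_at F x%:C) -> (forall x, 0 < x -> holo_at (cder F) x%:C) ->
  ray_bound F r -> ray_bound (fun t => t * cder F t) r ->
  lap alpha (fun t => t * cder F t + (alpha + 1) * F t) zeta = zeta * lap (alpha + 1) F zeta.
Proof.
move=> a1 rz hF hF' bF bF'.
have a2 : -1 < Re (alpha + 1) by rewrite ReD /=; lra.
pose f x := cexp (- (zeta * x%:C)) * (rpow x alpha * (x%:C * cder F x%:C + (alpha + 1) * F x%:C)).
pose g x := cexp (- (zeta * x%:C)) * (rpow x (alpha + 1) * F x%:C).
have mF : cmeas H (fun x => F x%:C) by exact: holo_cmeas.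
have fi : cint H f.
  apply: (@cint_lap alpha (fun t => t * cder F t + (alpha + 1) * F t) zeta r) => //.
    apply: cmeasD; [apply: cmeasM; [exact: cmeas_real|exact: holo_cmeas]|].
    by apply: cmeasM => //; exact: cmeas_cst.
  by apply: ray_boundD => //; exact: ray_boundZ.
have gi : cint H g by exact: (@cint_lap (alpha + 1) F zeta r).
suff : Cintegral H (fun x => f x - zeta * g x) = 0.
  rewrite CintegralB//; last exact: cintZ.
  by rewrite CintegralZ// => /eqP; rewrite subr_eq0 => /eqP.
have cDe x : cD (fun x => cexp (- (zeta * x%:C))) x (- zeta * cexp (- (zeta * x%:C))).
  apply: cD_cexp; have := cDZ (- zeta) (cD_real (is_derive_id x 1)).
  by rewrite mulr1; apply: cD_ext => s; rewrite mulNr.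
have cDF x : 0 < x -> cD (fun x => F x%:C) x (cder F x%:C).
  move=> x0; have h := @cD_holo _ F 0 1 x; rewrite add0r !mulr1 in h.
  by apply: cD_ext (h (hF x x0)) => s; rewrite add0r mulr1.
have cDF' x : 0 < x -> cD (fun x => cder F x%:C) x (cder (cder F) x%:C).
  move=> x0; have h := @cD_holo _ (cder F) 0 1 x; rewrite add0r !mulr1 in h.
  by apply: cD_ext (h (hF' x x0)) => s; rewrite add0r mulr1.
apply: (@halfline_FTC _ g).
- move=> x x0; apply: cD_eq (cDM (cDe x) (cDM (cD_rpow (alpha + 1) x0) (cDF x x0))) _.
  by rewrite /f /g addrK rpowD rpow1//; ring.
- move=> x x0; have h1 := cD_ccont (cDe x); have h2 := cD_ccont (cDF x x0).
  have h3 := cD_ccont (cDF' x x0); have h4 := cD_ccont (cD_rpow alpha x0).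
  have h5 := cD_ccont (cD_rpow (alpha + 1) x0).
  have h6 (w : R[i]) := cD_ccont (cD_cst w x).
  have h7 := cD_ccont (cD_real (is_derive_id x 1)).
  rewrite /f /g; apply: ccontD.
    exact: (ccontM h1 (ccontM h4 (ccontD (ccontM h7 h3) (ccontM (h6 _) h2)))).
  have -> : (fun s => - (zeta * (cexp (- (zeta * s%:C)) * (rpow s (alpha + 1) * F s%:C)))) =
    (fun s => (- zeta) * (cexp (- (zeta * s%:C)) * (rpow s (alpha + 1) * F s%:C))).
    by apply/funext => s; rewrite mulNr.
  exact: (ccontM (h6 _) (ccontM h1 (ccontM h5 h2))).
- by apply: cintB => //; exact: cintZ.
(* Near 0 the boundary term is O(x^(Re alpha + 1)), with a positive exponent. *)
- case: bF => M M0 FM e e0.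
  pose sg := Re (alpha + 1); have sg0 : 0 < sg by rewrite /sg ReD /=; lra.
  have : (M + 1) * s `^ sg @[s --> 0^'+] --> (M + 1) * 0.
    by apply: cvgM; [exact: cvg_cst|exact: powR_cvg0].
  rewrite mulr0 => /cvgrPdist_lt /(_ e e0) [d /= d0 hd]; exists d => //.
  move=> x /andP[x0 xd].
  have := hd x; rewrite /= sub0r normrN gtr0_norm// => /(_ xd x0).
  rewrite sub0r normrN ger0_norm; last by rewrite mulr_ge0 ?powR_ge0//; lra.
  apply: le_lt_trans; apply: le_trans (normc_lap_integrand _ _ x0 (FM x x0)) _.
  apply: ler_pM => //; first by rewrite mulr_ge0 ?powR_ge0 ?expR_ge0.
    by lra.
  rewrite -/sg ler_piMr ?powR_ge0// -expR0 ler_expR oppr_le0 mulr_ge0 ?ltW ?subr_gt0//.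
(* Near infinity one half of the decay rate [c] absorbs the power of x and the other half makes the
   term small. *)
- case: bF => M M0 FM e e0.
  pose sg := Re (alpha + 1); have sg0 : 0 <= sg by rewrite /sg ReD /=; lra.
  pose c := Re zeta - r; have c0 : 0 < c by rewrite subr_gt0.
  have [C C0 hC] := powR_expR_bound sg0 (divr_gt0 c0 (ltr0n _ 2)).
  pose K := M * C + 1; have K0 : 0 < K by rewrite ltr_wpDl// mulr_ge0// ltW.
  exists (Num.max 0 ((1 + K / e) / (c / 2))) => x; rewrite gt_max => /andP[x0].
  rewrite ltr_pdivrMr ?divr_gt0// => hx.
  apply: le_lt_trans (normc_lap_integrand _ _ x0 (FM x x0)) _; rewrite -/sg -/c.
  have h1 := hC x x0.
  have h2 : expR (- (c * x)) = expR (- (c / 2 * x)) * expR (- (c / 2 * x)).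
    by rewrite -expRD; congr expR; field.
  have h3 : x `^ sg * expR (- (c * x)) <= C * expR (- (c / 2 * x)).
    rewrite h2 mulrA ler_wpM2r ?expR_ge0//.
    by rewrite expRN ler_pdivrMr ?expR_gt0.
  have h4 : expR (- (c / 2 * x)) < e / K.
    rewrite expRN -[ltRHS]invf_div ltf_pV2 ?posrE ?expR_gt0 ?divr_gt0//.
    by apply: lt_le_trans (expR_ge1Dx _); move: hx; rewrite mulrC; lra.
  apply: le_lt_trans (ler_wpM2l M0 h3) _; rewrite mulrA.
  apply: le_lt_trans (_ : K * expR (- (c / 2 * x)) < _).
    by rewrite ler_wpM2r ?expR_ge0// /K lerDl.
  by rewrite mulrC -ltr_pdivlMr.
Qed.

End PowersAndLaplace.

(** * The Gamma integral at complex arguments *)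

Section GammaIntegral.
Variable R : realType.
Local Notation mu := (@lebesgue_measure R).
Local Notation RT := (measurableTypeR R).
Local Notation H := (`]0%R, +oo[%classic : set RT).
Implicit Types (z w c alpha zeta : R[i]) (x s : R) (F G : R[i] -> R[i]).

Let mH : measurable H. Proof. exact: measurable_itv. Qed.

Local Notation one := (fun=> 1 : R[i]).

Lemma ray_bound1 (r : R) : 0 <= r -> ray_bound one r.
Proof.
by move=> r0; exists 1 => // x x0; rewrite normc1 mul1r -expR0 ler_expR mulr_ge0// ltW.
Qed.

(** The functional equation of Gamma, obtained from [lap_shift] for the constant 1, whose derivative
    vanishes. *)
Lemma lap1_shift alpha zeta : -1 < Re alpha -> 0 < Re zeta ->
  (alpha + 1) * lap alpha one zeta = zeta * lap (alpha + 1) one zeta.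
Proof.
move=> a1 z0; have mm : cmeas H (fun x => one x%:C) by exact: cmeas_cst.
rewrite -(lapZ (alpha + 1) a1 z0 mm (ray_bound1 (lexx 0))).
have c0 : cder one = fun=> 0 by apply/funext => t; exact: cder_cst.
rewrite -(lap_shift (F := one) a1 z0).
- rewrite c0 (_ : (fun t => t * 0 + (alpha + 1) * 1) = (fun t => (alpha + 1) * 1))//.
  by apply/funext => t; rewrite mulr0 add0r.
- by move=> x _; exact: holo_at_cst.
- by move=> x _; rewrite c0; exact: holo_at_cst.
- exact: ray_bound1.
- rewrite c0; exists 0 => // x _; by rewrite mulr0 normc0 mul0r.
Qed.

(** Differentiation under the integral sign with an explicit error: the second-order remainder of
    exp (-z v) is at most 4 |z v|^2 exp (|z| v), and |z| < Re zeta / 2 spends only half of the decay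
    of exp (-zeta v). *)
Lemma lap1_quadratic alpha zeta : -1 < Re alpha -> 0 < Re zeta ->
  exists K e : R, 0 < e /\ forall z, normc z < e ->
  normc (lap alpha one (zeta + z) - lap alpha one zeta - (- lap (alpha + 1) one zeta) * z) <=
  K * normc z ^+ 2.
Proof.
move=> a1 z0; pose x := Re zeta; pose sg := Re alpha.
have x2 : 0 < x / 2 by rewrite divr_gt0.
have s1 : -1 < sg + 2 by rewrite /sg; lra.
pose g (v : R) := v `^ (sg + 2) * expR (- (x / 2 * v)).
have gi := int_powR_exp s1 x2.
exists (2 * (4 * Rintegral mu H g)), (x / 2); split => // z zx.
have z0' : 0 < Re (zeta + z).
  by rewrite ReD; have := normRe z; rewrite ler_norml => /andP[h _]; move: zx; rewrite -/x; lra.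
have a2 : -1 < Re (alpha + 1) by rewrite ReD /=; lra.
have mm : cmeas H (fun x => one x%:C) by exact: cmeas_cst.
have bb := ray_bound1 (lexx 0).
have i1 := cint_lap a1 z0' mm bb; have i2 := cint_lap a1 z0 mm bb.
have i3 := cint_lap a2 z0 mm bb.
rewrite mulNr opprK mulrC /lap -(CintegralZ z mH i3) -(CintegralB mH i1 i2).
rewrite -(CintegralD mH (cintB mH i1 i2) (cintZ z mH i3)).
have E v : 0 < v -> cexp (- ((zeta + z) * v%:C)) * (rpow v alpha * 1) -
    cexp (- (zeta * v%:C)) * (rpow v alpha * 1) + z * (cexp (- (zeta * v%:C)) * (rpow v (alpha + 1) * 1))
  = cexp (- (zeta * v%:C)) * rpow v alpha * (cexp (- (z * v%:C)) - (cexp_poly R 2).[- (z * v%:C)]).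
  move=> v0; have -> : - ((zeta + z) * v%:C) = - (zeta * v%:C) + - (z * v%:C) by ring.
  rewrite cexpD rpowD rpow1// horner_poly !big_ord_recl big_ord0 /= fact0 /bump/= factS fact0.
  by rewrite muln1 invr1 expr0 expr1; ring.
have mf := cint_cmeas (cintD mH (cintB mH i1 i2) (cintZ z mH i3)).
have gi' := integrableZl mH (4 * normc z ^+ 2) gi.
apply: le_trans (Cintegral_bound (g := fun v => 4 * normc z ^+ 2 * g v) mH mf gi' _) _; last first.
  rewrite RintegralZl// le_eqVlt; apply/orP; left; apply/eqP; ring.
move=> v /=; rewrite in_itv/= andbT => v0; rewrite E//.
rewrite !normcM normc_cexp normc_rpow// ReN cReM /= mulr0 subr0 -/x -/sg.
have h := cexp_taylor 2 (- (z * v%:C)).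
rewrite normcNE normcM normc_real gtr0_norm// in h.
have h2 : expR (normc z * v) <= expR (x / 2 * v) by rewrite ler_expR ler_pM2r// ltW.
have h3 : 2 ^+ 2 * (normc z * v) ^+ 2 * expR (normc z * v) <=
   4 * normc z ^+ 2 * v ^+ 2 * expR (x / 2 * v).
  rewrite exprMn mulrA (_ : (2 : R) ^+ 2 = 4); last by ring.
  by rewrite ler_wpM2l// mulr_ge0 ?sqr_ge0// mulr_ge0 ?sqr_ge0.
have h4 : expR (- (x * v)) = expR (- (x / 2 * v)) * expR (- (x / 2 * v)).
  by rewrite -expRD; congr expR; field.
apply: le_trans (ler_wpM2l _ (le_trans h h3)) _; first by rewrite mulr_ge0 ?expR_ge0 ?powR_ge0.
rewrite /g powRD; last by apply/implyP => _; exact: lt0r_neq0.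
rewrite -(powR_mulrn 2 (ltW v0)) h4 expRN le_eqVlt; apply/orP; left; apply/eqP.
by field; rewrite lt0r_neq0 ?expR_gt0.
Qed.

(** On the right half-plane the argument becomes an arctangent, which is smooth across the real
    axis; the defining formula, acos with a case split on the sign of Im, is not visibly so. *)
Lemma clogE z : 0 < Re z ->
  clog z = (ln (Re z ^+ 2 + Im z ^+ 2) / 2) +i* atan (Im z / Re z).
Proof.
case: z => x y /= x0; have n0 : 0 < x ^+ 2 + y ^+ 2 by rewrite ltr_wpDr ?sqr_ge0 ?exprn_gt0.
have s0 : 0 < Num.sqrt (x ^+ 2 + y ^+ 2) by rewrite sqrtr_gt0.
rewrite /clog /=; congr (_ +i* _).
  rewrite -[in RHS](sqr_sqrtr (ltW n0)) lnXn//; by field.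
have cE : x / Num.sqrt (x ^+ 2 + y ^+ 2) = cos (atan (y / x)).
  rewrite cos_atan (_ : x ^+ 2 + y ^+ 2 = x ^+ 2 * (1 + (y / x) ^+ 2)); last first.
    by field; exact: lt0r_neq0.
  rewrite sqrtrM ?sqr_ge0// sqrtr_sqr gtr0_norm// invfM mulrA divff ?mul1r//.
  exact: lt0r_neq0.
have pi0 := @pi_gt0 R.
rewrite /principal_arg /= cE; case: ifPn => [y0|]; last rewrite -ltNge => y0.
  rewrite cosK// in_itv/= -{1}atan0 le_atan ?divr_ge0 ?(ltW x0)//=.
  by apply: ltW; apply: lt_trans (atan_ltpi2 _) _; lra.
rewrite cosKN ?opprK//; apply/andP; split.
  by apply: ltW; apply: lt_trans (atan_gtNpi2 _); lra.
by rewrite -[leRHS]atan0 le_atan// pmulr_lle0 ?invr_gt0// ltW.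
Qed.

Lemma cD_near (f g : R -> R[i]) x c : (\forall s \near x, f s = g s) -> cD f x c -> cD g x c.
Proof.
move=> fg [f1 f2]; split.
  by apply: near_eq_is_derive f1; apply: filterS fg => s ->.
by apply: near_eq_is_derive f2; apply: filterS fg => s ->.
Qed.

Lemma cD_clog z (s : R) : 0 < Re z -> 0 <= s <= 1 ->
  cD (fun s => clog (1 + s%:C * (z - 1))) s ((z - 1) / (1 + s%:C * (z - 1))).
Proof.
move=> z0 /andP[s0 s1]; pose a := Re z - 1; pose b := Im z.
pose X (s : R) : R := 1 + s * a; pose Y (s : R) : R := s * b.
have pE (u : R) : 1 + u%:C * (z - 1) = X u +i* Y u.
  by apply: complexP; rewrite ?ReD ?ImD ?cReM ?cImM ?ReD ?ImD /= /X /Y /a /b; ring.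
have X0 : 0 < X s by rewrite /X /a; nra.
have dX : is_derive s 1 X a.
  have := is_deriveD (is_derive_cst (1 : R) s 1) (is_deriveZ a (is_derive_id s 1)).
  rewrite add0r /GRing.scale/= mulr1; congr is_derive.
  by apply/funext => u; rewrite /X mulrC.
have dY : is_derive s 1 Y b.
  have := is_deriveZ b (is_derive_id s 1); rewrite /GRing.scale/= mulr1; congr is_derive.
  by apply/funext => u; rewrite /Y mulrC.
have n0 : 0 < X s ^+ 2 + Y s ^+ 2 by rewrite ltr_wpDr ?sqr_ge0 ?exprn_gt0.
pose g u : R[i] := (2^-1 * ln (X u * X u + Y u * Y u)) +i* atan (Y u * (X u)^-1).
have near0 : \forall u \near s, 0 < X u.
  have cX : {for s, continuous X} by apply: differentiable_continuous; apply/derivable1_diffP.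
  exact: (cvgr_gt _ cX).
apply: (@cD_near g).
  apply: filterS near0 => u Xu; rewrite pE clogE//= /g; congr (_ +i* _).
  by rewrite mulrC !expr2.
have dN : is_derive s 1 (X * X + Y * Y) (2 * (X s * a + Y s * b)).
  apply: is_derive_eq (is_deriveD (is_deriveM dX dX) (is_deriveM dY dY)) _.
  by rewrite /GRing.scale/=; ring.
have dXV := is_deriveV (lt0r_neq0 X0) dX.
have dQ : is_derive s 1 (Y * (fun u => (X u)^-1)) (b / X s - Y s * a / X s ^+ 2).
  by apply: is_derive_eq; rewrite /GRing.scale/=; field; exact: lt0r_neq0.
have n0' : 0 < (X * X + Y * Y) s by move: n0; rewrite !expr2.
have dL := is_derive1_ln n0'.
have e1 : is_derive s 1 (2^-1 *: (@ln R \o (X * X + Y * Y))) ((X s * a + Y s * b) / (X s ^+ 2 + Y s ^+ 2)).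
  apply: is_derive_eq; rewrite /GRing.scale/= -[(X * X + Y * Y) s]/(X s * X s + Y s * Y s) !expr2.
  by field; rewrite -!expr2 lt0r_neq0.
have e2 : is_derive s 1 (atan \o (Y * (fun u => (X u)^-1))) ((X s * b - Y s * a) / (X s ^+ 2 + Y s ^+ 2)).
  apply: is_derive_eq; rewrite /GRing.scale/= -[(Y * _) s]/(Y s / X s).
  field; rewrite !lt0r_neq0//; apply/andP; split => //.
have -> : (z - 1) / (1 + s%:C * (z - 1)) = ((X s * a + Y s * b) / (X s ^+ 2 + Y s ^+ 2)) +i*
   ((X s * b - Y s * a) / (X s ^+ 2 + Y s ^+ 2)).
  have pn0 : 1 + s%:C * (z - 1) != 0.
    by rewrite pE; apply/eqP => -[h _]; move: X0; rewrite h ltxx.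
  apply: (mulIf pn0); rewrite divfK// pE.
  have n0n := lt0r_neq0 n0.
  apply: complexP; rewrite ?cReM ?cImM ?ReD ?ImD /= ?oppr0 ?addr0 -/a -/b; field => //.
by split.
Qed.

(* [lap alpha one 1] is Gamma (alpha + 1). *)
Lemma gammaE alpha zeta : -1 < Re alpha -> 0 < Re zeta ->
  cpow zeta (alpha + 1) * lap alpha one zeta = lap alpha one 1.
Proof.
(* [p] runs along the segment from 1 to zeta, inside the right half-plane. The left-hand side is
   constant along it, because [lap1_shift] cancels the two terms of its derivative. *)
move=> a1 z0; pose p (s : R) : R[i] := 1 + s%:C * (zeta - 1).
have p0 s : 0 <= s <= 1 -> 0 < Re (p s).
  move=> /andP[s0 s1]; rewrite /p ReD cReM ReD /= mul0r subr0; nra.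
pose f s := cpow (p s) (alpha + 1) * lap alpha one (p s).
have -> : cpow zeta (alpha + 1) * lap alpha one zeta = f 1.
  by rewrite /f (_ : p 1 = zeta)// /p (_ : (1 : R)%:C = 1)// mul1r addrC subrK.
have -> : lap alpha one 1 = f 0.
  rewrite /f (_ : p 0 = (1 : R)%:C); last by rewrite /p (_ : (0 : R)%:C = 0)// mul0r addr0.
  by rewrite cpow_real// rpow1w mul1r.
apply: cD0_cst => s s01; have pn0 : p s != 0.
  by apply/eqP => h; have := p0 s s01; rewrite h ltxx.
have dl : cD (fun s => lap alpha one (p s)) s (- lap (alpha + 1) one (p s) * (zeta - 1)).
  have [K [e [e0 h]]] := lap1_quadratic a1 (p0 s s01).
  apply: (@cD_quadratic _ _ _ _ (K * normc (zeta - 1) ^+ 2) (e / (normc (zeta - 1) + 1))).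
    by rewrite divr_gt0// ltr_wpDl ?normc_ge0.
  move=> k; rewrite ltr_pdivlMr ?ltr_wpDl ?normc_ge0// => ke.
  have kv : normc (k%:C * (zeta - 1)) <= `|k| * (normc (zeta - 1) + 1).
    by rewrite normcM normc_real ler_wpM2l// lerDl.
  rewrite (_ : p (s + k) = p s + k%:C * (zeta - 1)); last by rewrite /p raddfD/=; ring.
  rewrite (_ : - _ * _ * k%:C = - lap (alpha + 1) one (p s) * (k%:C * (zeta - 1))); last by ring.
  apply: le_trans (h _ (le_lt_trans kv ke)) _.
  by rewrite normcM normc_real exprMn (real_normK (num_real k)) mulrCA mulrC mulrA.
have dc : cD (fun s => cpow (p s) (alpha + 1)) s
    ((alpha + 1) * ((zeta - 1) / p s) * cpow (p s) (alpha + 1)).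
  by apply: cD_cexp; apply: cDZ; exact: cD_clog.
apply: cD_eq (cDM dc dl) _; have := lap1_shift a1 (p0 s s01).
set L := lap alpha _ _; set L' := lap (alpha + 1) _ _ => E.
have -> : L' = (alpha + 1) * L / p s by rewrite E mulrAC divff// mul1r.
by rewrite -/L; field.
Qed.

End GammaIntegral.

(** * Convolutions and their transforms *)

Section Convolution.
Variable R : realType.
Local Notation mu := (@lebesgue_measure R).
Local Notation RT := (measurableTypeR R).
Local Notation H := (`]0%R, +oo[%classic : set RT).
Local Notation I := (`]0%R, 1%R[%classic : set RT).
Implicit Types (z w c p q zeta : R[i]) (x s : R) (F G : R[i] -> R[i]).

Definition cut (D : set R) (f : R -> R[i]) x : R[i] := if x \in D then f x else 0.

Lemma Cintegral_mkcond (D : set R) (f : R -> R[i]) : Cintegral D f = Cintegral setT (cut D f).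
Proof.
apply: complexP => /=; rewrite Rintegral_mkcond; apply: eq_Rintegral => x _;
  by rewrite /cut /patch; case: ifP.
Qed.

Lemma cint_mkcond (D : set RT) (f : R -> R[i]) : measurable D ->
  cint D f <-> cint setT (cut D f).
Proof.
move=> mD; have h (g : R[i] -> R) : g 0 = 0 -> mu.-integrable D (fun x => (g (f x))%:E) <->
    mu.-integrable setT (fun x => (g (cut D f x))%:E).
  move=> g0; rewrite (integrable_mkcond _ mD).
  rewrite (_ : _ \_ D = (fun x => (g (cut D f x))%:E))//.
  by apply/funext => x; rewrite /cut /patch; case: ifP; rewrite ?g0.
by split=> -[f1 f2]; split; [apply/h|apply/h|apply/h|apply/h].
Qed.

Lemma Cintegral_shift (g : R -> R[i]) (u : R) : cint setT g ->
  cint setT (fun t => g (t - u)) /\ Cintegral setT (fun t => g (t - u)) = Cintegral setT g.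
Proof.
move=> gi; have mT : measurable (setT : set RT) by [].
have [i1 i2] := @Cintegral_affine R 1 (- u) ltr01 setT g mT gi.
rewrite preimage_setT in i1 i2; rewrite mul1r in i2; split.
  by apply: eq_cint i1 => // x _; rewrite mul1r.
by rewrite i2; apply: eq_Cintegral => x _; rewrite mul1r.
Qed.

Lemma cint_EFin (f : R -> R) : mu.-integrable setT (fun x => (f x)%:E) -> cint setT (fun x => (f x)%:C).
Proof. by move=> fi; split => //=; exact: integrable0. Qed.

(* Fubini after the unimodular shear (u, t) -> (u, t - u) *)
Lemma Cintegral_conv (f g : R -> R[i]) : cint setT f -> cint setT g ->
  (forall t, cint setT (fun u => f u * g (t - u))) ->
  Cintegral setT (fun t => Cintegral setT (fun u => f u * g (t - u))) =
  Cintegral setT f * Cintegral setT g.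
Proof.
move=> fi gi fgi; have mT : measurable (setT : set RT) by [].
pose h (v : RT * RT) := f v.1 * g (v.2 - v.1).
have mh : cmeas setT h.
  apply: cmeasM.
    have := @cmeas_comp _ _ _ _ _ fst f setT setT mT; apply => //; exact: cint_cmeas.
  have := @cmeas_comp _ _ _ _ _ (fun v : RT * RT => v.2 - v.1 : RT) g setT setT mT; apply => //.
    exact: cint_cmeas.
  by apply: measurable_funB.
have gs u := Cintegral_shift u gi.
have hy u : cint setT (fun t => h (u, t)) by apply: (@cintZ _ _ (f u) (fun t => g (t - u))) => //; case: (gs u).
have hyE u : Cintegral setT (fun t => h (u, t)) = f u * Cintegral setT g.
  by rewrite /h /= CintegralZ//; [case: (gs u) => _ -> | case: (gs u)].
pose N := Rintegral mu setT (fun x => normc (g x)).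
have hN : (\int[mu]_u \int[mu]_t (normc (h (u, t)))%:E < +oo)%E.
  have ni := cint_normc mT gi.
  have E u : (\int[mu]_t (normc (h (u, t)))%:E = (N * normc (f u))%:E)%E.
    have [i1 i2] := Cintegral_shift u (cint_EFin ni).
    have [j1 _] := i1; move/(congr1 (@Re R)): i2; rewrite /= -/N => <-.
    rewrite -(fineK (integrable_fin_num mT (cint_normc mT (hy u)))); congr EFin.
    rewrite mulrC -(RintegralZl (normc (f u)) mT j1).
    by apply: eq_Rintegral => t _; rewrite /h normcM.
  under eq_integral do rewrite E.
  have := integrableZl mT N (cint_normc mT fi) => /integrableP[_].
  have N0 : 0 <= N by apply: Rintegral_ge0 => x _; exact: normc_ge0.
  by under eq_integral do rewrite -EFinM abse_EFin ger0_norm ?mulr_ge0 ?normc_ge0//.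
have inn : (mu \x mu)%E.-integrable setT (fun v => (normc (h v))%:E).
  apply/integrable12ltyP; first exact/measurable_EFinP/measurable_normc.
  have -> // : (\int[mu]_u \int[mu]_t `|(normc (h (u, t)))%:E| = \int[mu]_u \int[mu]_t (normc (h (u, t)))%:E)%E.
  by apply: eq_integral => u _; apply: eq_integral => t _; rewrite abse_EFin ger0_norm ?normc_ge0.
(* Fubini's theorem is used for the real and the imaginary part; [pr] stands for either. *)
have key (pr : R[i] -> R) : (forall w, `|pr w| <= normc w) ->
   measurable_fun setT (fun v : RT * RT => pr (h v)) -> 
   (forall f, cint setT f -> mu.-integrable setT (fun x => (pr (f x))%:E)) ->
   Rintegral mu setT (fun t => Rintegral mu setT (fun u => pr (h (u, t)))) =
   Rintegral mu setT (fun u => Rintegral mu setT (fun t => pr (h (u, t)))).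
  move=> pr1 mpr pri.
  have ih : (mu \x mu)%E.-integrable setT (fun v => (pr (h v))%:E).
    apply: le_integrable inn => //; first exact/measurable_EFinP.
    by move=> v _; rewrite !abse_EFin lee_fin (ger0_norm (normc_ge0 _)).
  have e1 u : (\int[mu]_t (pr (h (u, t)))%:E = (Rintegral mu setT (fun t => pr (h (u, t))))%:E)%E.
    by rewrite fineK//; apply: integrable_fin_num => //; exact: pri.
  have e2 t : (\int[mu]_u (pr (h (u, t)))%:E = (Rintegral mu setT (fun u => pr (h (u, t))))%:E)%E.
    by rewrite fineK//; apply: integrable_fin_num => //; exact: (pri _ (fgi t)).
  transitivity (fine (\int[mu]_t \int[mu]_u (pr (h (u, t)))%:E)%E).
    by congr (fine _); apply: eq_integral => t _; rewrite e2.
  transitivity (fine (\int[mu]_u \int[mu]_t (pr (h (u, t)))%:E)%E).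
    exact: (congr1 fine (esym (Fubini ih))).
  by congr (fine _); apply: eq_integral => u _; rewrite e1.
transitivity (Cintegral setT (fun u => Cintegral setT (fun t => h (u, t)))).
  apply: complexP => /=; apply: key => //.
  - move=> w; exact: normRe.
  - by case: mh.
  - by move=> ? [].
  - move=> w; exact: normIm.
  - by case: mh.
  - by move=> ? [].
under eq_fun do rewrite hyE.
rewrite (mulrC _ (Cintegral setT g)) -CintegralZ//.
by apply: eq_Cintegral => x _; rewrite mulrC.
Qed.

Lemma preimage_scale x : 0 < x -> (fun s : RT => x * s + 0) @^-1` `]0, x[ = I.
Proof.
move=> x0; apply/funext => s; apply/propext; rewrite /= !in_itv/= addr0 pmulr_rgt0//.
by rewrite -[X in x * s < X]mulr1 ltr_pM2l.
Qed.

Lemma cexp_neq0 z : cexp z != 0.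
Proof.
apply/eqP => h; have := normc_cexp z; rewrite h normc0 => e.
by have := expR_gt0 (Re z); rewrite -e ltxx.
Qed.

Definition avg (k : R -> R[i]) F t : R[i] := Cintegral I (fun s => k s * F (s%:C * t)).

Definition beta_kernel p q s : R[i] := rpow s p * rpow (1 - s) (q - 1).

(* t^(p+q) [avg (beta_kernel p q) F t] is the convolution of t^p F and t^(q-1). *)
Lemma lap_avg p q F zeta (r : R) : -1 < Re p -> 1 <= Re q -> 0 <= r ->
  r < Re zeta -> cmeas H (fun x => F x%:C) -> ray_bound F r ->
  lap (p + q) (avg (beta_kernel p q) F) zeta = lap p F zeta * lap (q - 1) (fun=> 1) zeta.
Proof.
move=> p1 q1 r0 rz mF bF; have mT : measurable (setT : set RT) by [].
have mH : measurable H by exact: measurable_itv.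
have q1' : -1 < Re (q - 1) by rewrite ReD ReN /=; lra.
have x0 : 0 < Re zeta by lra.
pose f := cut H (fun u => cexp (- (zeta * u%:C)) * (rpow u p * F u%:C)).
pose g := cut H (fun u => cexp (- (zeta * u%:C)) * (rpow u (q - 1) * 1)).
have fi : cint setT f by apply/(cint_mkcond _ mH); exact: (cint_lap p1 rz mF bF).
have gi : cint setT g.
  apply/(cint_mkcond _ mH).
  exact: (cint_lap (F := fun=> 1) q1' x0 (cmeas_cst _ _) (ray_bound1 (lexx 0))).
have fE u : 0 < u -> f u = cexp (- (zeta * u%:C)) * (rpow u p * F u%:C).
  by move=> u0; rewrite /f /cut mem_set//= in_itv/= u0.
have gE u : 0 < u -> g u = cexp (- (zeta * u%:C)) * rpow u (q - 1).
  by move=> u0; rewrite /g /cut mem_set ?mulr1//= in_itv/= u0.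
have f0 u : u <= 0 -> f u = 0.
  by move=> u0; rewrite /f /cut memNset//= in_itv/= andbT; apply/negP; rewrite -leNgt.
have g0 u : u <= 0 -> g u = 0.
  by move=> u0; rewrite /g /cut memNset//= in_itv/= andbT; apply/negP; rewrite -leNgt.
(* Re q >= 1 makes [g] bounded, so that the slice f u * g (t - u) is integrable in u for every t,
   not merely for almost every t. *)
have [C C0 hC] := @powR_expR_bound R (Re (q - 1)) (Re zeta) ltac:(rewrite ReD ReN /=; lra) x0.
have gC u : normc (g u) <= C.
  have [u0|u0] := lerP u 0; first by rewrite g0// normc0 ltW.
  rewrite gE// normcM normc_cexp normc_rpow// ReN cReM /= mulr0 subr0 expRN.
  by rewrite mulrC ler_pdivrMr ?expR_gt0// hC.
have fgi t : cint setT (fun u => f u * g (t - u)).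
  apply: (cint_le (g := fun u => C * normc (f u))) => //.
  - apply: cmeasM; first exact: cint_cmeas.
    have := @cmeas_comp _ _ _ _ _ (fun u : RT => t - u : RT) g setT setT mT; apply => //.
      exact: cint_cmeas.
    exact: measurable_funB.
  - exact: (integrableZl mT C (cint_normc mT fi)).
  - by move=> u _; rewrite normcM mulrC ler_wpM2r ?normc_ge0.
transitivity (Cintegral setT f * Cintegral setT g); last by rewrite /f /g -!Cintegral_mkcond.
rewrite -Cintegral_conv// /lap Cintegral_mkcond; apply: eq_Cintegral => t _.
rewrite /cut; case: ifPn => [|tH]; last first.
  have t0 : t <= 0 by rewrite leNgt; apply: contra tH => t0; rewrite mem_set//= in_itv/= t0.
  rewrite -(Cintegral0 setT); apply: eq_Cintegral => u _.
  have [u0|u0] := lerP u 0; first by rewrite f0// mul0r.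
  by rewrite g0 ?mulr0//; lra.
rewrite inE/= in_itv/= andbT => t0.
pose D := (`]0, t[%classic : set RT); have mD : measurable D by exact: measurable_itv.
have cutE : (fun u => f u * g (t - u)) = cut D (fun u => f u * g (t - u)).
  apply/funext => u; rewrite /cut; case: ifPn => // uD.
  have [u0|u0] := lerP u 0; first by rewrite f0// mul0r.
  rewrite g0 ?mulr0// subr_le0 leNgt; apply: contra uD => ut.
  by rewrite inE /D /= in_itv/= u0.
have iD : cint D (fun u => f u * g (t - u)) by apply/(cint_mkcond _ mD); rewrite -cutE.
have [i1 i2] := @Cintegral_affine R t 0 t0 D _ mD iD.
rewrite cutE -Cintegral_mkcond i2.
(* With u = t s the two exponentials multiply to exp (-zeta t) and the powers of t to t^(p+q-1). The
   factor t of the substitution completes t^(p+q). *)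
rewrite (preimage_scale t0) in i1 *; pose c := cexp (- (zeta * t%:C)) * rpow t (p + (q - 1)).
have c0 : c != 0 := mulf_neq0 (cexp_neq0 _) (rpow_neq0 _ _).
have E s : I s -> f (t * s + 0) * g (t - (t * s + 0)) = c * (beta_kernel p q s * F (s%:C * t%:C)).
  rewrite /= in_itv/= => /andP[s0 s1]; rewrite addr0 fE ?mulr_gt0//.
  rewrite (_ : t - t * s = t * (1 - s)); last by ring.
  rewrite gE ?mulr_gt0 ?subr_gt0// !rpowM ?subr_gt0// /c /beta_kernel.
  rewrite (_ : - (zeta * t%:C) = - (zeta * (t * s)%:C) + - (zeta * (t * (1 - s))%:C)); last first.
    by rewrite !rmorphM rmorphB /= rmorph1; ring.
  have -> : s%:C * t%:C = (t * s)%:C by rewrite mulrC rmorphM.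
  by rewrite cexpD (rpowD t p); ring.
rewrite (eq_Cintegral E) CintegralZ//; last first.
  apply: eq_cint (cintZ c^-1 _ i1) => //; try exact: measurable_itv.
  by move=> s sI; rewrite E// mulKf.
rewrite /c (_ : p + q = p + (q - 1) + 1); last by ring.
by rewrite (rpowD t _ 1) rpow1// -/(avg _ _ _); ring.
Qed.

End Convolution.

(** * The strip and averages along segments *)

Section Strip.
Variable R : realType.
Local Notation mu := (@lebesgue_measure R).
Local Notation RT := (measurableTypeR R).
Local Notation H := (`]0%R, +oo[%classic : set RT).
Local Notation I := (`]0%R, 1%R[%classic : set RT).
Implicit Types (t z w c : R[i]) (x s a A N : R) (F G : R[i] -> R[i]).

Lemma dist_ray_le t x : 0 < x -> dist_ray t <= normc (t - x%:C).
Proof.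
move=> x0; apply: ge_inf; last by exists x => //=; rewrite in_itv/= x0.
by exists 0 => _ [y _ <-]; exact: normc_ge0.
Qed.

Lemma dist_ray_ge t A : (forall x, 0 < x -> A <= normc (t - x%:C)) -> A <= dist_ray t.
Proof.
move=> h; apply: lb_le_inf; first by exists (normc (t - 1%:C)); exists 1 => //=; rewrite in_itv/= ltr01.
by move=> _ [x /= x0 <-]; apply: h; move: x0; rewrite in_itv/= andbT.
Qed.

Lemma dist_ray_ge0 t : 0 <= dist_ray t.
Proof. by apply: dist_ray_ge => x _; exact: normc_ge0. Qed.

Lemma dist_rayD t z : dist_ray (t + z) <= dist_ray t + normc z.
Proof.
rewrite -lerBlDr; apply: dist_ray_ge => x x0; rewrite lerBlDr.
apply: le_trans (dist_ray_le _ x0) (le_trans _ (normcD _ _)).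
by rewrite addrAC.
Qed.

Lemma dist_ray0 : dist_ray (0 : R[i]) = 0.
Proof.
apply/le_anti; rewrite dist_ray_ge0 andbT; apply/ler_addgt0Pr => e e0; rewrite add0r.
by apply: le_trans (dist_ray_le _ e0) _; rewrite sub0r normcNE normc_real gtr0_norm.
Qed.

Lemma dist_ray_normc t : dist_ray t <= normc t.
Proof. by have := dist_rayD 0 t; rewrite add0r dist_ray0 add0r. Qed.

Lemma dist_ray_scale s t : 0 <= s <= 1 -> dist_ray (s%:C * t) <= dist_ray t.
Proof.
move=> /andP[]; rewrite le_eqVlt => /predU1P[<- _|s0 s1].
  by rewrite (_ : 0%:C = 0)// mul0r dist_ray0 dist_ray_ge0.
apply: dist_ray_ge => x x0; apply: le_trans (dist_ray_le _ (mulr_gt0 s0 x0)) _.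
rewrite (_ : _ - _ = s%:C * (t - x%:C)); last by rewrite rmorphM/=; ring.
by rewrite normcM normc_real (gtr0_norm s0) ler_piMl ?normc_ge0.
Qed.

Lemma dist_ray_Im t : `|Im t| <= dist_ray t.
Proof.
by apply: dist_ray_ge => x x0; apply: le_trans (normIm _); rewrite ImD ImN /= oppr0 addr0.
Qed.

Lemma dist_ray_Re t : - Re t <= dist_ray t.
Proof.
apply: dist_ray_ge => x x0; apply: le_trans (normRe _); rewrite ReD ReN /=.
by rewrite -normrN (le_trans _ (ler_norm _))// opprB lerDr ltW.
Qed.

(** The ray is open at 0, so for Re t = 0 the infimum is only approached; comparison with Re t + e
    treats all cases alike. *)
Lemma dist_ray_right t : 0 <= Re t -> dist_ray t = `|Im t|.
Proof.
move=> t0; apply/le_anti; rewrite dist_ray_Im andbT.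
apply/ler_addgt0Pr => e e0; have x0 : 0 < Re t + e by lra.
apply: le_trans (dist_ray_le _ x0) (le_trans (normc_le _) _).
by rewrite ReD ReN ImD ImN /= oppr0 addr0 opprD addrA subrr sub0r normrN (gtr0_norm e0) addrC.
Qed.

Lemma normc_strip t : normc t <= `|Re t| + dist_ray t.
Proof. by rewrite (le_trans (normc_le _))// lerD2l dist_ray_Im. Qed.

Lemma copen_strip a : copen (strip a : set R[i]).
Proof.
move=> t ta; exists ((a - dist_ray t) / 4); first by rewrite divr_gt0 ?subr_gt0.
move=> z /normc_sq zd; rewrite /strip/= (le_lt_trans (dist_rayD _ _))//.
by move: ta; rewrite /strip/=; lra.
Qed.

Lemma strip_le a A : A <= a -> (strip A : set R[i]) `<=` strip a.
Proof. by move=> Aa t; rewrite /strip/= => /lt_le_trans; apply. Qed.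

Lemma strip_scale a s t : 0 <= s <= 1 -> strip a t -> strip a (s%:C * t).
Proof. by move=> s01; rewrite /strip/=; apply: le_lt_trans; exact: dist_ray_scale. Qed.

(** [dist_ray] and [normc] are 1-Lipschitz, hence the set is closed, and it lies in a compact
    square. *)
Lemma compact_strip A N : compact (cset [set t : R[i] | dist_ray t <= A /\ normc t <= N]).
Proof.
have lipc (f : R[i] -> R) : (forall t z, `|f (t + z) - f t| <= normc z) ->
    closed (cset [set t | f t <= 0]).
  move=> hf; have -> : cset [set t | f t <= 0] =
     (fun q : R * R => Re ((f (q.1 +i* q.2))%:C)) @^-1` [set y | y <= 0] by [].
  apply: closed_comp; last exact: closed_le.
  move=> -[x y] _; have l : lip_at (fun t => (f t)%:C) (x +i* y).
    exists 1, 1; split=> // z _; rewrite (_ : _ - _ = (f (x +i* y + z) - f (x +i* y))%:C); last by rewrite rmorphB.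
    by rewrite normc_real mul1r.
  by case: (lip_continuous l).
apply: (subclosed_compact _ (@compact_rect R (- N) N (- N) N)); last first.
  move=> -[x y] [_] /= h; have := normRe (x +i* y); have := normIm (x +i* y).
  move=> /le_trans/(_ h) + /le_trans/(_ h); rewrite !ler_norml => /andP[? ?] /andP[? ?].
  by split; apply/andP.
have -> : cset [set t : R[i] | dist_ray t <= A /\ normc t <= N] =
   cset [set t | dist_ray t - A <= 0] `&` cset [set t | normc t - N <= 0].
  by apply/seteqP; split=> -[x y] /=; rewrite /cset /= !subr_le0.
have e (u v x : R) : u - v - (x - v) = u - x by ring.
apply: closedI; apply: lipc => t z; rewrite e ler_norml.
  have h1 := dist_rayD t z; have := dist_rayD (t + z) (- z); rewrite addrK normcNE => h2.
  by apply/andP; split; lra.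
have h1 := normcD t z; have := normcD (t + z) (- z); rewrite addrK normcNE => h2.
by apply/andP; split; lra.
Qed.

Lemma strip_bounded a A N F : holo (strip a) F -> A < a ->
  exists2 M : R, 0 <= M & forall t, dist_ray t <= A -> normc t <= N -> normc (F t) <= M.
Proof.
move=> hF Aa; have [|M M0 h] := @ccompact_bounded R _ F (@compact_strip A N).
  by move=> t [tA _]; apply: holo_lip; apply: hF; exact: le_lt_trans Aa.
by exists M => // t tA tN; exact: h.
Qed.

End Strip.

(** * Holomorphy of averages along the segments from 0 to t *)

Section Average.
Variable R : realType.
Local Notation mu := (@lebesgue_measure R).
Local Notation RT := (measurableTypeR R).
Local Notation H := (`]0%R, +oo[%classic : set RT).
Local Notation I := (`]0%R, 1%R[%classic : set RT).
Implicit Types (t z w c : R[i]) (x s a A N : R) (F G : R[i] -> R[i]).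

Let mI : measurable I. Proof. exact: measurable_itv. Qed.

Lemma cmeas_seg a F t : holo (strip a) F -> strip a t -> cmeas I (fun s => F (s%:C * t)).
Proof.
move=> hF ta; apply: cmeas_eq (@lip_cmeas _ I F 0 t _ _).
- by move=> s _; rewrite /= add0r.
- exact: interval_open.
- move=> s /=; rewrite in_itv/= => /andP[s0 s1]; rewrite add0r; apply: holo_lip; apply: hF.
  by apply: strip_scale => //; rewrite !ltW.
Qed.

Lemma cint_avg a k F t : cint I k -> holo (strip a) F -> strip a t ->
  cint I (fun s => k s * F (s%:C * t)).
Proof.
move=> ki hF ta; have [M M0 FM] := strip_bounded (normc t) hF ta.
apply: (cint_le (g := fun s => M * normc (k s))) => //.
- by apply: cmeasM; [exact: cint_cmeas|exact: cmeas_seg hF ta].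
- exact: (integrableZl mI M (cint_normc mI ki)).
- move=> s /=; rewrite in_itv/= => /andP[s0 s1].
  rewrite normcM mulrC ler_wpM2r ?normc_ge0// FM//.
    by apply: dist_ray_scale; rewrite !ltW.
  by rewrite normcM normc_real (gtr0_norm s0) ler_piMl ?normc_ge0// ltW.
Qed.

(* At z = 0 the quotient is a derivative, obtained as the limit of the quotients at
   nonzero points. *)
Lemma cmeas_iter_dquot a F t (d : R) j z : 0 < d -> holo (strip a) F ->
  (forall z, sq d z -> dist_ray t + normc z < a) -> sq d z ->
  cmeas I (fun s => iter j (@dquot R) (fun z => F (s%:C * t + z)) z).
Proof.
move=> d0 hF da; have hg s : I s -> holo (sq d) (fun z => F (s%:C * t + z)).
  rewrite /= in_itv/= => /andP[s0 s1] w wd; apply: (@holo_shift _ (strip a)) => //.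
  rewrite /strip/= (le_lt_trans (dist_rayD _ _))// (le_lt_trans _ (da _ wd))// lerD2r.
  by apply: dist_ray_scale; rewrite !ltW.
have s0 := sq0 (ltW d0).
elim: j z => [|j IH] z zd /=.
  apply: cmeas_eq (@lip_cmeas _ I F z t _ _).
  - by move=> s _; rewrite /= addrC.
  - exact: interval_open.
  - move=> s sI; rewrite addrC; have h := holo_lip (hg s sI z zd).
    by case: h => M [e [M0 e0 h]]; exists M, e; split=> // w /h; rewrite addrA.
have nz w : w != 0 -> sq d w ->
    cmeas I (fun s => dquot (iter j (@dquot R) (fun z => F (s%:C * t + z))) w).
  move=> w0 wd; rewrite /dquot (negbTE w0).
  by apply: cmeasM; [apply: cmeasD; [exact: IH|apply: cmeasN; exact: IH]|exact: cmeas_cst].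
have [->|z0] := eqVneq z 0; last exact: nz.
pose zn (n : nat) : R[i] := (d / n.+1%:R)%:C.
have zn_norm n : normc (zn n) = d / n.+1%:R by rewrite normc_real gtr0_norm// divr_gt0.
apply: (@cmeas_cvg _ _ _ _ (fun n s => dquot (iter j (@dquot R) (fun z => F (s%:C * t + z))) (zn n))).
  move=> n; apply: nz; first by rewrite -normc_gt0 zn_norm divr_gt0.
  by apply: sq_normc; rewrite zn_norm ler_pdivrMr// ler_pMr// ler1n.
move=> s sI e e0.
have := holo_iter_dquot j.+1 s0 (hg s sI) s0 => /holo_lip[M [r [M0 r0 h]]].
have e1 : 0 < Num.min r (e / (M + 1)).
  by rewrite lt_min r0 divr_gt0// ltr_wpDl.
have hK := archi_boundP (ltW (divr_gt0 d0 e1)); set K := Num.bound _ in hK.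
exists K => n Kn; have : normc (zn n) < Num.min r (e / (M + 1)).
  rewrite zn_norm ltr_pdivrMr// mulrC -ltr_pdivrMr// (lt_le_trans hK)// ler_nat.
  exact: leq_trans Kn _.
rewrite lt_min => /andP[h1 h2]; have := h _ h1; rewrite add0r => h3.
apply: le_lt_trans h3 _; move: h2; rewrite ltr_pdivlMr ?ltr_wpDl//.
by rewrite mulrC mulrDl mul1r => h2; apply: le_lt_trans h2; rewrite lerDl normc_ge0.
Qed.

Definition tay_avg (k : R -> R[i]) F t j : R[i] :=
  Cintegral I (fun s => k s * (tay F (s%:C * t) j * s%:C ^+ j)).

(** Taylor expansion under the integral sign. At the base point s t the increment is s z, which
    explains s^j in [tay_avg]; the remainders are uniform in s because all base points share the
    half-width [d] and the bound [M]. *)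
Lemma avg_jet a k F t n : cint I k -> holo (strip a) F -> strip a t ->
  exists M e : R, [/\ 0 <= M, 0 < e & forall z, normc z < e ->
   normc (avg k F (t + z) - (\poly_(j < n) tay_avg k F t j).[z]) <= M * normc z ^+ n].
Proof.
move=> ki hF ta; pose d := (a - dist_ray t) / 4.
have d0 : 0 < d by rewrite divr_gt0// subr_gt0.
have da z : sq d z -> dist_ray t + normc z < a.
  by move=> /normc_sq; rewrite /d; move: ta; rewrite /strip/=; lra.
have [M M0 FM] : exists2 M : R, 0 <= M & forall s z, 0 <= s <= 1 -> sq d z ->
    normc (F (s%:C * t + z)) <= M.
  have Aa : dist_ray t + (d + d) < a by rewrite /d; move: ta; rewrite /strip/=; lra.
  have [M M0 h] := strip_bounded (normc t + (d + d)) hF Aa; exists M => // s z s01 zd.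
  have zn := normc_sq zd; apply: h.
    by rewrite (le_trans (dist_rayD _ _))// lerD// dist_ray_scale.
  rewrite (le_trans (normcD _ _))// lerD// normcM normc_real.
  by case/andP: s01 => s0 s1; rewrite (ger0_norm s0) ler_piMl ?normc_ge0.
have hFs s : I s -> holo [set s%:C * t + z | z in sq d] F.
  rewrite /= in_itv/= => /andP[s0 s1] _ [z zd <-]; apply: hF.
  rewrite /strip/= (le_lt_trans (dist_rayD _ _))// (le_lt_trans _ (da _ zd))// lerD2r.
  by apply: dist_ray_scale; rewrite !ltW.
have sI s : I s -> 0 <= s <= 1.
  by rewrite /= in_itv/= => /andP[s0 s1]; rewrite !ltW.
have ti j : cint I (fun s => k s * (tay F (s%:C * t) j * s%:C ^+ j)).
  apply: (cint_le (g := fun s => M * (2 / d) ^+ j * normc (k s))) => //.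
  - apply: cmeasM; first exact: cint_cmeas.
    apply: cmeasM; first by apply: (cmeas_iter_dquot _ d0 hF da); exact: sq0 (ltW d0).
    apply: (@cmeas_eq _ _ _ _ (fun s : RT => (s ^+ j)%:C)) => [s _|]; first by rewrite rmorphXn.
    by apply: cmeas_real; exact: measurable_funX.
  - exact: (integrableZl mI _ (cint_normc mI ki)).
  - move=> s sI'; rewrite normcM mulrC ler_wpM2r ?normc_ge0// normcM.
    have h : normc (tay F (s%:C * t) j) <= M * (2 / d) ^+ j.
      apply: iter_dquot_bound (sq0 (ltW d0)) => //.
      + by move=> w wd; have h := @holo_shift _ _ _ (s%:C * t) (hFs s sI'); apply: (h w); exists w.
      + by move=> w; apply: FM; exact: sI.
    apply: le_trans _ h; rewrite ler_piMr ?normc_ge0// normcX normc_real.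
    by have /andP[? ?] := sI s sI'; rewrite ger0_norm// exprn_ile1.
pose K := M * (2 / d) ^+ n.
have iK : mu.-integrable I (fun s => (K * normc (k s))%:E) := integrableZl mI _ (cint_normc mI ki).
exists (2 * Rintegral mu I (fun s => K * normc (k s))), d; split=> //.
  apply: mulr_ge0 => //; apply: Rintegral_ge0 => s _.
  by rewrite mulr_ge0 ?normc_ge0// mulr_ge0// exprn_ge0// divr_ge0// ltW.
move=> z zd; have sz s : 0 <= s <= 1 -> normc (s%:C * z) <= normc z.
  by move=> /andP[s0 s1]; rewrite normcM normc_real (ger0_norm s0) ler_piMl ?normc_ge0.
have tza : strip a (t + z).
  by rewrite /strip/= (le_lt_trans (dist_rayD _ _))//; apply: da; apply: sq_normc; exact: ltW.
have Si : cint I (fun s => \sum_(j < n) (z ^+ j * (k s * (tay F (s%:C * t) j * s%:C ^+ j)))).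
  apply: (@cint_sum _ I n (fun j s => z ^+ j * (k s * (tay F (s%:C * t) j * s%:C ^+ j)))) => // j.
  exact: cintZ.
have -> : avg k F (t + z) - (\poly_(j < n) tay_avg k F t j).[z] = Cintegral I (fun s =>
   k s * F (s%:C * (t + z)) - \sum_(j < n) (z ^+ j * (k s * (tay F (s%:C * t) j * s%:C ^+ j)))).
  rewrite CintegralB//; last exact: (cint_avg ki hF).
  congr (_ - _); rewrite (@Cintegral_sum _ I n (fun j s => z ^+ j * (k s * (tay F (s%:C * t) j * s%:C ^+ j))))//; last first.
    by move=> j; exact: cintZ.
  by rewrite horner_poly; apply: eq_bigr => j _; rewrite CintegralZ// mulrC.
have iK' : mu.-integrable I (fun s => (normc z ^+ n * (K * normc (k s)))%:E) := integrableZl mI _ iK.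
apply: le_trans (Cintegral_bound mI _ iK' _) _.
- by apply: cint_cmeas; apply: cintB => //; exact: (cint_avg ki hF).
- move=> s sI'; have s01 := sI s sI'.
  have -> : \sum_(j < n) z ^+ j * (k s * (tay F (s%:C * t) j * s%:C ^+ j)) =
     k s * \sum_(j < n) tay F (s%:C * t) j * (s%:C * z) ^+ j.
    by rewrite mulr_sumr; apply: eq_bigr => j _; rewrite exprMn; ring.
  rewrite -mulrBr normcM mulrDr.
  have zs : sq d (s%:C * z) by apply: sq_normc; rewrite (le_trans (sz s s01))// ltW.
  have := taylor n d0 (hFs s sI') (fun w wd => FM s w s01 wd) zs.
  move=> h; rewrite mulrC (mulrC (normc z ^+ n)) mulrAC ler_wpM2r ?normc_ge0//.
  apply: le_trans h _; rewrite /K -[leRHS]mulrA -exprMn ler_wpM2l// lerXn2r ?nnegrE ?mulr_ge0 ?normc_ge0 ?invr_ge0 ?(ltW d0)//.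
  by rewrite ler_wpM2l ?sz// mulr_ge0// invr_ge0 ltW.
- by rewrite (RintegralZl _ mI iK) mulrCA mulrC.
Qed.

Lemma holo_avg a k F : cint I k -> holo (strip a) F -> holo (strip a) (avg k F).
Proof.
move=> ki hF t ta n; have [M [e [M0 e0 h]]] := avg_jet n ki hF ta.
by exists (\poly_(j < n) tay_avg k F t j), M, e.
Qed.

End Average.

(** * Pointwise growth in H *)

Section Growth.
Variable R : realType.
Local Notation mu := (@lebesgue_measure R).
Local Notation RT := (measurableTypeR R).
Local Notation H := (`]0%R, +oo[%classic : set RT).
Local Notation I := (`]0%R, 1%R[%classic : set RT).
Implicit Types (t z w c : R[i]) (x s a r A B N : R) (F G : R[i] -> R[i]).

Let mI : measurable I. Proof. exact: measurable_itv. Qed.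
Let mH : measurable H. Proof. exact: measurable_itv. Qed.

(** The factor exp (-eta t^2) decays faster than any exponential on the half-strip and is at most
    exp (eta A^2) in modulus on its edges. The maximum principle then applies to a long rectangle,
    and eta tends to 0. *)
Lemma phragmen_lindelof A B (C c : R) P : 0 < B -> 0 <= c -> 0 <= C ->
  (forall t, 0 <= Re t -> `|Im t| <= A -> holo_at P t) ->
  (forall t, 0 <= Re t -> `|Im t| <= A ->
     normc (P t) <= C * expR (c * Re t)) ->
  (forall t, 0 <= Re t -> `|Im t| <= A ->
     Re t = 0 \/ `|Im t| = A -> normc (P t) <= B) ->
  forall t, 0 <= Re t -> `|Im t| <= A -> normc (P t) <= B.
Proof.
move=> B0 c0 C0 hP gP bP t t0 tA; have A0 : 0 <= A by exact: le_trans tA.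
pose x := Re t; pose K := A ^+ 2 + x ^+ 2.
have K0 : 0 <= K by rewrite addr_ge0 ?sqr_ge0.
have key eta : 0 < eta -> normc (P t) <= B * expR (eta * K).
  (* The first summand gives X (c - eta X) <= - X and the second C exp (- X) <= B, so the right edge
     of the rectangle obeys the same bound as the other edges. *)
  move=> e0; pose X := x + ((c + 1) / eta + C / B).
  have X1 : (c + 1) / eta <= X.
    by rewrite /X addrA addrAC lerDr addr_ge0// divr_ge0// ltW.
  have X2 : C / B <= X by rewrite /X addrA lerDr addr_ge0// divr_ge0 ?addr_ge0// ltW.
  have xX : x <= X by rewrite /X lerDl addr_ge0// divr_ge0 ?addr_ge0// ltW.
  have X0 : 0 <= X by exact: le_trans xX.
  pose p : {poly R[i]} := (- eta%:C) *: 'X^2; pose Q z := P z * cexp p.[z].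
  have pE z : normc (cexp p.[z]) = expR (- eta * (Re z ^+ 2 - Im z ^+ 2)).
    rewrite normc_cexp /p hornerZ hornerXn expr2 cReM ReN ImN cReM /=; congr expR; ring.
  have yA z : `|Im z| <= A -> Im z ^+ 2 <= A ^+ 2.
    by move=> zA; rewrite -(real_normK (num_real (Im z))) lerXn2r// ?nnegrE.
  have tE : normc (Q t) <= B * expR (eta * A ^+ 2).
    apply: (@max_rect _ 0 X (- A) A).
    - move=> z [/andP[z0 _] zA]; apply: holo_atM; last exact: holo_cexp_poly.
      by apply: hP => //; rewrite ler_norml.
    - move=> z [/andP[z0 zX] zA] zb; have zA' : `|Im z| <= A by rewrite ler_norml.
      have h : B * expR (eta * Im z ^+ 2) <= B * expR (eta * A ^+ 2).
        by rewrite ler_pM2l// ler_expR ler_pM2l// yA.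
      apply: le_trans h; rewrite /Q normcM pE.
      have [zX'|zX'] := eqVneq (Re z) X.
        apply: le_trans (ler_wpM2r (expR_ge0 _) (gP z z0 zA')) _.
        rewrite -mulrA -expRD zX'.
        rewrite (_ : c * X + - eta * (X ^+ 2 - Im z ^+ 2) = X * (c - eta * X) + eta * Im z ^+ 2); last by ring.
        rewrite expRD mulrA ler_wpM2r ?expR_ge0//.
        have hX : X * (c - eta * X) <= - X.
          move: X1; rewrite ler_pdivrMr// => X1; nra.
        have : C * expR (X * (c - eta * X)) <= C * expR (- X) by rewrite ler_wpM2l// ler_expR.
        move=> /le_trans; apply; rewrite expRN ler_pdivrMr ?expR_gt0//.
        rewrite mulrC -ler_pdivrMr// (le_trans X2)// (le_trans _ (expR_ge1Dx X))// lerDr.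
        by [].
      have zB : normc (P z) <= B.
        apply: bP => //; case: zb => [->|h'|h'|h']; [by left| |right|right].
        - by rewrite h' eqxx in zX'.
        - by rewrite h' normrN ger0_norm.
        - by rewrite h' ger0_norm.
      apply: ler_pM => //; first exact: normc_ge0.
      by rewrite ler_expR mulNr -mulrN opprB ler_pM2l// gerBl sqr_ge0.
    - by split; [rewrite t0 xX|rewrite -ler_norml].
  move: tE; rewrite /Q normcM pE => tE.
  have -> : normc (P t) = normc (P t) * expR (- eta * (x ^+ 2 - Im t ^+ 2)) *
      expR (eta * (x ^+ 2 - Im t ^+ 2)).
    by rewrite -mulrA -expRD mulNr addNr expR0 mulr1.
  apply: le_trans (ler_wpM2r (expR_ge0 _) tE) _.
  rewrite -mulrA -expRD ler_pM2l// ler_expR -mulrDr ler_pM2l// /K lerD2l gerBl.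
  exact: sqr_ge0.
rewrite leNgt; apply/negP => PB; have P0 : 0 < normc (P t) by exact: lt_trans PB.
pose L := ln (normc (P t) / B).
have L0 : 0 < L by rewrite ln_gt0// ltr_pdivlMr// mul1r.
(* With eta = L / (K + 1) the exponent eta K is below L = ln (|P t| / B), contradicting [key]. *)
have := key (L / (K + 1)) ltac:(rewrite divr_gt0// ltr_wpDl//); apply/negP; rewrite -ltNge.
have -> : normc (P t) = B * expR L.
  by rewrite lnK ?posrE ?divr_gt0// mulrC divfK// lt0r_neq0.
rewrite ltr_pM2l// ltr_expR mulrAC ltr_pdivrMr ?ltr_wpDl// ltr_pM2l// ltrDl//.
Qed.

(** Every r > rho is allowed, so a polynomial factor can be absorbed by a slightly larger rate. *)
Definition growth a rho F := forall A r, A < a -> rho < r -> exists2 M : R, 0 <= M &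
  forall t, dist_ray t <= A -> normc (F t) <= M * expR (r * normc t).

Lemma cint_bounded (f : R -> R[i]) (M : R) : cmeas I f -> (forall s, I s -> normc (f s) <= M) -> cint I f.
Proof.
move=> mf fM; apply: (cint_le (g := fun s => M * s `^ 0)) => //.
  exact: (integrableZl mI M (int_powR_unit (ltrN10 R))).
by move=> s /fM; rewrite powRr0 mulr1.
Qed.

Lemma cint_unit_cst c : cint I (fun=> c).
Proof. by apply: (cint_bounded (M := normc c)) => //; exact: cmeas_cst. Qed.

Lemma cint_unit_id : cint I (fun s => s%:C).
Proof.
apply: (cint_bounded (M := 1)); first exact: cmeas_real.
move=> s sI; have /andP[s0 s1] : 0 < s < 1 by move: sI; rewrite /= in_itv.
by rewrite normc_real gtr0_norm// ltW.
Qed.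

(** t times the plain average is the integral of [F] over the segment from 0 to t. Its derivative is
    int_0^1 (F(s t) + s t F'(s t)) ds, whose integrand is the s-derivative of s F(s t). *)
Lemma prim_cder a F t : holo (strip a) F -> strip a t ->
  cder (fun t => t * avg (fun=> 1) F t) t = F t.
Proof.
move=> hF ta; have hc := holo_cder (@copen_strip _ a) hF.
have i1 := cint_unit_cst (1 : R[i]).
have hA := holo_avg i1 hF.
rewrite (cderM (holo_at_id t) (hA t ta)) cder_id mul1r /id.
have -> : cder (avg (fun=> 1) F) t = Cintegral I (fun s => s%:C * cder F (s%:C * t)).
  have [M [e [M0 e0 h]]] := avg_jet 2 i1 hF ta.
  rewrite /cder (derE (isT : (1 < 2)%N) M0 e0 h) coef_poly /=.
  by apply: eq_Cintegral => s _; rewrite tay1 expr1 mul1r mulrC.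
pose W s := s%:C * F (s%:C * t).
have i2 := cint_avg cint_unit_id hc ta.
have dW s : 0 <= s <= 1 -> cD W s (1 * F (s%:C * t) + s%:C * (cder F (s%:C * t) * t)).
  move=> s01; have h := @cD_holo _ F 0 t s.
  rewrite add0r in h; have {}h := h (hF _ (strip_scale s01 ta)).
  have h' : cD (fun s => F (s%:C * t)) s (cder F (s%:C * t) * t).
    by apply: cD_ext h => u; rewrite add0r.
  by apply: cDM h'; apply: cD_real.
have i3 : cint I (fun s => 1 * F (s%:C * t) + t * (s%:C * cder F (s%:C * t))).
  by apply: cintD => //; [exact: (cint_avg i1 hF ta)|exact: cintZ].
have := @unit_FTC _ W (fun s => 1 * F (s%:C * t) + t * (s%:C * cder F (s%:C * t))) _ _ i3.
have WE : W 1 - W 0 = F t.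
  by rewrite /W (_ : (1 : R)%:C = 1)// (_ : (0 : R)%:C = 0)// !mul1r mul0r subr0.
rewrite WE => <-.
- by rewrite (CintegralD mI (cint_avg i1 hF ta) (cintZ t mI i2)) (CintegralZ t mI i2).
- by move=> s /dW h; apply: cD_eq h _; ring.
- move=> s /andP[s0 s1]; have s01 : 0 <= s <= 1 by rewrite !ltW.
  have cF G : holo (strip a) G -> ccont (fun s => G (s%:C * t)) s.
    move=> hG; have h := @cD_holo _ G 0 t s.
    rewrite add0r in h; have {}h := h (hG _ (strip_scale s01 ta)).
    have /cD_ccont // : cD (fun s => G (s%:C * t)) s (cder G (s%:C * t) * t).
      by apply: cD_ext h => u; rewrite add0r.
  have cc w : ccont (fun=> w) s by exact: cD_ccont (cD_cst w s).
  apply: ccontD; first exact: ccontM (cc 1) (cF _ hF).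
  apply: ccontM (cc t) (ccontM _ (cF _ hc)).
  exact: cD_ccont (cD_real (is_derive_id s (1 : R))).
Qed.

Lemma avg_bound a k F t (M : R) : cint I k -> holo (strip a) F -> strip a t -> 0 <= M ->
  (forall s, 0 < s < 1 -> normc (F (s%:C * t)) <= M) ->
  normc (avg k F t) <= 2 * Rintegral mu I (fun s => M * normc (k s)).
Proof.
move=> ki hF ta M0 FM; apply: Cintegral_bound => //.
- by apply: cint_cmeas; exact: (cint_avg ki hF ta).
- exact: (integrableZl mI M (cint_normc mI ki)).
- move=> s; rewrite /= in_itv/= => s01; rewrite normcM mulrC ler_wpM2r ?normc_ge0//.
  exact: FM.
Qed.

Lemma line_eq b x : x +i* b = 0 +i* b + x%:C :> R[i].
Proof. by apply: complexP; rewrite ?ReD ?ImD /= ?add0r ?addr0. Qed.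

Lemma cmeas_line a F b : holo (strip a) F -> `|b| < a -> cmeas H (fun x => F (x +i* b)).
Proof.
move=> hF ba.
apply: cmeas_eq (@lip_cmeas _ H F (0 +i* b) 1 _ _).
- by move=> y _; rewrite /= mulr1 -line_eq.
- exact: interval_open.
- move=> y; rewrite /= in_itv/= andbT => y0; rewrite mulr1 -line_eq.
  by apply: holo_lip; apply: hF; rewrite /strip/= dist_ray_right// ltW.
Qed.

(** Along the half-line the primitive differs from its value at i b by an integral of [h], which the
    L1 norm controls uniformly in x. *)
Lemma prim_line_bound a h b : holo (strip a) h -> `|b| < a ->
  mu.-integrable H (fun x => (normc (h (x +i* b)))%:E) ->
  exists2 B : R, 0 <= B & forall x, 0 <= x ->
    normc ((x +i* b) * avg (fun=> 1) h (x +i* b)) <= B.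
Proof.
move=> hh ba ih; pose P t := t * avg (fun=> 1) h t.
have i1 := cint_unit_cst (1 : R[i]).
have hP : holo (strip a) P.
  by move=> t ta; apply: holo_atM; [exact: holo_at_id|exact: (holo_avg i1 hh)].
have st x : 0 <= x -> strip a (x +i* b) by move=> x0; rewrite /strip/= dist_ray_right.
have g0 (x : R) : 0 <= normc (h (x +i* b)) by exact: normc_ge0.
exists (normc (P (0 +i* b)) + 2 * Rintegral mu H (fun x => normc (h (x +i* b)))).
  by rewrite addr_ge0 ?normc_ge0// mulr_ge0// Rintegral_ge0.
move=> x; rewrite le_eqVlt => /predU1P[<-|x0].
  by rewrite lerDl mulr_ge0// Rintegral_ge0.
pose D := (`]0, x[%classic : set RT); have mD : measurable D by exact: measurable_itv.
have DH : D `<=` H by move=> y; rewrite /D /= !in_itv/= andbT => /andP[].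
have mh : cmeas H (fun x => h (x +i* b)) := cmeas_line hh ba.
have iH : cint H (fun x => h (x +i* b)) by exact: (cint_le mH mh ih).
have iD : cint D (fun x => h (x +i* b)).
  by case: iH => iH1 iH2; split; [exact: integrableS iH1|exact: integrableS iH2].
have [j1 j2] := @Cintegral_affine R x 0 x0 D _ mD iD.
rewrite (preimage_scale x0) in j1 j2.
have FTC : P (x +i* b) - P (0 +i* b) = Cintegral D (fun x => h (x +i* b)).
  pose W s := P (0 +i* b + s%:C * x%:C); pose w s := h ((x * s + 0) +i* b) * x%:C.
  have wE s : w s = h (0 +i* b + s%:C * x%:C) * x%:C.
    by rewrite /w addr0 line_eq mulrC rmorphM mulrC (mulrC s%:C).
  have ss s : 0 <= s -> strip a (0 +i* b + s%:C * x%:C).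
    move=> s0; rewrite (_ : s%:C * x%:C = (s * x)%:C); last by rewrite rmorphM.
    by rewrite -line_eq; apply: st; rewrite mulr_ge0// ltW.
  have dW s : 0 <= s <= 1 -> cD W s (w s).
    move=> /andP[s0 s1]; apply: cD_eq (cD_holo (hP _ (ss s s0))) _.
    by rewrite wE (prim_cder hh (ss s s0)).
  have cw s : 0 < s < 1 -> ccont w s.
    move=> /andP[s0 s1]; have h1 := cD_holo (hh _ (ss s (ltW s0))).
    rewrite (_ : w = fun s => h (0 +i* b + s%:C * x%:C) * x%:C); last exact/funext.
    exact: cD_ccont (cDM h1 (cD_cst x%:C s)).
  have iw : cint I w by apply: eq_cint (cintZ x%:C mI j1) => // s _; rewrite mulrC.
  have := unit_FTC dW cw iw.
  rewrite /W (_ : (1 : R)%:C = 1)// (_ : (0 : R)%:C = 0)// mul1r mul0r addr0 -line_eq => <-.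
  by rewrite j2 -CintegralZ//; apply: eq_Cintegral => s _; rewrite mulrC.
rewrite -[X in normc X <= _]/(P (x +i* b)).
have -> : P (x +i* b) = P (0 +i* b) + Cintegral D (fun x => h (x +i* b)).
  by rewrite -FTC addrC subrK.
apply: le_trans (normcD _ _) _; rewrite lerD2l.
have ihD := integrableS mH mD DH ih.
apply: le_trans (Cintegral_bound mD (cint_cmeas iD) ihD (fun y _ => lexx _)) _.
rewrite ler_pM2l// /Rintegral fine_le//; [exact: integrable_fin_num|exact: integrable_fin_num|].
apply: ge0_subset_integral => //; last by move=> y _; rewrite lee_fin.
by case/integrableP: ih.
Qed.

End Growth.

(** * From boundary integrals to pointwise bounds *)

Section GrowthOfH.
Variable R : realType.
Local Notation mu := (@lebesgue_measure R).
Local Notation RT := (measurableTypeR R).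
Local Notation H := (`]0%R, +oo[%classic : set RT).
Local Notation I := (`]0%R, 1%R[%classic : set RT).
Implicit Types (t z w c : R[i]) (x s a r A B N : R) (F G : R[i] -> R[i]).

Let mI : measurable I. Proof. exact: measurable_itv. Qed.
Let mH : measurable H. Proof. exact: measurable_itv. Qed.

Lemma boundary_norm_lines r A F : 0 < A -> (boundary_norm r A F < +oo)%E ->
  (\int[mu]_(x in H) weighted r F (x +i* A) < +oo)%E /\
  (\int[mu]_(x in H) weighted r F (x -i* A) < +oo)%E.
Proof.
move=> A0; rewrite /boundary_norm.
have w0 (D : set RT) (g : RT -> R[i]) : (0 <= \int[mu]_(x in D) weighted r F (g x))%E.
  by apply: integral_ge0 => x _; rewrite lee_fin mulr_ge0 ?expR_ge0 ?normc_ge0.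
set i3 := (\int[mu]_(x in `[_, _]) _)%E => h.
have i30 : (0 <= A%:E * i3)%E by rewrite mule_ge0 ?w0// lee_fin ltW.
split; apply: le_lt_trans h.
  by rewrite -addeA leeDl// adde_ge0// w0.
by rewrite addeAC leeDr// adde_ge0// w0.
Qed.

Definition damp r F t := F t * cexp (- r%:C * t).

Lemma normc_damp r F t : normc (damp r F t) = normc (F t) * expR (- r * Re t).
Proof. by rewrite normcM normc_cexp cReM ReN ImN /= oppr0 mul0r subr0. Qed.

Lemma holo_damp a r F : holo (strip a) F -> holo (strip a) (damp r F).
Proof.
move=> hF t ta; apply: holo_atM; first exact: hF.
have h := holo_cexp_poly ((- r%:C) *: 'X : {poly R[i]}) t.
by move=> n; apply: jet_ext ltr01 _ (h n) => z _; rewrite hornerZ hornerX.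
Qed.

(** On the line |t| <= Re t + |b|, so replacing the weight exp (-r |t|) by exp (-r Re t) costs at
    most the factor exp (r A). *)
Lemma damp_line_integrable a r A b F : holo (strip a) F -> 0 <= r -> `|b| <= A -> A < a ->
  (\int[mu]_(x in H) weighted r F (x +i* b) < +oo)%E ->
  mu.-integrable H (fun x => (normc (damp r F (x +i* b)))%:E).
Proof.
move=> hF r0 bA Aa hw; have ba : `|b| < a by exact: le_lt_trans Aa.
have m1 := measurable_normc (cmeas_line hF ba).
have m2 := measurable_normc (cmeas_line (holo_damp r hF) ba).
have m3 : measurable_fun H (fun x : RT => normc (x +i* b)).
  by apply: measurable_normc; apply: (cmeas_line (F := id) _ ba) => t _; exact: holo_at_id.
have iw : mu.-integrable H (fun x => weighted r F (x +i* b)).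
  apply/integrableP; split.
    apply/measurable_EFinP; apply: measurable_funM => //.
    apply: measurableT_comp; first exact: measurable_expR.
    exact: measurable_funM.
  rewrite (eq_integral (fun x : RT => weighted r F (x +i* b)))// => x _.
  by rewrite gee0_abs// lee_fin mulr_ge0 ?expR_ge0 ?normc_ge0.
have := integrableZl mH (expR (r * A)) iw; apply: le_integrable => //.
  exact/measurable_EFinP.
move=> x xH; have x0 : 0 < x by move: xH; rewrite /= in_itv/= andbT.
rewrite /weighted -EFinM !abse_EFin lee_fin (ger0_norm (normc_ge0 _)) normc_damp ger0_norm; last first.
  by rewrite mulr_ge0 ?expR_ge0// mulr_ge0 ?expR_ge0 ?normc_ge0.
rewrite [leRHS]mulrA -expRD mulrC ler_wpM2r ?normc_ge0// ler_expR !mulNr -mulrBr -mulrN.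
apply: ler_wpM2l => //.
have h := normc_le (x +i* b); rewrite [Re _]/= [Im _]/= (gtr0_norm x0) in h.
by rewrite lerBrDr -lerBrDl opprK addrC (le_trans h)// lerD2l.
Qed.

Lemma exp_growth_bound a A F : holo (strip a) F -> 0 < A < a -> exp_growth_on (strip A) F ->
  exists M c : R, [/\ 0 <= M, 0 <= c &
    forall t, strip A t -> normc (F t) <= M * expR (c * normc t)].
Proof.
move=> hF /andP[A0 Aa] [M [c [N h]]]; have [M0 M00 h0] := strip_bounded N hF Aa.
exists (M0 + `|M|), `|c|; split; rewrite ?addr_ge0// => t tA.
have e1 : 1 <= expR (`|c| * normc t) by rewrite -expR0 ler_expR mulr_ge0 ?normc_ge0.
have [Nt|tN] := lerP N (normc t).
  apply: le_trans (h t tA Nt) _; apply: le_trans (_ : `|M| * expR (`|c| * normc t) <= _).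
    apply: le_trans (ler_wpM2r (expR_ge0 _) (ler_norm M)) _.
    by rewrite ler_wpM2l// ler_expR ler_wpM2r ?normc_ge0// ler_norm.
  by rewrite ler_wpM2r ?expR_ge0// lerDr.
apply: le_trans (h0 t (ltW tA) (ltW tN)) _.
by rewrite -[leLHS]mulr1 ler_pM// lerDl.
Qed.

(* The integral bounds on the boundary make a primitive P of F(t) exp(-r t) bounded
   on two half-lines, hence on the half-strip between them by Phragmen-Lindelof;
   Cauchy's estimate then bounds F(t) exp(-r t) = P'. *)
Lemma in_H_growth a rho F : 0 < a -> 0 <= rho -> in_H a rho F -> growth a rho F.
Proof.
move=> a0 rho0 [aF eF bF] A0 r A0a rr; have hF := analytic_holo aF.
have r0 : 0 < r by exact: le_lt_trans rr.
(* A1 < A < A2 < a: the bound is wanted up to distance [A1], the boundary integrals are used on the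
   lines Im t = A and Im t = -A, and the a priori exponential growth is taken on the strip of width
   [A2]. [A0] may be negative, hence the maximum with 0. *)
pose A1 := Num.max A0 0; have A1a : A1 < a by rewrite gt_max A0a.
have A10 : 0 <= A1 by rewrite le_max lexx orbT.
pose A := (A1 + a) / 2; have AA1 : A1 < A by rewrite /A; lra.
have Aa : A < a by rewrite /A; lra.
have A0' : 0 < A by exact: le_lt_trans AA1.
pose d := A - A1; have d0 : 0 < d by rewrite subr_gt0.
pose h := damp r F; have hh : holo (strip a) h := holo_damp r hF.
have i1 := cint_unit_cst (1 : R[i]).
pose P t := t * avg (fun=> 1) h t.
have hP : holo (strip a) P.
  by move=> t ta; apply: holo_atM; [exact: holo_at_id|exact: (holo_avg i1 hh)].
have rst t : 0 <= Re t -> `|Im t| <= A -> strip a t.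
  by move=> t0 tA; rewrite /strip/= dist_ray_right// (le_lt_trans tA).
have [w1 w2] := boundary_norm_lines A0' (bF r A rr ltac:(rewrite A0' Aa//)).
have bA : `|A| <= A by rewrite gtr0_norm.
have bA' : `|- A| <= A by rewrite normrN.
have [B1 B10 hB1] := prim_line_bound hh (le_lt_trans bA Aa) (damp_line_integrable hF (ltW r0) bA Aa w1).
have [B2 B20 hB2] := prim_line_bound hh (le_lt_trans bA' Aa) (damp_line_integrable hF (ltW r0) bA' Aa w2).
have [B3 B30 hB3] := strip_bounded A hP Aa.
pose B := B1 + B2 + B3 + 1; have B0 : 0 < B by rewrite /B; lra.
pose A2 := (A + a) / 2; have A2a : 0 < A2 < a by rewrite /A2; apply/andP; split; lra.
have AA2 : A < A2 by rewrite /A2; lra.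
have [M [c [M0 c0 FM]]] := exp_growth_bound hF A2a (eF A2 A2a).
have hM t : 0 <= Re t -> `|Im t| <= A -> normc (h t) <= M * expR (c * normc t).
  move=> t0 tA; rewrite normc_damp -[leRHS]mulr1; apply: ler_pM; rewrite ?normc_ge0 ?expR_ge0//.
    by apply: FM; rewrite /strip/= dist_ray_right// (le_lt_trans tA).
  by rewrite -expR0 ler_expR mulNr oppr_le0 mulr_ge0// ltW.
pose K := Rintegral mu I (fun=> normc (1 : R[i])).
have K0 : 0 <= K by apply: Rintegral_ge0 => x _; exact: normc_ge0.
(* The a priori growth that [phragmen_lindelof] asks for; the factor |t| of the primitive is
   absorbed by raising the rate from c to c + 1. *)
have PC t : 0 <= Re t -> `|Im t| <= A ->
    normc (P t) <= 2 * (M * K) * expR ((c + 1) * A) * expR ((c + 1) * Re t).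
  move=> t0 tA; have ta := rst t t0 tA; have e0 : 0 <= M * expR (c * normc t) by rewrite mulr_ge0 ?expR_ge0.
  have := avg_bound i1 hh ta e0; rewrite (RintegralZl _ mI); last by case: i1 => + _; rewrite normc1.
  rewrite -/K => hav; rewrite normcM.
  have h1 : normc t <= expR (normc t) by rewrite (le_trans _ (expR_ge1Dx _))// lerDr.
  have h2 : normc t <= Re t + A by rewrite (le_trans (normc_le _))// ger0_norm// lerD2l.
  apply: le_trans (_ : expR (normc t) * (2 * (M * expR (c * normc t) * K)) <= _).
    apply: ler_pM; rewrite ?normc_ge0//; apply: hav => s /andP[s0 s1].
    apply: le_trans (hM _ _ _) _.
    - by rewrite cReM /= mul0r subr0 mulr_ge0// ltW.
    - rewrite cImM /= mul0r addr0 normrM gtr0_norm// (le_trans _ tA)// ler_piMl// ltW//.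
    - rewrite ler_wpM2l// ler_expR ler_wpM2l// normcM normc_real gtr0_norm// ler_piMl ?normc_ge0// ltW//.
  rewrite (_ : _ * _ = 2 * (M * K) * (expR (c * normc t) * expR (normc t))); last by ring.
  rewrite -[leRHS]mulrA -!expRD ler_wpM2l ?mulr_ge0// ler_expR.
  have : (c + 1) * normc t <= (c + 1) * (Re t + A) by rewrite ler_wpM2l ?addr_ge0.
  lra.
have PB t : 0 <= Re t -> `|Im t| <= A -> normc (P t) <= B.
  apply: (phragmen_lindelof B0 _ _ _ PC).
  - by rewrite addr_ge0.
  - by rewrite mulr_ge0 ?expR_ge0// mulr_ge0// mulr_ge0.
  - by move=> z z0 zA; apply: hP; exact: rst.
  - move=> z z0 zA [zr|zi].
      apply: le_trans (hB3 z _ _) _; rewrite ?dist_ray_right//; last by rewrite /B; lra.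
      by rewrite (le_trans (normc_le _))// zr normr0 add0r.
    have zE : z = Re z +i* Im z by case: (z).
    have : Im z = A \/ Im z = - A.
      by move: zi; case: (ger0P (Im z)) => h0 <-; [left|right; rewrite opprK].
    case=> h0; rewrite zE h0.
      by apply: le_trans (hB1 _ z0) _; rewrite /B; lra.
    by apply: le_trans (hB2 _ z0) _; rewrite /B; lra.
have [M1 M10 hM1] := strip_bounded (d + A1 + A1) hF A1a.
exists (M1 + B * (2 / d)); first by rewrite addr_ge0// mulr_ge0 ?(ltW B0)// divr_ge0// ltW.
move=> t tA0; have tA : dist_ray t <= A1 by rewrite le_max tA0.
have e1 : 1 <= expR (r * normc t) by rewrite -expR0 ler_expR mulr_ge0 ?normc_ge0// ltW.
(* For Re t < d the points stay in a bounded set. Otherwise the square of half-width [d] about t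
   lies in the half-strip where P is bounded. *)
have [td|td] := ltrP (Re t) d.
  apply: le_trans (_ : M1 * expR (r * normc t) <= _); last first.
    by rewrite ler_wpM2r ?expR_ge0// lerDl mulr_ge0 ?(ltW B0)// divr_ge0// ltW.
  rewrite -[leLHS]mulr1; apply: ler_pM; rewrite ?normc_ge0//; apply: hM1 => //.
  have [t0|t0] := lerP 0 (Re t).
    by rewrite (le_trans (normc_strip _))// ger0_norm//; lra.
  by have := dist_ray_Re t; have := normc_strip t; rewrite ltr0_norm//; lra.
have t0 : 0 <= Re t by apply: le_trans td; exact: ltW.
have ti : `|Im t| <= A1 by exact: le_trans (dist_ray_Im _) _.
have sub z : sq d z -> 0 <= Re (t + z) /\ `|Im (t + z)| <= A.
  move=> /sqP[]; rewrite ler_norml ReD ImD => /andP[z1 _] z2; split.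
    by rewrite -lerBlDr sub0r (le_trans _ td)// lerNl.
  by rewrite (le_trans (ler_normD _ _))// (le_trans (lerD ti z2))// /d addrC subrK.
have : normc (cder P t) <= B * (2 / d).
  apply: cauchy_bound => //.
    by move=> _ [z zd <-]; apply: hP; have [? ?] := sub z zd; exact: rst.
  by move=> z zd; have [? ?] := sub z zd; exact: PB.
have ta : strip a t by exact: le_lt_trans A1a.
rewrite (prim_cder hh ta) normc_damp => hb.
have -> : normc (F t) = normc (F t) * expR (- r * Re t) * expR (r * Re t).
  by rewrite -mulrA -expRD mulNr addNr expR0 mulr1.
apply: ler_pM; rewrite ?mulr_ge0 ?normc_ge0 ?expR_ge0//.
  by rewrite (le_trans hb)// lerDr.
by rewrite ler_expR ler_pM2l// (le_trans (ler_norm _))// normRe.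
Qed.

End GrowthOfH.

(** * The pointwise description of H and its stability *)

Section HolomorphicGrowth.
Variable R : realType.
Local Notation mu := (@lebesgue_measure R).
Local Notation RT := (measurableTypeR R).
Local Notation H := (`]0%R, +oo[%classic : set RT).
Local Notation I := (`]0%R, 1%R[%classic : set RT).
Implicit Types (t z w c : R[i]) (x s a r A B N : R) (F G : R[i] -> R[i]).

Let mI : measurable I. Proof. exact: measurable_itv. Qed.
Let mH : measurable H. Proof. exact: measurable_itv. Qed.

Definition hgrowth a rho F := holo (strip a) F /\ growth a rho F.

Lemma line_weight_finite a rho r F b : hgrowth a rho F -> rho < r -> `|b| < a ->
  (\int[mu]_(x in H) weighted r F (x +i* b) < +oo)%E.
Proof.
(* The rate r' lies strictly between rho and r: it bounds [F] and leaves the integrable factor exp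
   (-(r - r') x). *)
move=> [hF gF] rr ba; pose r' := (rho + r) / 2.
have [M M0 FM] := gF `|b| r' ba ltac:(rewrite /r'; lra).
have dr : 0 < r - r' by rewrite /r'; lra.
have m1 := measurable_normc (cmeas_line hF ba).
have m3 : measurable_fun H (fun x : RT => normc (x +i* b)).
  by apply: measurable_normc; apply: (cmeas_line (F := id) _ ba) => t _; exact: holo_at_id.
have mw : measurable_fun H (fun x => weighted r F (x +i* b)).
  apply/measurable_EFinP; apply: measurable_funM => //.
  apply: measurableT_comp; first exact: measurable_expR.
  exact: measurable_funM.
have w0 x : (0 <= weighted r F (x +i* b))%E by rewrite lee_fin mulr_ge0 ?expR_ge0 ?normc_ge0.
have := integrableZl mH M (int_powR_exp (ltrN10 R) dr) => ig.
have : mu.-integrable H (fun x => weighted r F (x +i* b)).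
  apply: le_integrable ig => // x xH; have x0 : 0 < x by move: xH; rewrite /= in_itv/= andbT.
  rewrite gee0_abs// -EFinM abse_EFin lee_fin powRr0 mul1r ger0_norm ?mulr_ge0 ?expR_ge0//.
  have xz : x <= normc (x +i* b).
    by have := normRe (x +i* b); rewrite [Re _]/= (gtr0_norm x0).
  apply: le_trans (ler_wpM2l (expR_ge0 _) (FM _ _)) _.
    by rewrite dist_ray_right// ltW.
  rewrite mulrCA -expRD ler_wpM2l// ler_expR -mulrDl addrC -opprB mulNr lerN2 ler_pM2l//.
move=> /integrableP[_]; rewrite (eq_integral (fun x : RT => weighted r F (x +i* b)))// => x _.
by rewrite gee0_abs.
Qed.

Lemma arc_weight_finite a r F A : holo (strip a) F -> 0 < A < a ->
  (\int[mu]_(s in `[(pi / 2)%R, (3 * pi / 2)%R])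
              weighted r F ((A * cos s)%R +i* (A * sin s)%R) < +oo)%E.
Proof.
move=> hF /andP[A0 Aa]; pose g (s : R) : R[i] := (A * cos s) +i* (A * sin s).
have ng s : normc (g s) = A.
  apply/eqP; rewrite -(@eqrXn2 _ 2) ?normc_ge0 ?(ltW A0)// normc_sqr /= !exprMn -mulrDr.
  by rewrite cos2Dsin2 mulr1.
have dg s : dist_ray (g s) <= A by rewrite -(ng s) dist_ray_normc.
have [M M0 FM] := strip_bounded A hF Aa.
have c1 : continuous (fun s : R => A * cos s) by move=> s; apply: cvgMr; exact: continuous_cos.
have c2 : continuous (fun s : R => A * sin s) by move=> s; apply: cvgMr; exact: continuous_sin.
have mg : cmeas setT (fun s : RT => F (g s)).
  have l s : lip_at F (g s) by apply: holo_lip; apply: hF; exact: le_lt_trans Aa.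
  have cg s : (fun u => (A * cos u, A * sin u) : R * R) @ s --> (A * cos s, A * sin s).
    exact: cvg_pair (c1 s) (c2 s).
  split; apply: continuous_measurable_fun => s.
    by have [h _] := lip_continuous (l s); exact: (continuous_comp (cg s) h).
  by have [_ h] := lip_continuous (l s); exact: (continuous_comp (cg s) h).
have mw (D : set RT) : measurable_fun D (fun s => weighted r F (g s)).
  apply/measurable_EFinP; under eq_fun do rewrite ng.
  apply: measurable_funM => //.
  by apply: measurable_normc; case: mg => m1 m2; split; exact: measurable_funTS.
pose D := (`[(pi / 2)%R, (3 * pi / 2)%R]%classic : set RT).
have mD : measurable D by exact: measurable_itv.
apply: (@le_lt_trans _ _ (\int[mu]_(s in D) (expR (- r * A) * M)%:E)%E).
  apply: ge0_le_integral => //.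
  - by move=> s _; rewrite lee_fin mulr_ge0 ?expR_ge0 ?normc_ge0.
  - by move=> s _; rewrite -/(g s) /weighted lee_fin ng ler_wpM2l ?expR_ge0// FM// ng.
have Doo : (lebesgue_measure (`[(pi / 2)%R, (3 * pi / 2)%R]%classic : set R) < +oo)%E.
  by rewrite lebesgue_measure_itv/=; case: ifP => _; rewrite ?ltry// -EFinB ltry.
rewrite integral_cst//; apply: lte_mul_pinfty => //.
by rewrite lee_fin mulr_ge0 ?expR_ge0.
Qed.

Lemma hgrowth_in_H a rho F : hgrowth a rho F -> in_H a rho F.
Proof.
move=> hF; split.
- by apply: holo_analytic; [exact: copen_strip|case: hF].
- move=> A /andP[A0 Aa]; have [_ gF] := hF.
  have [M M0 FM] := gF A (rho + 1) Aa ltac:(lra).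
  by exists M, (rho + 1), 0 => t tA _; apply: FM; exact: ltW.
- move=> r A rr /andP[A0 Aa]; rewrite /boundary_norm.
  have bA : `|A| < a by rewrite gtr0_norm.
  have bA' : `|- A| < a by rewrite normrN.
  have a1 := line_weight_finite hF rr bA; have a2 := line_weight_finite hF rr bA'.
  have a3 : (\int[mu]_(s in `[(pi / 2)%R, (3 * pi / 2)%R])
     weighted r F ((A * cos s)%R +i* (A * sin s)%R) < +oo)%E.
    by apply: (@arc_weight_finite a) => //; [case: hF|rewrite A0].
  apply: lte_add_pinfty; first exact: lte_add_pinfty.
  by apply: lte_mul_pinfty => //; rewrite lee_fin ltW.
Qed.

Lemma in_HP a rho F : 0 < a -> 0 <= rho -> in_H a rho F <-> hgrowth a rho F.
Proof.
move=> a0 rho0; split; last exact: hgrowth_in_H.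
by move=> hF; split; [case: hF => /analytic_holo|exact: in_H_growth].
Qed.

Lemma hgrowthD a rho F G : hgrowth a rho F -> hgrowth a rho G -> hgrowth a rho (fun t => F t + G t).
Proof.
move=> [hF gF] [hG gG]; split; first by move=> t ta; apply: holo_atD; [exact: hF|exact: hG].
move=> A r Aa rr; have [M M0 FM] := gF A r Aa rr; have [N N0 GN] := gG A r Aa rr.
exists (M + N); first exact: addr_ge0.
by move=> t tA; rewrite mulrDl (le_trans (normcD _ _))// lerD ?FM ?GN.
Qed.

Lemma hgrowthZ a rho c F : hgrowth a rho F -> hgrowth a rho (fun t => c * F t).
Proof.
move=> [hF gF]; split; first by move=> t ta; apply: holo_atM; [exact: holo_at_cst|exact: hF].
move=> A r Aa rr; have [M M0 FM] := gF A r Aa rr.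
exists (normc c * M); first by rewrite mulr_ge0 ?normc_ge0.
by move=> t tA; rewrite normcM -mulrA ler_wpM2l ?normc_ge0 ?FM.
Qed.

Lemma hgrowth_avg a rho k F : 0 <= rho -> cint I k -> hgrowth a rho F -> hgrowth a rho (avg k F).
Proof.
move=> rho0 ki [hF gF]; split; first exact: holo_avg.
move=> A r Aa rr; have [M M0 FM] := gF A r Aa rr.
have r0 : 0 <= r by exact: le_trans (ltW rr).
exists (2 * (M * Rintegral mu I (fun s => normc (k s)))).
  by rewrite mulr_ge0// mulr_ge0//; apply: Rintegral_ge0 => s _; exact: normc_ge0.
move=> t tA; have e0 : 0 <= M * expR (r * normc t) by rewrite mulr_ge0 ?expR_ge0.
have ta : strip a t by exact: le_lt_trans Aa.
have := avg_bound ki hF ta e0; rewrite (RintegralZl _ mI (cint_normc mI ki)).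
rewrite (_ : 2 * (M * _ * _) = 2 * (M * Rintegral mu I (fun s => normc (k s))) * expR (r * normc t)); last by ring.
apply => s /andP[s0 s1]; apply: le_trans (FM _ _) _.
  by rewrite (le_trans _ tA)// dist_ray_scale// !ltW.
by rewrite ler_wpM2l// ler_expR ler_wpM2l// normcM normc_real gtr0_norm// ler_piMl ?normc_ge0 ?ltW.
Qed.

(** Cauchy's estimate on squares of half-width [d], which stay within distance A' = A + 2 d of the
    ray, bounds the derivative. The factor |t| is absorbed by passing from the rate r' to r. *)
Lemma hgrowth_euler a rho F : 0 <= rho -> hgrowth a rho F -> hgrowth a rho (fun t => t * cder F t).
Proof.
move=> rho0 [hF gF]; split.
  move=> t ta; apply: holo_atM; first exact: holo_at_id.
  exact: (holo_cder (@copen_strip _ a) hF).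
move=> A r Aa rr; pose A' := (A + a) / 2; pose d := (a - A) / 4.
have d0 : 0 < d by rewrite /d; lra.
have A'a : A' < a by rewrite /A'; lra.
pose r' := (rho + r) / 2; have rr' : rho < r' by rewrite /r'; lra.
have r0' : 0 < r' by exact: le_lt_trans rr'.
have [M M0 FM] := gF A' r' A'a rr'.
have dr : 0 < r - r' by rewrite /r'; lra.
exists ((r - r')^-1 * (M * expR (r' * (d + d)) * (2 / d))).
  by rewrite !mulr_ge0 ?expR_ge0// ?invr_ge0 ltW.
move=> t tA; rewrite normcM.
have h1 : normc t <= (r - r')^-1 * expR ((r - r') * normc t).
  by rewrite mulrC ler_pdivlMr// mulrC (le_trans _ (expR_ge1Dx _))// lerDr.
have dz z : sq d z -> dist_ray (t + z) <= A'.
  move=> /normc_sq zd; rewrite (le_trans (dist_rayD _ _))//; rewrite /d in zd; rewrite /A'; lra.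
have h2 : normc (cder F t) <= M * expR (r' * (normc t + (d + d))) * (2 / d).
  apply: cauchy_bound => //.
    by move=> _ [z /dz zd <-]; apply: hF; exact: le_lt_trans A'a.
  move=> z zd; apply: le_trans (FM _ (dz z zd)) _; rewrite ler_wpM2l// ler_expR ler_pM2l//.
  by rewrite (le_trans (normcD _ _))// lerD2l normc_sq.
apply: le_trans (ler_pM (normc_ge0 _) (normc_ge0 _) h1 h2) _.
rewrite mulrDr expRD le_eqVlt; apply/orP; left; apply/eqP.
have -> : r * normc t = (r - r') * normc t + r' * normc t by ring.
by rewrite expRD; ring.
Qed.

Lemma hgrowth1 a rho : 0 <= rho -> hgrowth a rho (fun=> 1).
Proof.
move=> rho0; split; first by move=> t _; exact: holo_at_cst.
move=> A r _ rr; exists 1 => // t _; rewrite normc1 mul1r -expR0 ler_expR.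
by rewrite mulr_ge0 ?normc_ge0// (le_trans rho0)// ltW.
Qed.

Lemma hgrowth_ray a rho F r : 0 < a -> hgrowth a rho F -> rho < r -> ray_bound F r.
Proof.
move=> a0 [_ gF] rr; have [M M0 FM] := gF 0 r a0 rr; exists M => // x x0.
rewrite -{2}(gtr0_norm x0) -normc_real; apply: FM.
by rewrite dist_ray_right /= ?normr0//; exact: ltW.
Qed.

Lemma hgrowth_holo_ray a rho F x : 0 < a -> hgrowth a rho F -> 0 < x -> holo_at F x%:C.
Proof. by move=> a0 [hF _] x0; apply: hF; exact: strip_ray. Qed.

Lemma hgrowth_cmeas a rho F : 0 < a -> hgrowth a rho F -> cmeas H (fun x => F x%:C).
Proof. by move=> a0 hF; apply: holo_cmeas => x; exact: (hgrowth_holo_ray a0 hF). Qed.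

End HolomorphicGrowth.

(** * Change of exponent *)

Section Shift.
Variable R : realType.
Local Notation mu := (@lebesgue_measure R).
Local Notation RT := (measurableTypeR R).
Local Notation H := (`]0%R, +oo[%classic : set RT).
Local Notation I := (`]0%R, 1%R[%classic : set RT).
Implicit Types (t z w c p q zeta delta : R[i]) (x s a r A B N rho : R) (F G : R[i] -> R[i]).

Let mI : measurable I. Proof. exact: measurable_itv. Qed.
Let mH : measurable H. Proof. exact: measurable_itv. Qed.
Local Notation one := (fun=> 1 : R[i]).

Lemma cpowD z p q : cpow z (p + q) = cpow z p * cpow z q.
Proof. by rewrite /cpow mulrDl cexpD. Qed.

Lemma cpow0 z : cpow z 0 = 1.
Proof. by rewrite /cpow mul0r cexp0. Qed.

Lemma cpow1 z : z != 0 -> cpow z 1 = z.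
Proof.
move=> z0; have n0 : 0 < normc z by rewrite normc_gt0.
have u1 : -1 <= Re z / normc z <= 1.
  rewrite -ler_norml normrM normfV (ger0_norm (normc_ge0 z)) ler_pdivrMr// mul1r.
  exact: normRe.
have sE : normc z * Num.sqrt (1 - (Re z / normc z) ^+ 2) = `|Im z|.
  rewrite -[X in X * _](gtr0_norm n0) -sqrtr_sqr -sqrtrM ?sqr_ge0// -sqrtr_sqr; congr Num.sqrt.
  rewrite mulrBr mulr1 -exprMn mulrC divfK ?lt0r_neq0// normc_sqr; ring.
rewrite /cpow mul1r /cexp /clog /= lnK// /principal_arg.
apply: complexP => /=; case: ifPn => y0.
- by rewrite acosK// mulrC divfK// lt0r_neq0.
- by rewrite cosN acosK// mulrC divfK// lt0r_neq0.
- by rewrite sin_acos// sE ger0_norm.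
- by rewrite sinN sin_acos// mulrN sE ltr0_norm ?opprK// ltNge.
Qed.

(* Equality of [laplace_pow p G] and [laplace_pow q F] up to their common factor
   zeta. *)
Definition same_transform rho p G q F := forall zeta, rho < Re zeta ->
  cpow zeta p * lap p G zeta = cpow zeta q * lap q F zeta.

Lemma lower a rho p F : 0 < a -> 0 <= rho -> -1 < Re p -> hgrowth a rho F ->
  exists2 G, hgrowth a rho G & same_transform rho p G (p + 1) F.
Proof.
move=> a0 rho0 p1 hF; have hE := hgrowth_euler rho0 hF.
exists (fun t => t * cder F t + (p + 1) * F t).
  by apply: hgrowthD => //; exact: hgrowthZ.
(* Bounds on the ray are available for rates above rho only, and convergence needs a rate below Re
   zeta. *)
move=> zeta rz; pose r := (rho + Re zeta) / 2.
have [r1 r2] : rho < r /\ r < Re zeta by rewrite /r; split; lra.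
have z0 : zeta != 0.
  by apply/eqP => h; move: rz; rewrite h /= ltNge rho0.
rewrite (lap_shift p1 r2).
- by rewrite cpowD cpow1// mulrA.
- by move=> x; exact: hgrowth_holo_ray hF.
- by move=> x x0; apply: (holo_cder (@copen_strip _ a) hF.1); exact: strip_ray.
- exact: hgrowth_ray hF r1.
- exact: hgrowth_ray hE r1.
Qed.

(** [lap (q - 1) one 1] is Gamma(q). By [lap_avg] and [gammaE], averaging with the beta kernel
    multiplies the transform by this constant, which [c] divides out; Re q >= 1 lets s^(Re p)
    dominate the kernel. *)
Lemma raise a rho p q F : 0 < a -> 0 <= rho -> -1 < Re p -> 1 <= Re q ->
  lap (q - 1) one 1 != 0 -> hgrowth a rho F ->
  exists2 G, hgrowth a rho G & same_transform rho (p + q) G p F.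
Proof.
move=> a0 rho0 p1 q1 g0 hF; pose c := (lap (q - 1) one 1)^-1.
have ki : cint I (beta_kernel p q).
  apply: (cint_le (g := fun s => s `^ Re p)) => //.
  - apply: cmeasM.
      by case: (cmeas_rpow p) => m1 m2; split; [apply: measurable_funS m1|apply: measurable_funS m2];
        rewrite // => x /=; rewrite !in_itv/= andbT => /andP[].
    have := @cmeas_comp _ _ _ _ _ (fun s : RT => 1 - s : RT) (fun x => rpow x (q - 1)) H I mH.
    apply; [|exact: cmeas_rpow|exact: measurable_funB].
    by move=> _ [s /= + <-]; rewrite !in_itv/= andbT subr_gt0 => /andP[].
  - exact: int_powR_unit.
  - move=> s sI; have /andP[s0 s1] : 0 < s < 1 by move: sI; rewrite /= in_itv.
    rewrite normcM !normc_rpow ?subr_gt0// ler_piMr ?powR_ge0//.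
    have c0 : 0 <= Re (q - 1) by rewrite ReD ReN /=; lra.
    have := ge0_ler_powR c0 (_ : 1 - s \in Num.nneg) (_ : 1 \in Num.nneg).
    rewrite powR1; apply; rewrite ?nnegrE ?subr_ge0 ?(ltW s1)//.
    by rewrite lerBlDr lerDl ltW.
have hA := hgrowth_avg rho0 ki hF.
exists (fun t => c * avg (beta_kernel p q) F t); first exact: hgrowthZ.
move=> zeta rz; pose r := (rho + Re zeta) / 2.
have [r1 r2] : rho < r /\ r < Re zeta by rewrite /r; split; lra.
have z0 : 0 < Re zeta by exact: le_lt_trans rz.
have pq1 : -1 < Re (p + q) by rewrite ReD; lra.
have q1' : -1 < Re (q - 1) by rewrite ReD ReN /=; lra.
rewrite (lapZ c pq1 r2 (hgrowth_cmeas a0 hA) (hgrowth_ray a0 hA r1)).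
have r0 : 0 <= r by exact: le_trans (ltW r1).
rewrite (lap_avg p1 q1 r0 r2 (hgrowth_cmeas a0 hF) (hgrowth_ray a0 hF r1)).
have := gammaE q1' z0; rewrite subrK => gE.
rewrite cpowD (_ : _ * _ = c * (cpow zeta q * lap (q - 1) one zeta) * (cpow zeta p * lap p F zeta)); last by ring.
by rewrite gE /c mulVf// mul1r.
Qed.

(** Gamma(1) is only needed to be nonzero: exp (-x) >= exp (-1) on the unit interval bounds it
    below. *)
Lemma lap01_neq0 : lap 0 one 1 != 0.
Proof.
pose g (x : R) := expR (- x); have gE x : Re (cexp (- (1 * x%:C)) * (rpow x 0 * 1)) = g x.
  by rewrite rpow0 mul1r !mulr1 /= oppr0 cos0 mulr1.
have a1 : -1 < Re (0 : R[i]) by exact: ltrN10.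
have [ig _] := cint_lap a1 (ltr01 : 0 < Re (1 : R[i])) (cmeas_cst H (1 : R[i])) (ray_bound1 (lexx 0)).
have {}ig : mu.-integrable H (fun x => (g x)%:E) by apply: eq_integrable ig => // x _; rewrite gE.
have g0 x : (0 <= (g x)%:E)%E by rewrite lee_fin expR_ge0.
have mg : measurable_fun H (fun x => (g x)%:E) by case/integrableP: ig.
have IH : I `<=` H by move=> x; rewrite /= !in_itv/= andbT => /andP[].
have h : ((expR (- 1))%:E <= \int[mu]_(x in H) (g x)%:E)%E.
  have h1 := ge0_subset_integral mu mI mH mg (fun x _ => g0 x) IH.
  apply: le_trans _ h1.
  have -> : (expR (-1))%:E = (\int[mu]_(x in I) (expR (- 1))%:E)%E.
    by rewrite integral_cst//; rewrite [X in (_ * X)%E](lebesgue_measure_itv `]0, 1[%R)/= lte_fin ltr01 sube0 mule1.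
  apply: ge0_le_integral => //.
  - exact: measurable_funS mg.
  - by move=> x; rewrite /= in_itv/= => /andP[_ x1]; rewrite lee_fin ler_expR lerN2 ltW.
have E : Re (lap 0 one 1) = Rintegral mu H g by apply: eq_Rintegral => x _; exact: gE.
apply/eqP => l0; rewrite l0 in E; have e0 : Rintegral mu H g = 0 by rewrite -E.
move: h; rewrite -(fineK (integrable_fin_num mH ig)) -/(Rintegral mu H g) e0 lee_fin.
by rewrite leNgt expR_gt0.
Qed.

(** Gamma(2) = Gamma(1) is nonzero, and continuity follows from |v^delta - 1| <= 4 |delta| (v + 1/v)
    for |delta| <= 1/2. The choice of the point 2 supplies a factor v in the integrand that
    compensates 1/v, leaving the weight v^2 + 1 of [g]. *)
Lemma gamma2_neq0 : exists2 d : R, 0 < d & forall delta, normc delta < d ->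
  lap (1 + delta) one 1 != 0.
Proof.
have a0 : -1 < Re (0 : R[i]) by exact: ltrN10.
have one0 : 0 < Re (1 : R[i]) by exact: ltr01.
have := lap1_shift a0 one0; rewrite add0r !mul1r => e01.
have l1 : 0 < normc (lap 1 one 1) by rewrite normc_gt0 -e01 lap01_neq0.
pose g (v : R) : R := v `^ 2 * expR (- (1 * v)) + v `^ 0 * expR (- (1 * v)).
have ig : mu.-integrable H (fun v => (g v)%:E).
  have i1 : -1 < (2 : R) by lra.
  by have := integrableD mH (int_powR_exp i1 ltr01) (int_powR_exp (ltrN10 R) ltr01).
pose K := Rintegral mu H g.
have K0 : 0 <= K by apply: Rintegral_ge0 => v _; rewrite addr_ge0// mulr_ge0 ?powR_ge0 ?expR_ge0.
(* The difference from Gamma(2) is at most 8 K |delta|: 4 from the pointwise bound and 2 from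
   [Cintegral_bound]. *)
exists (Num.min (1 / 2) (normc (lap 1 one 1) / (8 * K + 1))).
  by rewrite lt_min divr_gt0//= divr_gt0// ltr_wpDl// mulr_ge0.
move=> delta; rewrite lt_min => /andP[d2 dK]; apply/eqP => l0.
have ad : -1 < Re (1 + delta).
  by rewrite ReD /=; have := normRe delta; rewrite ler_norml => /andP[? ?]; lra.
have a1 : -1 < Re (1 : R[i]) by rewrite /=; lra.
have cst1 : cmeas H (fun x => one x%:C) by exact: cmeas_cst.
have b1 := @ray_bound1 R 0 (lexx 0).
have j1 := cint_lap (F := one) ad one0 cst1 b1; have j2 := cint_lap (F := one) a1 one0 cst1 b1.
have : normc (lap (1 + delta) one 1 - lap 1 one 1) <= 2 * Rintegral mu H (fun v => 4 * normc delta * g v).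
  rewrite /lap -CintegralB//; apply: Cintegral_bound => //.
  - by apply: cint_cmeas; exact: cintB.
  - exact: (integrableZl mH (4 * normc delta) ig).
  - move=> v vH; have v0 : 0 < v by move: vH; rewrite /= in_itv/= andbT.
    rewrite !mulr1 -mulrBr rpowD rpow1// -[X in _ - X]mulr1 -mulrBr !normcM normc_cexp normc_real gtr0_norm//.
    rewrite mul1r ReN [Re v%:C]/=.
    set L := `|ln v|; have h1 : normc (rpow v delta - 1) <= 2 * (normc delta * L) * expR (normc delta * L).
      have := cexp_taylor 1 (delta * (ln v)%:C).
      by rewrite horner_poly big_ord1 fact0 invr1 expr0 mulr1 !expr1 normcM normc_real.
    have L0 : 0 <= L by exact: normr_ge0.
    have L1 : L <= 2 * expR (L / 2) by have := expR_ge1Dx (L / 2); lra.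
    have h2 : expR (normc delta * L) <= expR (L / 2).
      by rewrite ler_expR mulrC ler_wpM2l// (le_trans (ltW d2))// mul1r.
    have h3 : expR (L / 2) * expR (L / 2) = expR L by rewrite -expRD; congr expR; field.
    have h4 : expR L <= v + v^-1.
      rewrite /L; case: (ger0P (ln v)) => _.
        by rewrite lnK// lerDl invr_ge0 ltW.
      by rewrite expRN lnK// lerDr ltW.
    have h5 : normc (rpow v delta - 1) <= 4 * normc delta * (v + v^-1).
      apply: le_trans h1 _; apply: le_trans (_ : 4 * normc delta * expR L <= _); last first.
        by rewrite ler_wpM2l ?mulr_ge0 ?normc_ge0.
      rewrite (_ : 2 * (normc delta * L) * _ = normc delta * (2 * (L * expR (normc delta * L)))); last by ring.
      rewrite (mulrC 4) -[leRHS]mulrA ler_wpM2l ?normc_ge0// -h3.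
      have := ler_pM L0 (expR_ge0 _) L1 h2; lra.
    apply: le_trans (ler_wpM2l (expR_ge0 _) (ler_wpM2l (ltW v0) h5)) _.
    rewrite /g powRr0 powR_mulrn ?(ltW v0)// mul1r le_eqVlt; apply/orP; left; apply/eqP.
    by field; exact: lt0r_neq0.
rewrite l0 sub0r normcNE (RintegralZl _ mH ig) -/K.
move: dK; rewrite ltr_pdivlMr ?ltr_wpDl ?mulr_ge0//.
have := normc_ge0 delta; nra.
Qed.

Lemma same_transform_trans rho p q w F G K : same_transform rho p F q G -> same_transform rho q G w K ->
  same_transform rho p F w K.
Proof. by move=> h1 h2 zeta rz; rewrite h1// h2. Qed.

(* The only nonzero values of Gamma known so far are those near 2: raising by
   2 + delta and lowering twice gives small steps delta. *)
Lemma change_exponent a rho p q F : 0 < a -> 0 <= rho -> -1 < Re p -> -1 < Re q ->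
  hgrowth a rho F -> exists2 G, hgrowth a rho G & same_transform rho q G p F.
Proof.
move=> a0 rho0 p1 q1 hF; have [d d0 hd] := gamma2_neq0.
have small p' delta F' : -1 < Re p' -> -1 < Re (p' + delta) -> normc delta < d ->
    normc delta <= 1 -> hgrowth a rho F' ->
    exists2 G, hgrowth a rho G & same_transform rho (p' + delta) G p' F'.
  move=> p'1 pd1 dd d1 hF'.
  have q2 : 1 <= Re (2 + delta).
    by rewrite ReD /=; have := normRe delta; rewrite ler_norml => /andP[? ?]; lra.
  have [G1 hG1 e1] := @raise a rho p' (2 + delta) F' a0 rho0 p'1 q2
    ltac:(rewrite (_ : 2 + delta - 1 = 1 + delta); [exact: hd|ring]) hF'.
  have pd2 : -1 < Re (p' + delta + 1) by rewrite ReD /=; lra.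
  have [G2 hG2 e2] := lower a0 rho0 pd2 hG1; have [G3 hG3 e3] := lower a0 rho0 pd1 hG2.
  exists G3 => //; apply: same_transform_trans e3 (same_transform_trans e2 _).
  by rewrite (_ : p' + delta + 1 + 1 = p' + (2 + delta)); last ring.
(* The number of steps makes each one shorter than [d], for Gamma(2 + delta) to be nonzero, and
   shorter than 1, for Re (2 + delta) >= 1. *)
pose m := Num.bound (normc (q - p) / Num.min d 1).
have d10 : 0 < Num.min d 1 by rewrite lt_min d0 ltr01.
have hm : normc (q - p) < Num.min d 1 * m.+1%:R.
  rewrite mulrC -ltr_pdivrMr//; apply: lt_trans (archi_boundP _) _; last by rewrite ltr_nat.
  by rewrite divr_ge0 ?normc_ge0// ltW.
have m0 : 0 < m.+1%:R :> R by [].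
pose delta := (m.+1%:R^-1)%:C * (q - p).
have /andP[dd d1] : (normc delta < d) && (normc delta < 1).
  rewrite -lt_min normcM normc_real gtr0_norm ?invr_gt0// mulrC ltr_pdivrMr//.
have [G hG eG] : exists2 G, hgrowth a rho G & same_transform rho (p + delta *+ m.+1) G p F.
  (* The intermediate exponents lie on the segment from p to q, and the half-plane Re > -1 is
     convex. *)
  have conv j : (j <= m.+1)%N -> -1 < Re (p + delta *+ j).
    move=> jm; have -> : Re (p + delta *+ j) = (1 - j%:R / m.+1%:R) * Re p + j%:R / m.+1%:R * Re q.
      rewrite ReD -mulr_natl (_ : j%:R = (j%:R : R)%:C); last by rewrite rmorph_nat.
      rewrite /delta !cReM !cImM /= ReD ReN; ring.
    have h0 : 0 <= j%:R / m.+1%:R :> R by rewrite divr_ge0.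
    have h1 : j%:R / m.+1%:R <= 1 :> R by rewrite ler_pdivrMr// mul1r ler_nat.
    set c := j%:R / m.+1%:R in h0 h1 *; pose u := Num.min (Re p + 1) (Re q + 1).
    have u0 : 0 < u by rewrite lt_min; apply/andP; split; lra.
    have up : u <= Re p + 1 by rewrite ge_min lexx.
    have uq : u <= Re q + 1 by rewrite ge_min lexx orbT.
    have c1 : 0 <= 1 - c by lra.
    have := ler_wpM2l c1 up; have := ler_wpM2l h0 uq; lra.
  have : (m.+1 <= m.+1)%N by []. 
  elim: {-2}m.+1 => [_|j IH jm]; first by rewrite mulr0n addr0; exists F.
  have [G hG eG] := IH (ltnW jm).
  have cj := conv _ jm; rewrite mulrS [delta + _]addrC addrA in cj *.
  have [K hK eK] := @small _ delta G (conv _ (ltnW jm)) cj dd (ltW d1) hG.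
  by exists K => //; exact: same_transform_trans eK eG.
exists G => //; suff -> : q = p + delta *+ m.+1 by [].
rewrite /delta -mulr_natl mulrA (_ : m.+1%:R = (m.+1%:R : R)%:C); last by rewrite rmorph_nat.
by rewrite -rmorphM/= divff ?pnatr_eq0// rmorph1 mul1r addrC subrK.
Qed.

End Shift.

(** * Watson's lemma and injectivity *)

Section Identity.
Variable R : realType.
Implicit Types (t z w c p q zeta : R[i]) (x s a r A B N rho : R) (F G : R[i] -> R[i]).

Lemma iter_dquot_zero (g : R[i] -> R[i]) k (e : R) : (forall z, normc z < e -> g z = 0) ->
  forall z, normc z < e -> iter k (@dquot R) g z = 0.
Proof.
move=> g0; elim: k => [//|k IH] z ze /=; rewrite /dquot; case: eqVneq => [z0|_].
  have e0 : 0 < e by rewrite (le_lt_trans _ ze)// normc_ge0.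
  rewrite (@derE _ 2 _ 0 0 e)// ?coef0// => w we.
  by rewrite IH// horner0 subr0 normc0 mul0r.
by rewrite !IH ?subr0 ?mul0r// normc0 (le_lt_trans _ ze)// normc_ge0.
Qed.

(** When all coefficients vanish, [taylor] leaves only the remainder, at most M 2^(-k) for |z| <=
    d/4 and every k. *)
Lemma holo_flat_zero (d M : R) F t : 0 < d -> holo [set t + z | z in sq d] F ->
  (forall z, sq d z -> normc (F (t + z)) <= M) -> (forall k, tay F t k = 0) ->
  forall z, normc z <= d / 4 -> F (t + z) = 0.
Proof.
move=> d0 hF FM F0 z zd; have M0 : 0 <= M by exact: le_trans (normc_ge0 _) (FM 0 (sq0 (ltW d0))).
have zs : sq d z by apply: sq_normc; lra.
have h k : normc (F (t + z)) <= M * (1 / 2) ^+ k.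
  have := taylor k d0 hF FM zs; rewrite big1 ?subr0 => [h|j _]; last by rewrite F0 mul0r.
  apply: le_trans h _; rewrite ler_wpM2l// lerXn2r ?nnegrE ?mulr_ge0 ?normc_ge0 ?invr_ge0 ?(ltW d0)//.
  by rewrite mulrAC ler_pdivrMr//; lra.
apply/eqP; rewrite -normc_eq0 eq_le normc_ge0 andbT; apply/ler_addgt0Pr => e e0; rewrite add0r.
have hm := archi_boundP (divr_ge0 M0 (ltW e0)); set m := Num.bound _ in hm.
apply: le_trans (h m) _; rewrite mul1r exprVn ler_pdivrMr ?exprn_gt0// mulrC -ler_pdivrMr//.
apply: le_trans (ltW hm) _; rewrite -natrX ler_nat ltnW// ltn_expl//.
Qed.

(** Vanishing propagates along the segment from 0 to t, all of whose points admit the same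
    half-width [d]. Steps shorter than d/8 keep the disc of radius d/8 about the next point inside
    the disc of radius d/4 where [F] is already known to vanish. *)
Lemma identity_theorem a F t : holo (strip a) F -> strip a t -> (forall k, tay F 0 k = 0) -> F t = 0.
Proof.
move=> hF ta F0; pose d := (a - dist_ray t) / 4.
have d0 : 0 < d by rewrite divr_gt0// subr_gt0.
have Aa : dist_ray t + (d + d) < a by rewrite /d; move: ta; rewrite /strip/=; lra.
have [M M0 hM] := strip_bounded (normc t + (d + d)) hF Aa.
have dd s z : 0 <= s <= 1 -> sq d z -> dist_ray (s%:C * t + z) <= dist_ray t + (d + d).
  by move=> s01 /normc_sq zd; rewrite (le_trans (dist_rayD _ _))// lerD// dist_ray_scale.
have hs s : 0 <= s <= 1 -> (forall k, tay F (s%:C * t) k = 0) ->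
    forall z, normc z <= d / 4 -> F (s%:C * t + z) = 0.
  move=> s01; apply: (@holo_flat_zero _ M) => //.
    by move=> _ [z zd <-]; apply: hF; exact: le_lt_trans (dd s z s01 zd) Aa.
  move=> z zd; apply: hM; first exact: dd.
  rewrite (le_trans (normcD _ _))// lerD ?normc_sq// normcM normc_real.
  by case/andP: s01 => s0 s1; rewrite ger0_norm// ler_piMl ?normc_ge0.
pose m := Num.bound (normc t / (d / 8)).
have m0 : 0 < m.+1%:R :> R by [].
have d8 : 0 < d / 8 by exact: divr_gt0.
have tm : normc t / m.+1%:R < d / 8.
  rewrite ltr_pdivrMr// mulrC -ltr_pdivrMr//; apply: lt_trans (archi_boundP _) _.
    by rewrite divr_ge0 ?normc_ge0// ltW.
  by rewrite ltr_nat.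
have step j : (j <= m.+1)%N -> forall k, tay F ((j%:R / m.+1%:R)%:C * t) k = 0.
  elim: j => [_|j IH jm]; first by rewrite mul0r (_ : 0%:C = 0)// mul0r.
  have s01 : 0 <= (j%:R / m.+1%:R : R) <= 1.
    by rewrite divr_ge0//= ler_pdivrMr// mul1r ler_nat ltnW.
  have F1 := hs _ s01 (IH (ltnW jm)) => k; rewrite /tay.
  apply: (@iter_dquot_zero _ _ (d / 8)); last by rewrite normc0.
  move=> z zd.
  have -> : (j.+1%:R / m.+1%:R)%:C * t + z = (j%:R / m.+1%:R)%:C * t + ((m.+1%:R^-1)%:C * t + z).
    by rewrite -natr1 mulrDl mul1r rmorphD/=; ring.
  apply: F1; apply: le_trans (normcD _ _) _.
  rewrite (_ : normc ((m.+1%:R^-1)%:C * t) = normc t / m.+1%:R).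
    by apply: le_trans (lerD (ltW tm) (ltW zd)) _; lra.
  by rewrite normcM normc_real gtr0_norm ?invr_gt0// mulrC.
have := hs 1 _ (fun k => _) 0; rewrite addr0 (_ : (1 : R)%:C = 1)// mul1r; apply.
- by rewrite ler01 lexx.
- by move=> k; have := step m.+1 (leqnn _) k; rewrite divff ?pnatr_eq0// mul1r.
- by rewrite normc0 divr_ge0// ltW.
Qed.

End Identity.

(** * Watson's lemma with remainder, and its consequences for Gamma and injectivity *)

Section Watson.
Variable R : realType.
Local Notation mu := (@lebesgue_measure R).
Local Notation RT := (measurableTypeR R).
Local Notation H := (`]0%R, +oo[%classic : set RT).
Implicit Types (t z w c p q zeta alpha : R[i]) (x s a r A B N rho b y : R) (F G : R[i] -> R[i]).

Let mH : measurable H. Proof. exact: measurable_itv. Qed.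
Local Notation one := (fun=> 1 : R[i]).

Lemma cexp_real x : cexp x%:C = (expR x)%:C :> R[i].
Proof. by apply: complexP => /=; rewrite ?cos0 ?sin0 ?mulr1 ?mulr0. Qed.

Lemma rpow_real x b : 0 < x -> rpow x b%:C = (x `^ b)%:C.
Proof. by move=> x0; rewrite /rpow -rmorphM cexp_real /powR gt_eqF. Qed.

Lemma real_gamma b y : -1 < b -> 0 < y ->
  Rintegral mu H (fun x => x `^ b * expR (- (y * x))) =
  Rintegral mu H (fun x => x `^ b * expR (- (1 * x))) * y `^ (- (b + 1)).
Proof.
move=> b1 y0.
have lapE u : 0 < u -> lap b%:C one u%:C = (Rintegral mu H (fun x => x `^ b * expR (- (u * x))))%:C.
  move=> u0; have E x : H x -> cexp (- (u%:C * x%:C)) * (rpow x b%:C * 1) = (x `^ b * expR (- (u * x)))%:C.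
    rewrite /= in_itv/= andbT => x0; rewrite mulr1 rpow_real// -rmorphM -rmorphN cexp_real mulrC.
    by rewrite rmorphM.
  rewrite /lap (eq_Cintegral E); apply: complexP => //=.
  by rewrite /Rintegral integral0.
have b1' : -1 < Re (b%:C : R[i]) by [].
have y0' : 0 < Re (y%:C : R[i]) by [].
have := gammaE b1' y0'; rewrite lapE// (_ : 1 = 1%:C :> R[i])// lapE// cpow_real//.
rewrite -rmorphD rpow_real// -rmorphM => /(congr1 (@Re R)) /= <-.
by rewrite powRN mulrC mulKf// lt0r_neq0// powR_gt0.
Qed.

(** The error F(x) - f x^m is O(x^(m+1) e^(r x)) on the whole ray, by the Taylor expansion near 0
    and by growth away from 0. Its transform is therefore one power of y smaller than the leading
    term. *)
Lemma watson a rho alpha F (m : nat) : 0 < a -> 0 <= rho -> -1 < Re alpha -> hgrowth a rho F ->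
  (forall j, (j < m)%N -> tay F 0 j = 0) ->
  exists C X : R, [/\ 0 <= C, 0 < X & forall y, X <= y ->
    normc (lap alpha F y%:C - tay F 0 m * lap (alpha + m%:R) one y%:C) <=
      C * y `^ (- (Re alpha + m%:R + 2))].
Proof.
move=> a0 rho0 al1 hF F0; pose d := a / 4; have d0 : 0 < d by rewrite divr_gt0.
have Aa : d + d < a by rewrite /d; lra.
have dz z : sq d z -> dist_ray (0 + z) <= d + d.
  by move=> /normc_sq zd; rewrite add0r (le_trans (dist_ray_normc _)).
have [M M0 FM] := strip_bounded (d + d) hF.1 Aa.
have tayb z : sq d z -> normc (F z - tay F 0 m * z ^+ m) <= M * (2 / d * normc z) ^+ m.+1.
  move=> zd; have := @taylor _ d M F 0 m.+1 z d0 _ _ zd.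
  rewrite big_ord_recr/= big1 ?add0r => [h|j _]; last by rewrite F0// mul0r.
  apply: h; first by move=> _ [w /dz wd <-]; apply: hF.1; exact: le_lt_trans Aa.
  by move=> w wd; apply: FM; [exact: dz|rewrite add0r normc_sq].
pose r := rho + 1; have r0 : 0 < r by rewrite /r; lra.
have [L L0 FL] := hgrowth_ray a0 hF (ltac:(rewrite /r; lra) : rho < r).
set f := tay F 0 m in tayb *.
(* The first summand comes from the Taylor remainder for x <= d. The other two bound F and f x^m for
   x > d, where powers of x / d are at least 1. *)
pose C := M * (2 / d) ^+ m.+1 + (L / d ^+ m.+1 + normc f / d).
have d1 : 0 < d ^+ m.+1 by exact: exprn_gt0.
have c1 : 0 <= M * (2 / d) ^+ m.+1 by rewrite mulr_ge0// exprn_ge0// divr_ge0// ltW.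
have c2 : 0 <= L / d ^+ m.+1 by rewrite divr_ge0// ltW.
have c3 : 0 <= normc f / d by rewrite divr_ge0 ?normc_ge0// ltW.
have C0 : 0 <= C by rewrite !addr_ge0.
have global x : 0 < x -> normc (F x%:C - f * x%:C ^+ m) <= C * (x ^+ m.+1 * expR (r * x)).
  move=> x0; have e1 : 1 <= expR (r * x) by rewrite -expR0 ler_expR mulr_ge0// ltW.
  have xm : 0 < x ^+ m.+1 by exact: exprn_gt0.
  have [xd|dx] := lerP x d.
    have nx : normc (x%:C : R[i]) = x by rewrite normc_real gtr0_norm.
    have xs : sq d (x%:C : R[i]) by apply: sq_normc; rewrite nx.
    apply: le_trans (tayb _ xs) _; rewrite nx exprMn [leLHS]mulrA.
    apply: ler_pM; rewrite ?(ltW xm)//; first by rewrite /C lerDl addr_ge0.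
    by rewrite ler_peMr// ltW.
  apply: le_trans (normcB _ _) _.
  have h1 : normc (F x%:C) <= L / d ^+ m.+1 * (x ^+ m.+1 * expR (r * x)).
    apply: le_trans (FL x x0) _; rewrite mulrA ler_wpM2r ?expR_ge0// mulrAC ler_pdivlMr//.
    by rewrite ler_wpM2l// lerXn2r ?nnegrE ?ltW.
  have h2 : normc (f * x%:C ^+ m) <= normc f / d * (x ^+ m.+1 * expR (r * x)).
    rewrite normcM normcX normc_real gtr0_norm// -mulrA ler_wpM2l ?normc_ge0//.
    rewrite ler_pdivlMl// exprS -mulrA; apply: ler_pM; rewrite ?(ltW d0) ?exprn_ge0 ?(ltW x0) ?(ltW dx)//.
    by rewrite ler_peMr// exprn_ge0// ltW.
  apply: le_trans (lerD h1 h2) _; rewrite -mulrDl ler_wpM2r ?mulr_ge0 ?expR_ge0 ?(ltW xm)//.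
  by rewrite /C lerDr.
pose sg := Re alpha; pose b := sg + m.+1%:R.
have b1 : -1 < b by rewrite /b -natr1; have : 0 <= m%:R :> R by []; move: al1; rewrite -/sg; lra.
pose K := Rintegral mu H (fun x => x `^ b * expR (- (1 * x))).
have K0 : 0 <= K by apply: Rintegral_ge0 => x _; rewrite mulr_ge0 ?powR_ge0 ?expR_ge0.
(* For y >= 2 r the shifted rate y - r is at least y / 2, which produces 2^(b+1). *)
exists (2 * (C * (K * 2 `^ (b + 1)))), (2 * r); split.
- by rewrite !mulr_ge0 ?powR_ge0.
- by rewrite mulr_gt0.
move=> y yr; have y0 : 0 < y by apply: lt_le_trans yr; rewrite mulr_gt0.
have ry : r < Re (y%:C : R[i]) by rewrite /=; lra.
have yr0 : 0 < y - r by lra.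
have am1 : -1 < Re (alpha + m%:R).
  by rewrite ReD (_ : Re m%:R = m%:R :> R); [rewrite ltr_wpDr|rewrite -(rmorph_nat (@real_complex R))].
have rr : rho < r by rewrite /r; lra.
have j1 := cint_lap al1 ry (hgrowth_cmeas a0 hF) (hgrowth_ray a0 hF rr).
have j2 := cint_lap (F := one) am1 ry (cmeas_cst _ _) (ray_bound1 (ltW r0)).
rewrite /lap -CintegralZ// -CintegralB//; last exact: cintZ.
have ig := integrableZl mH C (int_powR_exp b1 yr0).
apply: le_trans (Cintegral_bound mH _ ig _) _.
- by apply: cint_cmeas; apply: cintB => //; exact: cintZ.
- move=> x xH; have x0 : 0 < x by move: xH; rewrite /= in_itv/= andbT.
  have xmE : rpow x (alpha + m%:R) = rpow x alpha * x%:C ^+ m.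
    rewrite rpowD; congr (_ * _); elim: m {F0 tayb f C d1 c1 c2 c3 C0 global b b1 K K0 am1 j2 ig} => [|m IH]; first by rewrite rpow0 expr0.
    by rewrite -natr1 rpowD IH rpow1// exprSr.
  rewrite xmE (_ : _ - _ = cexp (- (y%:C * x%:C)) * rpow x alpha * (F x%:C - f * x%:C ^+ m)); last by ring.
  rewrite !normcM normc_cexp normc_rpow// ReN cReM /= mulr0 subr0 -/sg.
  apply: le_trans (ler_wpM2l _ (global x x0)) _; first by rewrite mulr_ge0 ?expR_ge0 ?powR_ge0.
  rewrite /b powRD; last by apply/implyP => _; exact: lt0r_neq0.
  rewrite powR_mulrn ?(ltW x0)// mulrBl opprB expRD le_eqVlt.
  by apply/orP; left; apply/eqP; ring.
rewrite RintegralZl//; last exact: int_powR_exp.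
rewrite real_gamma// -/K -!mulrA ler_wpM2l// ler_wpM2l// ler_wpM2l//.
have -> : Re alpha + m%:R + 2 = b + 1 by rewrite /b -natr1 /sg; ring.
rewrite !powRN ler_pdivlMr ?powR_gt0// mulrC ler_pdivrMr ?powR_gt0//.
rewrite -powRM ?(ltW yr0)//.
have e0 : 0 <= b + 1 by lra.
apply: (ge0_ler_powR e0); rewrite ?nnegrE ?(ltW y0) ?mulr_ge0 ?(ltW yr0)//; lra.
Qed.

(* Choose G with the same transform as 1 at exponent 0; if Gamma (alpha + 1) were 0,
   [watson] would make that transform decay too fast. *)
Lemma lap_one_neq0 alpha : -1 < Re alpha -> lap alpha one 1 != 0.
Proof.
move=> al1; apply/eqP => g0.
have zr : -1 < Re (0 : R[i]) by exact: ltrN10.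
have [G hG eG] := change_exponent ltr01 (lexx 0) zr al1 (@hgrowth1 R 1 0 (lexx 0)).
have [|C [X [C0 X0 hC]]] := @watson 1 0 alpha G 0 ltr01 (lexx 0) al1 hG; first by [].
pose g1 := normc (lap 0 one 1 : R[i]).
have g10 : 0 < g1 by rewrite normc_gt0 lap01_neq0.
(* The transform of the constant 1 has modulus [g1], while the decay of that of [G] forces g1 * y <=
   C; this [y] violates it. *)
pose y := X + (C + 1) / g1; have y0 : 0 < y by rewrite addr_gt0// divr_gt0// ltr_wpDl.
have Xy : X <= y by rewrite lerDl ltW// divr_gt0// ltr_wpDl.
have y0' : 0 < Re (y%:C : R[i]) by [].
have lz : lap alpha one y%:C = 0.
  have := gammaE al1 y0'; rewrite g0 => /eqP; rewrite mulf_eq0 => /orP[|/eqP//].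
  by rewrite cpow_real// (negbTE (rpow_neq0 _ _)).
have := hC y Xy; rewrite !addr0 lz mulr0 subr0 => hl.
have := eG y%:C y0'; rewrite cpow0 mul1r => e1.
have := gammaE zr y0'; rewrite add0r -e1 !cpow_real// rpow1// => e2.
have /(congr1 (@normc R)) := e2; rewrite -/g1 !normcM normc_real gtr0_norm// normc_rpow// => e3.
suff : g1 * y <= C.
  rewrite /y mulrDr mulrC [g1 * _]mulrC divfK ?lt0r_neq0//; have := mulr_gt0 X0 g10; lra.
rewrite -e3; set sg := Re alpha in hl *.
apply: (@le_trans _ _ (y * (y `^ sg * (C * y `^ (- (sg + 2)))) * y)).
  by rewrite ler_wpM2r ?(ltW y0)// ler_wpM2l ?(ltW y0)// ler_wpM2l ?powR_ge0.
rewrite le_eqVlt; apply/orP; left; apply/eqP.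
rewrite powRN powRD; last by apply/implyP => _; exact: lt0r_neq0.
rewrite (powR_mulrn 2) ?(ltW y0)//; field.
by rewrite !lt0r_neq0// powR_gt0.
Qed.

(** If f is the first nonzero Taylor coefficient, of index k, then f Gamma(alpha + k + 1) y^(-(alpha
    + k + 1)) dominates the error of [watson], one power smaller, so the transform cannot vanish for
    large y. Hence all coefficients are 0, and [identity_theorem] concludes. *)
Lemma lap_eq0 a rho alpha F B : 0 < a -> 0 <= rho -> -1 < Re alpha -> hgrowth a rho F ->
  (forall y, B < y -> lap alpha F y%:C = 0) -> forall t, strip a t -> F t = 0.
Proof.
move=> a0 rho0 al1 hF l0 t ta; apply: identity_theorem hF.1 ta _ => k.
have [m] := ubnP k; elim: m k => // m IH k km.
have F0 j : (j < k)%N -> tay F 0 j = 0 by move=> jk; apply: IH; exact: leq_trans jk _.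
have [C [X [C0 X0 hC]]] := watson a0 rho0 al1 hF F0.
set f := tay F 0 k in hC *; pose sg := Re alpha + k%:R.
have am : Re (alpha + k%:R) = sg.
  by rewrite ReD (_ : Re k%:R = k%:R :> R)// -(rmorph_nat (@real_complex R)).
have am1 : -1 < Re (alpha + k%:R) by rewrite am /sg ltr_wpDr.
have g0 := lap_one_neq0 am1; apply/eqP; apply: contraT => f0.
pose c := normc f * normc (lap (alpha + k%:R) one 1).
have c0 : 0 < c by rewrite mulr_gt0 ?normc_gt0.
(* Beyond X and B, and large enough to contradict c * y <= C, which the vanishing transform would
   imply. *)
pose y := X + `|B| + (C + 1) / c.
have k0 : 0 < (C + 1) / c by rewrite divr_gt0// ltr_wpDl.
have B0 : 0 <= `|B| by exact: normr_ge0.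
have y0 : 0 < y by rewrite /y; lra.
have Xy : X <= y by rewrite /y; lra.
have By : B < y.
  by have := ler_norm B; rewrite /y; lra.
have := hC y Xy; rewrite l0// sub0r normcNE normcM -/sg => hl.
have := @gammaE R (alpha + k%:R) y%:C am1 y0; rewrite cpow_real// => /(congr1 (@normc R)).
rewrite normcM normc_rpow// ReD am [Re 1]/= => e3.
have : c * y <= C.
  rewrite /c -e3; apply: (@le_trans _ _ (y `^ (sg + 1) * (C * y `^ (- (sg + 2))) * y)).
    rewrite ler_wpM2r ?(ltW y0)// mulrCA ler_wpM2l ?powR_ge0//.
  rewrite le_eqVlt; apply/orP; left; apply/eqP.
  rewrite powRN !powRD; try by apply/implyP => _; exact: lt0r_neq0.
  rewrite powRr1 ?(ltW y0)//; field.
  by rewrite !lt0r_neq0// powR_gt0.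
rewrite /y mulrDr [c * (_ / _)]mulrC divfK ?lt0r_neq0// leNgt.
have : 0 <= c * (X + `|B|) by rewrite mulr_ge0 ?(ltW c0)// addr_ge0// ltW.
by move=> h /negP; case; lra.
Qed.

End Watson.

(** * The operators on germs *)

Section Quotient.
Variables (X Y : Type) (U A : set X) (P Q : X -> Y) (Pi Qi : Y -> X).
Hypotheses (PK : forall x, U x -> Pi (P x) = x) (QK : forall x, U x -> Qi (Q x) = x).
Hypothesis AU : A `<=` U.
Hypothesis PQ : forall x, A x -> exists2 y, A y & Q y = P x.
Hypothesis QP : forall y, A y -> exists2 x, A x & P x = Q y.

(** For x in [A], the value P x is attained by [Q] on [A], so the chosen inverse [Qi] returns a
    genuine preimage. The hypotheses are symmetric in P and Q: exchanging them passes from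
    differentiation to integration. *)
Lemma quotientE x : A x -> Q ((Qi \o P) x) = P x /\ A ((Qi \o P) x).
Proof.
move=> Ax; have [y Ay yx] := PQ Ax; have <- : y = (Qi \o P) x by rewrite /= -yx QK//; exact: AU.
by [].
Qed.

Lemma quotient_bij : set_bij A A (Qi \o P).
Proof.
split.
- by move=> x /quotientE[].
- move=> x y; rewrite !inE => Ax Ay e.
  rewrite -(PK (AU Ax)) -(PK (AU Ay)).
  by rewrite -(quotientE Ax).1 -(quotientE Ay).1 e.
- move=> y Ay; have [x Ax xy] := QP Ay; exists x => //=.
  by rewrite xy QK//; exact: AU.
Qed.

Lemma quotient_hat_bij : set_bij (Q @` A) (Q @` A) (P \o Qi).
Proof.
split.
- move=> _ [x Ax <-]; rewrite /= QK; last exact: AU.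
  by have [y Ay <-] := PQ Ax; exists y.
- move=> s t; rewrite !inE => -[x Ax <-] [y Ay <-]; rewrite /= !QK; try exact: AU.
  by move=> e; rewrite -(PK (AU Ax)) e PK//; exact: AU.
- move=> _ [y Ay <-]; have [x Ax xy] := QP Ay; exists (Q x); first by exists x.
  by rewrite /= QK//; exact: AU.
Qed.

(** The spaces S are images under [Lap], whereas with the roles exchanged [quotient_hat_bij] speaks
    of images under [Lap_pow]; this identifies the two. *)
Lemma quotient_image : Q @` A = P @` A.
Proof.
apply/seteqP; split=> _ [x Ax <-].
  by have [y Ay <-] := QP Ax; exists y.
by have [y Ay <-] := PQ Ax; exists y.
Qed.

End Quotient.

Lemma set_bij_image (X Y : Type) (A : set X) (B : set Y) f : set_bij A B f -> f @` A = B.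
Proof.
by move=> [fA _ fB]; apply/seteqP; split=> [_ [x Ax <-]|]; [exact: fA|exact: fB].
Qed.

(** * Transforms on germs: transfer of exponents and injectivity *)

Section Germs.
Variable R : realType.
Implicit Types (t zeta alpha p q : R[i]) (a rho : R) (F G : R[i] -> R[i]).

Lemma laplace_pow0 F : laplace_pow 0 F = laplace F.
Proof.
apply/funext => zeta; rewrite /laplace_pow cpow0 mul1r; congr (_ zeta).
by apply: eq_laplace => x _; rewrite cpow0 mul1r.
Qed.

(** The ordinary transform is the case of exponent 0, so transfer and injectivity are proved once,
    for [Lap_pow]. *)
Lemma Lap_pow0 : @Lap_pow R 0 = @Lap R.
Proof. by apply/funext => g; rewrite /Lap_pow laplace_pow0. Qed.

Lemma H_spaceU a rho : 0 < a -> 0 <= rho -> H_space a rho `<=` @H_union R.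
Proof. by move=> a0 rho0 g Hg; exists a, rho. Qed.

Lemma Lap_pow_transfer a rho p q g : 0 < a -> 0 <= rho -> -1 < Re p -> -1 < Re q ->
  H_space a rho g -> exists2 h, H_space a rho h & Lap_pow q h = Lap_pow p g.
Proof.
move=> a0 rho0 p1 q1 [F /(in_HP F a0 rho0) hF <-].
have [G hG e] := change_exponent a0 rho0 p1 q1 hF.
exists (\pi_(ray_germ R)%qT G); first by exists G => //; exact/in_HP.
rewrite !Lap_pow_pi; apply/eqquotP/asboolP; exists rho => zeta rz.
by rewrite !laplace_powE !(mulrCA _ zeta) e.
Qed.

Lemma hgrowth_le a b rho sigma F : b <= a -> rho <= sigma -> hgrowth a rho F -> hgrowth b sigma F.
Proof.
move=> ba rs [hF gF]; split; first by move=> t /(strip_le ba); exact: hF.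
by move=> A r Ab sr; apply: gF; [exact: lt_le_trans ba|exact: le_lt_trans sr].
Qed.

(** The two germs may come with different strips and types. On the smaller strip and with the larger
    type both representatives satisfy the growth condition, and the transform of their difference
    vanishes at large real arguments. *)
Lemma Lap_pow_inj alpha g h : -1 < Re alpha -> H_union g -> H_union h ->
  Lap_pow alpha g = Lap_pow alpha h -> g = h.
Proof.
move=> al1 [a [rho [a0 rho0 [F /(in_HP F a0 rho0) hF <-]]]] [b [sigma [b0 sigma0 [G /(in_HP G b0 sigma0) hG <-]]]].
rewrite !Lap_pow_pi => /eqquotP /asboolP [B e]; apply/eqquotP/asboolP.
pose c := Num.min a b; pose tau := Num.max rho sigma.
have c0 : 0 < c by rewrite lt_min a0.
have tau0 : 0 <= tau by rewrite le_max rho0.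
have {}hF : hgrowth c tau F by apply: hgrowth_le hF; rewrite ?ge_min ?le_max lexx.
have {}hG : hgrowth c tau G by apply: hgrowth_le hG; rewrite ?ge_min ?le_max lexx orbT.
have hN := hgrowthZ (-1) hG; have hD := hgrowthD hF hN.
exists c => // t tc; apply/eqP; rewrite -subr_eq0 -mulN1r; apply/eqP.
apply: (lap_eq0 (B := Num.max B (tau + 1)) c0 tau0 al1 hD) tc => y; rewrite gt_max => /andP[By ty].
have r1 : tau < tau + 1 by rewrite ltrDl.
have y0 : 0 < y by lra.
rewrite (lapD al1 (ty : _ < Re y%:C) (hgrowth_cmeas c0 hF) (hgrowth_ray c0 hF r1)
  (hgrowth_cmeas c0 hN) (hgrowth_ray c0 hN r1)).
rewrite (lapZ (-1) al1 (ty : _ < Re y%:C) (hgrowth_cmeas c0 hG) (hgrowth_ray c0 hG r1)).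
have := e y%:C By; rewrite !laplace_powE => /mulfI -/(_ (cexp_neq0 _)) /mulfI -> //.
  by rewrite mulN1r subrr.
by apply/eqP => -[y1]; rewrite y1 ltxx in y0.
Qed.

Lemma Lap_pow_invK alpha g : -1 < Re alpha -> H_union g -> Lap_pow_inv alpha (Lap_pow alpha g) = g.
Proof.
move=> al1 Hg; apply: pinvKV; last by rewrite inE.
by move=> h k; rewrite !inE; exact: Lap_pow_inj.
Qed.

Lemma LapK (g : ray_germ R) : H_union g -> Lap_inv (Lap g) = g.
Proof.
move=> Hg; apply: pinvKV; last by rewrite inE.
by move=> h k; rewrite !inE -Lap_pow0; apply: Lap_pow_inj; exact: ltrN10.
Qed.

End Germs.

Theorem theorem2 (R : realType) (a rho : R) (alpha : R[i])
  (a_gt0 : 0 < a) (rho_ge0 : 0 <= rho) (alpha_gtN1 : -1 < complex.Re alpha) :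
  (* (i); the equations say that frac_diff and frac_int are given by genuine
     values of the inverses of Lap and Lap_pow alpha *)
  (forall F : ray_germ R, H_space a rho F ->
     (Lap (frac_diff alpha F) = Lap_pow alpha F /\
      H_space a rho (frac_diff alpha F)) /\
     (Lap_pow alpha (frac_int alpha F) = Lap F /\
      H_space a rho (frac_int alpha F))) /\
  (* (ii) *)
  ([/\ frac_diff alpha @` H_space a rho = H_space a rho,
       frac_int alpha @` H_space a rho = H_space a rho,
       frac_diff_hat alpha @` S_space a rho = S_space a rho &
       frac_int_hat alpha @` S_space a rho = S_space a rho] /\
   [/\ frac_diff alpha @` H_union = H_union,
       frac_int alpha @` H_union = H_union,
       frac_diff_hat alpha @` S_union = S_union &
       frac_int_hat alpha @` S_union = S_union]) /\
  ([/\ set_bij (H_space a rho) (H_space a rho) (frac_diff alpha),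
       set_bij (H_space a rho) (H_space a rho) (frac_int alpha),
       set_bij (S_space a rho) (S_space a rho) (frac_diff_hat alpha) &
       set_bij (S_space a rho) (S_space a rho) (frac_int_hat alpha)] /\
   [/\ set_bij H_union H_union (frac_diff alpha),
       set_bij H_union H_union (frac_int alpha),
       set_bij S_union S_union (frac_diff_hat alpha) &
       set_bij S_union S_union (frac_int_hat alpha)]).
Proof.
have z1 : -1 < Re (0 : R[i]) by exact: ltrN10.
have fwd b sigma g : 0 < b -> 0 <= sigma -> H_space b sigma g ->
    exists2 h, H_space b sigma h & Lap h = Lap_pow alpha g.
  by rewrite -Lap_pow0 => b0 s0; exact: Lap_pow_transfer.
have bwd b sigma g : 0 < b -> 0 <= sigma -> H_space b sigma g ->
    exists2 h, H_space b sigma h & Lap_pow alpha h = Lap g.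
  by rewrite -Lap_pow0 => b0 s0; exact: Lap_pow_transfer.
have fwdU g : H_union g -> exists2 h, H_union h & Lap h = Lap_pow alpha g.
  move=> [b [sigma [b0 s0 /(fwd _ _ _ b0 s0)[h hh e]]]]; exists h => //.
  exact: H_spaceU hh.
have bwdU g : H_union g -> exists2 h, H_union h & Lap_pow alpha h = Lap g.
  move=> [b [sigma [b0 s0 /(bwd _ _ _ b0 s0)[h hh e]]]]; exists h => //.
  exact: H_spaceU hh.
have K1 := @Lap_pow_invK R alpha ^~ alpha_gtN1; have K2 := @LapK R.
have AU := @H_spaceU R a rho a_gt0 rho_ge0; have UU : @H_union R `<=` H_union by [].
have fwdA g := fwd a rho g a_gt0 rho_ge0; have bwdA g := bwd a rho g a_gt0 rho_ge0.
have D := quotient_bij K1 K2 AU fwdA bwdA; have DU := quotient_bij K1 K2 UU fwdU bwdU.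
have J := quotient_bij K2 K1 AU bwdA fwdA; have JU := quotient_bij K2 K1 UU bwdU fwdU.
have Dh := quotient_hat_bij K1 K2 AU fwdA bwdA; have DhU := quotient_hat_bij K1 K2 UU fwdU bwdU.
have Jh : set_bij (S_space a rho) (S_space a rho) (frac_int_hat alpha).
  by rewrite /S_space (quotient_image fwdA bwdA); exact: quotient_hat_bij K2 K1 AU bwdA fwdA.
have JhU : set_bij S_union S_union (@frac_int_hat R alpha).
  by rewrite /S_union (quotient_image fwdU bwdU); exact: quotient_hat_bij K2 K1 UU bwdU fwdU.
split; [|split; split; split] => //; try exact: set_bij_image.
move=> F HF; split; first exact: quotientE K2 AU fwdA _ HF.
exact: quotientE K1 AU bwdA _ HF.
Qed.
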